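(* There exist countable simple non-amenable hyperlinear groups. Also, there exist finitely generated hyperlinear groups that are not residually amenable.
   Context: Let $R$ be the hyperfinite type II$_1$ factor with its tracial state $\mathrm{Tr}_R$. For an ultrafilter $\omega$ on a countable set $I$ put $R^{(I)}=\{(a_i)_{i\in I}\in\prod_{i\in I}R : \sup_i\|a_i\|<\infty\}$, $J_\omega=\{(a_i)\in R^{(I)} : \lim_\omega \mathrm{Tr}_R(a_ia_i^* )=0\}$ and $R^\omega=R^{(I)}/J_\omega$, with trace $\mathrm{Tr}_\omega((a_i))=\lim_\omega\mathrm{Tr}_R(a_i)$. A countable group is called hyperlinear if it can be faithfully represented by unitary elements of $R^\omega$, i.e. if it admits an injective homomorphism into the unitary group of $R^\omega$ for some ultrafilter $\omega$ on a countable set. A group is residually amenable if every non-identity element has non-trivial image in some amenable quotient of the group. *)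

(* Defs.v *)
From HB Require Import structures.
From mathcomp Require Import all_boot all_order all_algebra.
From mathcomp Require Import complex sesquilinear.
From mathcomp Require Import all_classical all_reals topology normedtype.

Set Implicit Arguments.
Unset Strict Implicit.
Unset Printing Implicit Defensive.

Import Order.TTheory GRing.Theory Num.Theory.
Import numFieldNormedType.Exports.

Local Open Scope classical_set_scope.
Local Open Scope ring_scope.

(* Complex Hilbert spaces. The inner product of [sesquilinear] is linear in its
   first argument and conjugate-linear in the second. *)

Definition dot_norm (R : realType) (H : lmodType R[i])
  (dot : {dot H for Num.conj}) (x : H) : R[i] := sqrtC (dot x x).

Definition dot_complete (R : realType) (H : lmodType R[i])
    (dot : {dot H for Num.conj}) : Prop :=
  forall u : nat -> H,
    (forall e : R[i], 0 < e -> exists N : nat, forall m n : nat,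
       (N <= m)%N -> (N <= n)%N -> dot_norm dot (u m - u n) < e) ->
    exists l : H, forall e : R[i], 0 < e -> exists N : nat, forall n : nat,
      (N <= n)%N -> dot_norm dot (u n - l) < e.

Record hilbertSpace (R : realType) := HilbertSpace {
  hilbert_sort :> lmodType R[i];
  hilbert_dot : {dot hilbert_sort for Num.conj};
  hilbert_complete : dot_complete hilbert_dot }.

(* Operators are plain functions [H -> H], which carry the pointwise vector
   space structure; their product is [\o] and the identity is [idfun]. *)

Section Operators.
Variables (R : realType) (H : hilbertSpace R).

Local Notation operator := (H -> H).
Local Notation "''[' u , v ]" := (hilbert_dot H u v) : ring_scope.
Local Notation "''|' u |" := (dot_norm (hilbert_dot H) u)
  (at level 0, u at level 99, format "''|' u |") : ring_scope.

Definition norm_le (T : operator) (K : R[i]) : Prop :=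
  forall x : H, '|T x| <= K * '|x|.

Definition bounded_operator : set operator :=
  [set T | linear T /\ exists K : R[i], norm_le T K].

Definition is_adjoint (T S : operator) : Prop :=
  forall x y : H, '[T x, y] = '[x, S y].

(* A bounded operator has exactly one adjoint; the value 0 is only taken by
   functions without adjoint, which never occur below. *)
Definition adjoint (T : operator) : operator := xget 0 [set S | is_adjoint T S].

Definition commutant (A : set operator) : set operator :=
  [set T | bounded_operator T /\ forall S, A S -> T \o S = S \o T].

Definition von_neumann_algebra (M : set operator) : Prop :=
  [/\ M `<=` bounded_operator,
      (forall T, M T -> M (adjoint T)) &
      commutant (commutant M) = M].

Definition is_factor (M : set operator) : Prop :=
  [/\ von_neumann_algebra M,
      (exists x : H, x != 0) &
      M `&` commutant M = [set T | exists c : R[i], T = c *: idfun]].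

Definition projection (M : set operator) (p : operator) : Prop :=
  [/\ M p, p \o p = p & adjoint p = p].

(* [p \o q = q] is the order [q <= p] on projections. *)
Definition minimal_projection (M : set operator) (p : operator) : Prop :=
  [/\ projection M p, p <> 0 &
      forall q, projection M q -> p \o q = q -> q = 0 \/ q = p].

(* Murray and von Neumann's notion: 1 is not equivalent to a proper
   subprojection. *)
Definition finite_algebra (M : set operator) : Prop :=
  forall v, M v -> adjoint v \o v = idfun -> v \o adjoint v = idfun.

Definition factor_typeII1 (M : set operator) : Prop :=
  [/\ is_factor M, finite_algebra M & ~ exists p, minimal_projection M p].

Definition findim_star_subalgebra (A : set operator) : Prop :=
  [/\ A `<=` bounded_operator,
      A idfun,
      (forall (c : R[i]) T S, A T -> A S -> A (c *: T + S)),
      (forall T S, A T -> A S -> A (T \o S)) &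
      (forall T, A T -> A (adjoint T)) /\
      exists (n : nat) (b : 'I_n -> operator), forall T, A T ->
        exists c : 'I_n -> R[i], T = \sum_(i < n) c i *: b i].

(* By the bicommutant theorem, the bicommutant of the union is the von Neumann
   algebra it generates. *)
Definition hyperfinite (M : set operator) : Prop :=
  exists A : nat -> set operator,
    [/\ (forall n, findim_star_subalgebra (A n)),
        (forall n, A n `<=` A n.+1) &
        commutant (commutant (\bigcup_n A n)) = M].

(* Only the values of [tr] on [M] matter. On a factor of type II_1 there is
   exactly one tracial state, and it is faithful and normal. *)
Definition tracial_state (M : set operator) (tr : operator -> R[i]) : Prop :=
  [/\ (forall (c : R[i]) a b, M a -> M b -> tr (c *: a + b) = c * tr a + tr b),
      tr idfun = 1,
      (forall a, M a -> 0 <= tr (adjoint a \o a)) &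
      (forall a b, M a -> M b -> tr (a \o b) = tr (b \o a))].

End Operators.

(* By Murray and von Neumann, any two terms of this type are isomorphic by a
   trace-preserving *-isomorphism: this is the hyperfinite II_1 factor. *)
Record hyperfiniteII1Factor (R : realType) := HyperfiniteII1Factor {
  hf_space : hilbertSpace R;
  hf_algebra : set (hf_space -> hf_space);
  hf_trace : (hf_space -> hf_space) -> R[i];
  hf_factor : factor_typeII1 hf_algebra;
  hf_hyperfinite : hyperfinite hf_algebra;
  hf_tracial : tracial_state hf_algebra hf_trace }.

(* The tracial ultrapower, with its elements realized as the cosets of
   [null_families]. *)

Section Ultrapower.
Variables (R : realType) (N : hyperfiniteII1Factor R).
Variables (I : countType) (w : set_system I).

Local Notation family := (I -> hf_space N -> hf_space N).

Definition bounded_families : set family :=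
  [set a | (forall i, hf_algebra (a i)) /\
           exists K : R[i], forall i, norm_le (a i) K].

Definition null_families : set family :=
  [set a | bounded_families a /\
    (fun i => hf_trace (a i \o adjoint (a i)) : R[i]^o) @ w --> (0 : R[i]^o)].

Definition family_mul (a b : family) : family := fun i => a i \o b i.
Definition family_star (a : family) : family := fun i => adjoint (a i).
Definition family_one : family := fun=> idfun.

Definition ucoset (a : family) : set family :=
  [set b | bounded_families b /\ null_families (b - a)].

Definition ultrapower : set (set family) := ucoset @` bounded_families.

(* [null_families] is a two-sided *-ideal: the unions below consist of a single coset. *)
Definition ultrapower_mul (x y : set family) : set family :=
  [set c | exists a b, [/\ x a, y b & ucoset (family_mul a b) c]].

Definition ultrapower_star (x : set family) : set family :=
  [set c | exists2 a, x a & ucoset (family_star a) c].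

Definition ultrapower_one : set family := ucoset family_one.

Definition ultrapower_unitary : set (set family) :=
  [set u | [/\ ultrapower u,
               ultrapower_mul u (ultrapower_star u) = ultrapower_one &
               ultrapower_mul (ultrapower_star u) u = ultrapower_one]].

End Ultrapower.

Definition hyperlinear (R : realType) (G : groupType) : Prop :=
  countable [set: G] /\
  exists (N : hyperfiniteII1Factor R) (I : countType) (w : set_system I),
    UltraFilter w /\
    exists rho : G -> set (I -> hf_space N -> hf_space N),
      [/\ (forall g, ultrapower_unitary w (rho g)),
          (forall g h, rho (g * h)%g = ultrapower_mul w (rho g) (rho h)) &
          injective rho].

Section Groups.
Variable G : groupType.
Implicit Types N : set G.

Definition subgroup_set N : Prop :=
  N 1%g /\ forall x y, N x -> N y -> N (x * y^-1)%g.

Definition normal_subgroup N : Prop :=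
  subgroup_set N /\ forall x g, N x -> N (x ^ g)%g.

Definition simple_group : Prop :=
  (exists x : G, x <> 1%g) /\
  forall N, normal_subgroup N -> N = [set 1%g] \/ N = [set: G].

Definition finitely_generated : Prop :=
  exists s : seq G, forall N, subgroup_set N -> [set` s] `<=` N -> N = [set: G].

End Groups.

(* A left-invariant finitely additive probability measure on all subsets. *)
Definition amenable (R : realType) (G : groupType) : Prop :=
  exists mu : set G -> R,
    [/\ (forall A, 0 <= mu A),
        mu [set: G] = 1,
        (forall A B, A `&` B = set0 -> mu (A `|` B) = mu A + mu B) &
        (forall g A, mu [set (g * x)%g | x in A] = mu A)].

Definition residually_amenable (R : realType) (G : groupType) : Prop :=
  forall g : G, g <> 1%g ->
    exists (Q : groupType) (f : {multiplicative G -> Q}),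
      [/\ amenable R Q, (forall q : Q, exists x : G, f x = q) & f g <> 1%g].

(* Main.v *)
(** Both groups are embedded, locally, in finite symmetric groups, and these in
    the unitary group of one hyperfinite II_1 factor.

    The factor is the von Neumann algebra of the group of finitary permutations
    of nat. That group is a union of finite groups, hence hyperfiniteness, and
    has infinite conjugacy classes, hence trivial centre. An operator in the
    algebra is determined by its value at the basis vector of 1, whose
    coefficient at 1 is the trace. To split a projection p, take a projection e
    in a finite-dimensional subalgebra with e p <> 0 and tr e < tr p; the powers
    of p (1 - e) p decrease strongly to the projection q on the intersection of
    the ranges of p and 1 - e (von Neumann's alternating projections), and
    traciality gives tr q >= tr p - tr e.

    The simple group is PSL_2(Q), approximated by reduction modulo primes; it is
    simple because iterated commutators with a non-scalar matrix yield all
    unipotents, which generate. It is not amenable because three translates of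
    {|x| <= |y|} by shears are disjoint, and similarly for {|y| <= |x|}.

    The finitely generated group is generated, in an ultraproduct of the
    symmetric groups of F_p^2, by two shears and one transposition. It contains
    all transpositions of points of the orbit of (1, 0) in Z^2. A normal subgroup
    moving some point of the orbit contains all 3-cycles, so a quotient in which
    a 3-cycle survives still acts on the orbit, and is not amenable. *)

From HB Require Import structures.
Require Import Defs.
From mathcomp Require Import all_boot all_order all_fingroup all_algebra.
From mathcomp Require Import finmap complex sesquilinear ring lra.
From mathcomp Require Import all_classical all_reals topology normedtype.

Set Implicit Arguments.
Unset Strict Implicit.
Unset Printing Implicit Defensive.

Import Order.TTheory GRing.Theory Num.Theory.
Import numFieldNormedType.Exports.

Local Open Scope classical_set_scope.
Local Open Scope ring_scope.

Local Notation "x %:C" := (real_complex _ x) (format "x %:C") : ring_scope.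

(** * Unconditional sums *)

Section Totally.
Context {T : choiceType}.

(** Any realization of the hyperfinite factor may be chosen, so all operators act on square-summable
    families over a single group. There the canonical basis replaces the Riesz theorem, and the map
    from [T] to [T d1] replaces general trace theory. Distinct permutations give orthogonal vectors,
    so an approximation only has to be multiplicative and injective at almost all indices for each
    pair of elements; no metric on symmetric groups enters. The delicate axiom is the absence of
    minimal projections: a projection of the bicommutant need not lie in any finite stage, and
    powers of a self-adjoint contraction replace its spectral calculus. The shear coefficient 3 is
    the least integer for which three translates of a closed cone without its apex are disjoint;
    each cone then has measure at most 1/3, while two cones cover everything. The two shears alone
    generate a group of integer matrices, which is residually finite. The transposition is what
    destroys this: it joins neighbouring points of the orbit and so produces 3-cycles, which no
    amenable quotient can retain. *)

Definition totally : set_system {fset T} :=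
  filter_from setT (fun A => [set B | (A `<=` B)%fset]).

#[local] Instance totally_filter : ProperFilter totally.
Proof.
eapply filter_from_proper; last by move=> A _; exists A; rewrite /= fsubset_refl.
apply: filter_fromT_filter; first by exists fset0.
by move=> A B /=; exists (A `|` B)%fset => P /=; rewrite fsubUset => /andP[].
Qed.

End Totally.
#[global] Existing Instance totally_filter.

Section UnconditionalSums.
Variables (R : realType) (T : choiceType).
Local Notation C := R[i].
Implicit Types (f g : T -> C) (s : C) (F : {fset T}).

Definition psum f F : C := \sum_(x <- F) f x.

Definition has_sum f s := (psum f : _ -> C^o) @ totally --> (s : C^o).

Lemma has_sumP f s : (forall e : C, 0 < e -> exists F0 : {fset T},
    forall F, (F0 `<=` F)%fset -> `|s - psum f F| < e) <-> has_sum f s.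
Proof.
split=> [h|/cvgrPdist_lt h e /h [F _ hF]]; last by exists F => G FG; exact: hF.
apply/cvgrPdist_lt => e /h [F hF]; exists F => // G /= FG; exact: hF.
Qed.

Lemma has_sum_unique f s s' : has_sum f s -> has_sum f s' -> s = s'.
Proof. exact: (@cvg_unique _ (@norm_hausdorff C C^o)). Qed.

Lemma has_sumD f g s t : has_sum f s -> has_sum g t ->
  has_sum (fun x => f x + g x) (s + t).
Proof.
move=> hf hg; rewrite /has_sum.
have -> : psum (fun x => f x + g x) = psum f + psum g.
  by apply/funext => F; rewrite /psum big_split.
exact: (@cvgD C C^o _ totally _ _ _ _ _ hf hg).
Qed.

Lemma has_sumZ c f s : has_sum f s -> has_sum (fun x => c * f x) (c * s).
Proof.
move=> hf; rewrite /has_sum (_ : psum _ = (fun F => c *: psum f F)).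
  exact: cvgZl_tmp.
by apply/funext => F; rewrite /psum -mulr_sumr.
Qed.

Lemma has_sum_conj f s : has_sum f s -> has_sum (fun x => (f x)^*) s^*.
Proof.
move=> /has_sumP h; apply/has_sumP => e /h [F0 hF]; exists F0 => F /hF.
by rewrite /psum -rmorph_sum -rmorphB norm_conjC.
Qed.

Lemma psum_mono f F G : (forall x, 0 <= f x) -> (F `<=` G)%fset ->
  psum f F <= psum f G.
Proof.
move=> f0 /fsubsetP FG; rewrite /psum [leRHS](bigID (mem F)) /=.
rewrite [X in _ <= X + _](_ : _ = \sum_(x <- F) f x); last first.
  rewrite -big_filter; apply: perm_big; apply: uniq_perm => [||x].
  - by rewrite filter_uniq // fset_uniq.
  - exact: fset_uniq.
  by rewrite mem_filter andb_idr // => xF; exact: FG.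
by rewrite lerDl; apply: sumr_ge0.
Qed.

Lemma has_sum_real f s : (forall x, f x \is Num.real) -> has_sum f s -> s \is Num.real.
Proof.
move=> fr hf; apply/CrealP/(has_sum_unique _ hf).
by rewrite [X in has_sum X _](_ : f = fun x => (f x)^*); [exact: has_sum_conj|];
  apply/funext => x; rewrite conj_Creal.
Qed.

Lemma has_sum_ge f s F : (forall x, 0 <= f x) -> has_sum f s -> psum f F <= s.
Proof.
move=> f0 hf; have sr : s \is Num.real.
  by apply: has_sum_real hf => x; rewrite ger0_real.
have pr G : psum f G \is Num.real by rewrite ger0_real // sumr_ge0.
rewrite real_leNgt //; apply/negP => sF.
have := hf; move/has_sumP => /(_ (psum f F - s)); rewrite subr_gt0 => /(_ sF)[G hG].
have := hG (F `|` G)%fset (fsubsetUr _ _).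
rewrite distrC ger0_norm; first by rewrite ltrD2r le_gtF // psum_mono // fsubsetUl.
by rewrite subr_ge0 (le_trans (ltW sF)) // psum_mono // fsubsetUl.
Qed.

Lemma has_sum_le f s (K : C) : (forall x, 0 <= f x) -> has_sum f s ->
  (forall F, psum f F <= K) -> s <= K.
Proof.
move=> f0 hf fK; have sr : s \is Num.real.
  by apply: has_sum_real hf => x; rewrite ger0_real.
have Kr : K \is Num.real.
  by rewrite ger0_real // (le_trans _ (fK fset0)) // sumr_ge0.
rewrite real_leNgt //; apply/negP => sK.
have := hf; move/has_sumP => /(_ (s - K)); rewrite subr_gt0 => /(_ sK)[G /(_ G)].
rewrite fsubset_refl => /(_ isT); rewrite ger0_norm ?subr_ge0 ?has_sum_ge//.
by rewrite ltrD2l ltrN2 le_gtF.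
Qed.

Lemma has_sum_fin f F : (forall x, x \notin F -> f x = 0) -> has_sum f (psum f F).
Proof.
move=> f0; apply/has_sumP => e e0; exists F => G /fsubsetP FG.
rewrite (_ : psum f G = psum f F) ?subrr ?normr0 // /psum.
rewrite (bigID (mem F)) /= addrC big1 ?add0r => [|x /f0//].
rewrite -big_filter; apply: perm_big; apply: uniq_perm => [||x].
- by rewrite filter_uniq // fset_uniq.
- exact: fset_uniq.
by rewrite mem_filter andb_idr // => xF; exact: FG.
Qed.

Lemma has_sum_bij f s (p q : T -> T) : cancel p q -> cancel q p ->
  has_sum f s -> has_sum (f \o p) s.
Proof.
move=> pK qK /has_sumP h; apply/has_sumP => e /h [F0 hF].
exists [fset q x | x in F0]%fset => G /fsubsetP FG.
have -> : psum (f \o p) G = psum f [fset p x | x in G]%fset.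
  by rewrite /psum big_imfset //= => x y _ _; exact: can_inj.
apply: hF; apply/fsubsetP => x xF; apply/imfsetP; exists (q x); last by rewrite qK.
by apply: FG; apply/imfsetP; exists x.
Qed.

(** Partial sums are real and increase with the index set, so their supremum is the sum. The bound
    is taken in [R], where suprema exist. *)
Lemma has_sum_nonneg f (K : R) : (forall x, 0 <= f x) ->
  (forall F, psum f F <= K%:C) -> exists s, has_sum f s.
Proof.
move=> f0 fK; pose g F := complex.Re (psum f F).
have gE F : psum f F = (g F)%:C.
  by rewrite RRe_real // ger0_real // sumr_ge0.
have gK : has_sup (range g).
  split; first by exists (g fset0); exists fset0.
  by exists K => _ [F _ <-]; rewrite -lecR -gE.
exists (sup (range g))%:C; apply/has_sumP => e e0.
have eE : e = (complex.Re e)%:C by rewrite RRe_real // gtr0_real.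
rewrite eE in e0 *; rewrite ltcR in e0.
have [_ [F _ <-] hF] := sup_adherent e0 gK.
exists F => G FG; rewrite gE -rmorphB /= ger0_norm ?ler0c ?ltcR ?subr_ge0.
  have : g F <= g G by rewrite -lecR -!gE psum_mono.
  lra.
by apply: sup_ubound; [exact: gK.2 | exists G].
Qed.

Let normC_Im_le (z : C) : `|'Im z| <= `|z|.
Proof.
rewrite -(@ler_pXn2r _ 2) ?nnegrE ?normr_ge0 // real_normK ?Creal_Im // normC2_Re_Im.
by rewrite lerDr real_exprn_even_ge0 // Creal_Re.
Qed.

(** For real [h] with [|h| <= g], the family [h + g] is non-negative with partial sums at most
    [K + K]; the sum of [g] is subtracted afterwards. Real and imaginary parts are treated
    separately. *)
Lemma has_sum_dominated f (g : T -> C) (K : R) : (forall x, `|f x| <= g x) ->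
  (forall F, psum g F <= K%:C) -> exists s, has_sum f s.
Proof.
move=> fg gK.
have g0 x : 0 <= g x by exact: le_trans (fg x).
have aux (h : T -> C) : (forall x, `|h x| <= g x) -> (forall x, h x \is Num.real) ->
    exists s, has_sum h s.
  move=> hg hr.
  have [|F|s hs] := @has_sum_nonneg (fun x => h x + g x) (K + K).
  - move=> x; have := hg x; rewrite real_ler_norml // => /andP[+ _].
    by rewrite -subr_ge0 opprK addrC.
  - rewrite /psum big_split /= rmorphD lerD // (le_trans _ (gK F)) //.
    by apply: ler_sum => x _; apply: le_trans (hg x); exact: real_ler_norm.
  have [t ht] := @has_sum_nonneg g K g0 gK.
  have hst := has_sumD hs (@has_sumZ (-1) _ _ ht); exists (s + -1 * t); move: hst.
  by congr has_sum; apply/funext => x; rewrite mulN1r addrK.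
have [s hs] := aux (fun x => 'Re (f x))
  (fun x => le_trans (leif_normC_Re_Creal (f x)).1 (fg x)) (fun x => Creal_Re _).
have [t ht] := aux (fun x => 'Im (f x))
  (fun x => le_trans (normC_Im_le (f x)) (fg x)) (fun x => Creal_Im _).
have hst := has_sumD hs (@has_sumZ 'i _ _ ht); exists (s + 'i * t); move: hst.
by congr has_sum; apply/funext => x; rewrite -Crect.
Qed.

End UnconditionalSums.

Arguments has_sum_unique {R T f s s'} _ _.
Arguments has_sumD {R T f g s t} _ _.
Arguments has_sumZ {R T} c {f s} _.
Arguments has_sum_conj {R T f s} _.
Arguments has_sum_bij {R T f s p q} _ _ _.
Arguments has_sum_real {R T f s} _ _.
Arguments has_sum_ge {R T f s} F _ _.
Arguments has_sum_le {R T f s} K _ _ _.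
Arguments has_sum_fin {R T f} F _.

(** * The Hilbert space of square-summable families *)

Section SquareSummable.
Variables (R : realType) (T : choiceType).
Local Notation C := R[i].
Implicit Types (f g : T -> C).

Definition sqsum f : Prop :=
  exists K : R, forall F : {fset T}, psum (fun x => `|f x| ^+ 2) F <= K%:C.

Lemma normC_sqrD_le (a b : C) : `|a + b| ^+ 2 <= 2 * `|a| ^+ 2 + 2 * `|b| ^+ 2.
Proof.
have -> : 2 * `|a| ^+ 2 + 2 * `|b| ^+ 2 = `|a + b| ^+ 2 + `|a - b| ^+ 2.
  by rewrite !normCK !rmorphD !rmorphN; ring.
by rewrite lerDl exprn_ge0.
Qed.

Definition sqsum_pred : {pred T -> C} := fun f => `[< sqsum f >].

Lemma sqsum_submod : submod_closed sqsum_pred.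
Proof.
split=> [|c f g /asboolP[K fK] /asboolP[L gL]].
  by apply/asboolP; exists 0 => F; rewrite /psum big1 // => x _; rewrite normr0 expr0n.
apply/asboolP; exists (2 * (complex.Re (`|c| ^+ 2) * K) + 2 * L) => F.
have cE : (complex.Re (`|c| ^+ 2))%:C = `|c| ^+ 2.
  by rewrite RRe_real // ger0_real // exprn_ge0.
rewrite rmorphD !rmorphM /= cE.
rewrite (_ : 2%:C = 2); last by rewrite -(rmorph_nat (real_complex R)).
apply: (@le_trans _ _ (2 * (`|c| ^+ 2 * psum (fun x => `|f x| ^+ 2) F)
                        + 2 * psum (fun x => `|g x| ^+ 2) F)).
  rewrite /psum !mulr_sumr -big_split; apply: ler_sum => x _ /=.
  by rewrite -exprMn -normrM normC_sqrD_le.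
by rewrite lerD // ler_wpM2l // ler_wpM2l // exprn_ge0.
Qed.

Record ell2 := Ell2 { ell2_fun :> T -> C; _ : ell2_fun \in sqsum_pred }.

HB.instance Definition _ := [isSub for ell2_fun].
HB.instance Definition _ := [Choice of ell2 by <:].
HB.instance Definition _ :=
  GRing.isSubmodClosed.Build C (T -> C) sqsum_pred sqsum_submod.
HB.instance Definition _ := [SubChoice_isSubLmodule of ell2 by <:].

Implicit Types u v w : ell2.

Lemma ell2_eq u v : (forall x, u x = v x) -> u = v.
Proof. by move=> uv; apply/val_inj/funext. Qed.

Lemma ell2_sqsum u : sqsum u. Proof. by case: u => f /= /asboolP. Qed.

Lemma ell2D u v x : (u + v) x = u x + v x. Proof. by []. Qed.
Lemma ell2N u x : (- u) x = - u x. Proof. by []. Qed.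
Lemma ell2Z c u x : (c *: u) x = c * u x. Proof. by []. Qed.
Lemma ell20 x : (0 : ell2) x = 0. Proof. by []. Qed.

Definition mkell2 f (fP : sqsum f) : ell2 := Ell2 (asboolT fP).

(** The default 0 never stands for a missing sum: [ell2_dotP] finds one for every pair. *)
Definition ell2_dot u v : C := xget 0 (has_sum (fun x => u x * (v x)^*)).

Lemma ell2_dotP u v : has_sum (fun x => u x * (v x)^*) (ell2_dot u v).
Proof.
have [K uK] := ell2_sqsum u; have [L vL] := ell2_sqsum v.
apply: xgetPex.
apply: (@has_sum_dominated _ _ _ (fun x => `|u x| ^+ 2 + `|v x| ^+ 2) (K + L)).
  move=> x; rewrite normrM norm_conjC.
  rewrite -subr_ge0.
  have -> : `|u x| ^+ 2 + `|v x| ^+ 2 - `|u x| * `|v x|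
      = (`|u x| - `|v x|) ^+ 2 + `|u x| * `|v x| by ring.
  apply: addr_ge0; last exact: mulr_ge0.
  by rewrite real_exprn_even_ge0 ?rpredB ?normr_real.
by move=> F; rewrite /psum big_split rmorphD lerD ?uK ?vL.
Qed.
Arguments ell2_dotP : clear implicits.

Lemma ell2_dot_eq u v s : has_sum (fun x => u x * (v x)^*) s -> ell2_dot u v = s.
Proof. exact: has_sum_unique (ell2_dotP u v). Qed.
Arguments ell2_dot_eq {u v s} _.

Lemma ell2_dotC u v : ell2_dot v u = (ell2_dot u v)^*.
Proof.
apply: ell2_dot_eq; have := has_sum_conj (ell2_dotP u v).
by congr has_sum; apply/funext => x; rewrite rmorphM /= conjCK mulrC.
Qed.

Lemma ell2_dot_linear v : scalar (ell2_dot ^~ v).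
Proof.
move=> c u w; apply: ell2_dot_eq.
have := has_sumD (has_sumZ c (ell2_dotP u v)) (ell2_dotP w v).
by congr has_sum; apply/funext => x; rewrite ell2D ell2Z mulrDl mulrA.
Qed.

Lemma ell2_dot_linearr u : linear_for (Num.conj \; *%R) (ell2_dot u).
Proof.
by move=> c v w; rewrite ell2_dotC ell2_dot_linear rmorphD rmorphM /= -!ell2_dotC.
Qed.

HB.instance Definition _ := @bilinear_isBilinear.Build C ell2 ell2 C
  ( *%R ) (Num.conj \; *%R) ell2_dot (ell2_dot_linear, ell2_dot_linearr).

Lemma ell2_dot_herm u v : ell2_dot u v = (-1) ^+ false * (ell2_dot v u)^*.
Proof. by rewrite expr0 mul1r ell2_dotC. Qed.

HB.instance Definition _ :=
  isHermitianSesquilinear.Build C ell2 false Num.conj ell2_dot ell2_dot_herm.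

Lemma ell2_normP u : has_sum (fun x => `|u x| ^+ 2) (ell2_dot u u).
Proof.
by have := ell2_dotP u u; congr has_sum; apply/funext => x; rewrite normCK.
Qed.
Arguments ell2_normP : clear implicits.

Lemma ell2_psum_le u F : psum (fun x => `|u x| ^+ 2) F <= ell2_dot u u.
Proof. by apply: has_sum_ge (ell2_normP u) => x; rewrite exprn_ge0. Qed.

Lemma ell2_coord_le u x : `|u x| ^+ 2 <= ell2_dot u u.
Proof. by have := ell2_psum_le u [fset x]%fset; rewrite /psum big_seq_fset1. Qed.

Lemma ell2_dot_gt0 u : u != 0 -> 0 < ell2_dot u u.
Proof.
move=> u0; have [x ux] : exists x, u x != 0.
  apply/not_existsP => h; move/eqP: u0; apply; apply: ell2_eq => x.
  by apply/eqP/negP => /negP /h.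
by apply: lt_le_trans (ell2_coord_le u x); rewrite exprn_gt0 // normr_gt0.
Qed.

HB.instance Definition _ := isDotProduct.Build C ell2 ell2_dot ell2_dot_gt0.


Local Notation "''[' u , v ]" := (ell2_dot u v) : ring_scope.

Lemma delta_sqsum (a : T) : sqsum (fun x => (x == a)%:R).
Proof.
exists 1 => F.
apply: (@le_trans _ _ (psum (fun x => `|(x == a)%:R : C| ^+ 2) (a |` F)%fset)).
  by apply: psum_mono => [x|]; [rewrite exprn_ge0 | exact: fsubsetU1].
rewrite /psum (bigD1_seq a) ?fset_uniq ?fset1U1 //= eqxx normr1 expr1n big1 ?addr0//.
by move=> x /negPf ->; rewrite normr0 expr0n.
Qed.

Definition delta a : ell2 := mkell2 (delta_sqsum a).

Lemma ell2_dot_delta u a : '[u, delta a] = u a.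
Proof.
apply: ell2_dot_eq.
have -> : u a = psum (fun x => u x * (delta a x)^*) [fset a]%fset.
  by rewrite /psum big_seq_fset1 /= eqxx conjC1 mulr1.
apply: has_sum_fin => x; rewrite inE /= => /negPf ->; by rewrite conjC0 mulr0.
Qed.

Definition trunc (f : T -> C) (F : {fset T}) : ell2 := \sum_(x <- F) f x *: delta x.

Lemma ell2_sum (I : Type) (r : seq I) (E : I -> ell2) x :
  (\sum_(i <- r) E i) x = \sum_(i <- r) E i x.
Proof. by elim/big_rec2: _ => [|i y z _ <-]; rewrite ?ell20 ?ell2D. Qed.

Lemma truncE f F x : trunc f F x = f x * (x \in F)%:R.
Proof.
rewrite /trunc ell2_sum; have [xF|xF] := boolP (x \in F).
  rewrite (bigD1_seq x) ?fset_uniq // ell2Z /= eqxx big1 ?addr0 // => y.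
  by move=> /negPf yx; rewrite -[LHS]/(f y * (x == y)%:R) eq_sym yx mulr0.
rewrite mulr0 big_seq big1 // => y yF; rewrite ell2Z /=.
by case: eqP => [xy|]; rewrite ?mulr0 //; rewrite xy yF in xF.
Qed.

(** The difference [u - trunc u F] is zero on [F] and [u] off [F], so the squared norms subtract.
    This yields the density of finitely supported vectors. *)
Lemma trunc_dist u F : '[u - trunc u F, u - trunc u F] =
  '[u, u] - psum (fun x => `|u x| ^+ 2) F.
Proof.
apply: (has_sum_unique (ell2_normP _)).
have hF : has_sum (fun x => - (`|u x| ^+ 2 * (x \in F)%:R))
    (- psum (fun x => `|u x| ^+ 2) F).
  have -> : - psum (fun x => `|u x| ^+ 2) F =
            psum (fun x => - (`|u x| ^+ 2 * (x \in F)%:R)) F.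
    rewrite /psum sumrN; congr (- _); apply: eq_big_seq => x xF.
    by rewrite xF mulr1.
  by apply: has_sum_fin => x /negPf ->; rewrite mulr0 oppr0.
have := has_sumD (ell2_normP u) hF; congr has_sum; apply/funext => x.
rewrite ell2D ell2N truncE; case: (x \in F); rewrite ?mulr1 ?mulr0 ?subrr ?subr0 //.
by rewrite normr0 expr0n.
Qed.

Lemma trunc_dense u (e : C) : 0 < e ->
  exists F, '[u - trunc u F, u - trunc u F] < e.
Proof.
move=> /(proj2 (has_sumP _ _) (ell2_normP u))[F /(_ F)].
rewrite fsubset_refl => /(_ isT) h; exists F; rewrite trunc_dist.
by apply: le_lt_trans h; apply: real_ler_norm; rewrite -trunc_dist ger0_real // dnorm_ge0.
Qed.


Lemma C_complete (a : nat -> C) :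
  (forall e : C, 0 < e -> exists N : nat, forall m n : nat,
     (N <= m)%N -> (N <= n)%N -> `|a m - a n| < e) ->
  exists l : C, forall e : C, 0 < e -> exists N : nat, forall n : nat,
     (N <= n)%N -> `|a n - l| < e.
Proof.
move=> ca.
have ni : `|'i%C : C| = 1 by rewrite normc_def /= expr0n expr1n add0r sqrtr1.
have aux (p : C -> R) : (forall x y, p (x - y) = p x - p y) ->
    (forall x, `|p x|%:C <= `|x|) ->
    exists l : R, forall e : R, 0 < e -> exists N : nat, forall n : nat,
      (N <= n)%N -> `|p (a n) - l| < e.
  move=> pB ple; have : cvg ((fun n => p (a n) : R^o) @ \oo).
    apply/cauchy_cvgP/cauchyP => e e0.
    have [|N hN] := ca e%:C; first by rewrite ltcR.
    exists (p (a N)); exists N => // n /= Nn.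
    rewrite -ball_normE /ball_ /= -pB -ltcR.
    by apply: le_lt_trans (ple _) _; exact: hN.
  move=> /cvg_ex[l hl]; exists l => e e0.
  move/cvgrPdist_lt : hl => /(_ e e0)[N _ hN]; exists N => n Nn.
  by rewrite distrC; exact: hN.
have [|x|l hl] := aux (@complex.Re R); first by case=> ? ? [].
  exact: normc_ge_Re.
have [|x|k hk] := aux (@complex.Im R); first by case=> ? ? [].
  rewrite (_ : complex.Im x = - complex.Re (x * 'i%C)); last by rewrite ReiNIm opprK.
  by rewrite normrN (le_trans (normc_ge_Re _)) // normrM ni mulr1.
exists (Complex l k) => e e0.
have eE : e = (complex.Re e)%:C by rewrite RRe_real // gtr0_real.
have e0' : 0 < complex.Re e / 2 by rewrite divr_gt0 // -ltcR -eE.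
have [N hN] := hl _ e0'; have [M hM] := hk _ e0'; exists (maxn N M) => n.
rewrite geq_max => /andP[/hN h1 /hM h2].
rewrite [X in `|X|]complexE (le_lt_trans (ler_normD _ _)) // normrM.
rewrite ni mul1r eE !normc_def /= !expr0n /= !addr0 !sqrtr_sqr -rmorphD ltcR.
case: (a n) h1 h2 => x y /= h1 h2; lra.
Qed.

(** A Cauchy sequence converges at each coordinate. To bound the distance to the pointwise limit on
    a finite set [F], [u n] is compared with some [u m], where [m] depends on [F] but the resulting
    bound does not. *)
Lemma ell2_complete : dot_complete [the {dot ell2 for Num.conj} of ell2_dot].
Proof.
move=> u cu.
have cu2 (e : C) : 0 < e -> exists N : nat, forall m n : nat,
    (N <= m)%N -> (N <= n)%N -> '[u m - u n, u m - u n] < e.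
  move=> e0; have [|N hN] := cu (sqrtC e); first by rewrite sqrtC_gt0.
  by exists N => m n Nm Nn; have := hN m n Nm Nn;
    rewrite /dot_norm ltr_sqrtC // ?nnegrE ?dnorm_ge0 // ltW.
have pt x : exists l : C, forall e : C, 0 < e -> exists N : nat, forall n : nat,
     (N <= n)%N -> `|u n x - l| < e.
  apply: C_complete => e e0; have [|N hN] := cu2 (e ^+ 2); first by rewrite exprn_gt0.
  exists N => m n Nm Nn; have := le_lt_trans (ell2_coord_le _ x) (hN m n Nm Nn).
  by rewrite ltr_pXn2r ?nnegrE ?normr_ge0 ?(ltW e0).
have [l hl] := choice pt.
have fin (s : seq T) (e : C) : 0 < e -> exists M, forall m, (M <= m)%N ->
    \sum_(x <- s) `|u m x - l x| ^+ 2 < e.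
  elim: s e => [|x s IH] e e0; first by exists 0%N => m _; rewrite big_nil.
  have e20 : 0 < e / 2 by rewrite divr_gt0.
  have [M hM] := IH _ e20.
  have [|M' hM'] := hl x (sqrtC (e / 2)); first by rewrite sqrtC_gt0.
  exists (maxn M M') => m; rewrite geq_max => /andP[/hM h /hM' h'].
  rewrite big_cons [e](_ : _ = e / 2 + e / 2) ?ltrD //; last by field.
  by rewrite -[ltRHS]sqrtCK ltr_pXn2r // ?nnegrE // sqrtC_ge0 ltW.
have bd (e : C) : 0 < e -> exists N, forall n, (N <= n)%N -> forall F,
    psum (fun x => `|u n x - l x| ^+ 2) F <= 4 * e.
  move=> e0; have [N hN] := cu2 e e0; exists N => n Nn F.
  have [M hM] := fin F e e0.
  pose m := maxn N M.
  apply: (@le_trans _ _ (2 * psum (fun x => `|(u n - u m) x| ^+ 2) F +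
                         2 * psum (fun x => `|u m x - l x| ^+ 2) F)).
    rewrite /psum !mulr_sumr -big_split /=; apply: ler_sum => x _.
    have -> : u n x - l x = (u n - u m) x + (u m x - l x).
      by rewrite ell2D ell2N addrA subrK.
    exact: normC_sqrD_le.
  rewrite [4 * e](_ : _ = 2 * e + 2 * e); last by ring.
  rewrite lerD // ler_wpM2l //.
    by rewrite (le_trans (ell2_psum_le _ _)) // ltW // hN // leq_maxl.
  by rewrite ltW // hM // leq_maxr.
have lP : sqsum l.
  have [N /(_ N (leqnn N)) hN] := bd 1 ltr01.
  have dP : sqsum (fun x => u N x - l x).
    by exists 4 => F; rewrite (le_trans (hN F)) // mulr1 (rmorph_nat (real_complex R)).
  have : sqsum (u N - mkell2 dP) by exact: ell2_sqsum.
  congr sqsum; apply/funext => x; rewrite -[LHS]/(u N x - (u N x - l x)).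
  by rewrite opprB addrC subrK.
exists (mkell2 lP) => e e0.
(* The factor 4 of [bd] turns [e ^+ 2 / 8] into [e ^+ 2 / 2], strictly below [e ^+ 2]. *)
have e80 : 0 < e ^+ 2 / 8 by rewrite divr_gt0 // exprn_gt0.
have [N hN] := bd _ e80; exists N => n Nn.
have -> : e = sqrtC (e ^+ 2) by rewrite sqrCK // ltW.
rewrite /dot_norm ltr_sqrtC ?nnegrE ?dnorm_ge0 ?exprn_ge0 ?(ltW e0) //.
apply: (@le_lt_trans _ _ (4 * (e ^+ 2 / 8))).
  by apply: has_sum_le (ell2_normP _) _ => [x|]; [rewrite exprn_ge0 | exact: hN].
have -> : 4 * (e ^+ 2 / 8) = e ^+ 2 / 2 by field.
by rewrite ltr_pdivrMr // ltr_pMr ?exprn_gt0 // ltr1n.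
Qed.

Definition ell2_hilbert : hilbertSpace R := HilbertSpace ell2_complete.

End SquareSummable.

Arguments ell2_dotP {R T} u v.
Arguments ell2_dot_eq {R T u v s} _.
Arguments ell2_normP {R T} u.

(** * Bounded operators and commutants *)

Section LinearFacts.
Variables (K : fieldType) (V W : lmodType K) (T : V -> W).
Hypothesis lT : linear T.
Let mT : {linear V -> W} := HB.pack T (GRing.isLinear.Build K V W *:%R T lT).

Lemma linear_D u v : T (u + v) = T u + T v. Proof. exact: (linearD mT). Qed.
Lemma linear_B u v : T (u - v) = T u - T v. Proof. exact: (linearB mT). Qed.
Lemma linear_Z c u : T (c *: u) = c *: T u. Proof. exact: (linearZ_LR mT). Qed.
Lemma linear_sum_seq (I : Type) (r : seq I) (E : I -> V) :
  T (\sum_(i <- r) E i) = \sum_(i <- r) T (E i).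
Proof. exact: (linear_sum mT). Qed.
End LinearFacts.

Section Operators.
Variables (R : realType) (H : hilbertSpace R).
Local Notation C := R[i].
Local Notation operator := (H -> H).
Local Notation "''[' u , v ]" := (hilbert_dot H u v) : ring_scope.
Local Notation "''[' u ]" := (hilbert_dot H u u) : ring_scope.
Implicit Types (u v x y : H) (T S : operator) (A B : set operator).

Lemma dot_conj u v : '[v, u] = '[u, v]^*.
Proof. by rewrite hermC /= expr0 mul1r. Qed.

Lemma dot_ext u v : (forall x, '[u, x] = '[v, x]) -> u = v.
Proof.
move=> h; apply/eqP; rewrite -subr_eq0 -(dnorm_eq0 (hilbert_dot H)).
by rewrite linearBl /= h subrr.
Qed.

Lemma dot_extr u v : (forall x, '[x, u] = '[x, v]) -> u = v.
Proof. by move=> h; apply: dot_ext => x; rewrite dot_conj h -dot_conj. Qed.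

Lemma cauchy_schwarz u v : `|'[u, v]| ^+ 2 <= '[u] * '[v].
Proof.
have [->|v0] := eqVneq v 0; first by rewrite !linear0r normr0 expr0n mulr0.
have v1 : 0 < '[v] by rewrite dnorm_gt0.
have := dnorm_ge0 (hilbert_dot H) ('[v] *: u - '[u, v] *: v).
rewrite dnormB !dnormZ linearZl_LR linearZr_LR /= !normCK.
have vr : '[v]^* = '[v] by rewrite -dot_conj.
rewrite vr.
have -> : '[v] * '[v] * '[u] + '[u, v] * '[u, v]^* * '[v]
   - ('[v] * ('[u, v]^* * '[u, v]) + ('[v] * ('[u, v]^* * '[u, v]))^*)
   = '[v] * ('[u] * '[v] - '[u, v] * '[u, v]^*).
  by rewrite !rmorphM /= conjCK vr; ring.
by rewrite pmulr_rge0 // subr_ge0.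
Qed.

Lemma dnormD_le u v : '[u + v] <= 2 * '[u] + 2 * '[v].
Proof.
have -> : 2 * '[u] + 2 * '[v] = '[u + v] + '[u - v].
  by rewrite dnormD dnormB; ring.
by rewrite lerDl dnorm_ge0.
Qed.

Lemma dnorm_small u (K : C) : (forall e, 0 < e -> '[u] <= K * e) -> u = 0.
Proof.
move=> h; apply/eqP; rewrite -(dnorm_eq0 (hilbert_dot H)) eq_le dnorm_ge0 andbT.
have K0 : 0 <= K by have := h 1 ltr01; rewrite mulr1; apply: le_trans; exact: dnorm_ge0.
apply/ler_addgt0Pl => e e0; rewrite addr0.
have K1 : 0 < K + 1 by rewrite ltr_wpDl.
apply: le_trans (h (e / (K + 1)) _) _; first by rewrite divr_gt0.
rewrite mulrCA ler_piMr ?(ltW e0) // ler_pdivrMr // mul1r lerDl.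
exact: ler01.
Qed.

(** Squared norms keep square roots out of the estimates: [K] bounds the square of the operator
    norm. *)
Definition bound_by T (K : C) := 0 <= K /\ forall x, '[T x] <= K * '[x].

Lemma norm_le_bound T K : norm_le T K -> bound_by T (`|K| ^+ 2).
Proof.
move=> KP; split=> [|x]; first by rewrite exprn_ge0.
have := KP x; rewrite /dot_norm => h.
have h0 : 0 <= K * sqrtC '[x] by apply: le_trans h; rewrite sqrtC_ge0 dnorm_ge0.
have hE : K * sqrtC '[x] = `|K| * sqrtC '[x].
  have s0 : 0 <= sqrtC '[x] by rewrite sqrtC_ge0 dnorm_ge0.
  by rewrite -[RHS](congr1 _ (ger0_norm s0)) -normrM ger0_norm.
rewrite -[leLHS]sqrtCK -['[x]]sqrtCK -exprMn ler_pXn2r ?nnegrE -?hE //.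
by rewrite sqrtC_ge0 dnorm_ge0.
Qed.

Lemma bound_norm_le T K : bound_by T K -> norm_le T (sqrtC K).
Proof.
move=> [K0 KP] x; rewrite /dot_norm -sqrtCM ?nnegrE ?dnorm_ge0 //.
by rewrite ler_sqrtC ?nnegrE ?mulr_ge0 ?dnorm_ge0 ?KP.
Qed.

Lemma bounded_operatorP T :
  bounded_operator T <-> linear T /\ exists K, bound_by T K.
Proof.
split=> -[lT [K KP]]; split=> //; last by exists (sqrtC K); exact: bound_norm_le.
by exists (`|K| ^+ 2); exact: norm_le_bound.
Qed.

Lemma bounded_id : bounded_operator (idfun : operator).
Proof.
by apply/bounded_operatorP; split=> //; exists 1; split=> // x; rewrite mul1r.
Qed.

Lemma bounded_comp T S : bounded_operator T -> bounded_operator S ->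
  bounded_operator (T \o S).
Proof.
move=> /bounded_operatorP[lT [K [K0 TK]]] /bounded_operatorP[lS [L [L0 SL]]].
apply/bounded_operatorP; split; first by move=> c u v /=; rewrite lS lT.
exists (K * L); split=> [|x]; first exact: mulr_ge0.
by rewrite (le_trans (TK _)) // -mulrA ler_wpM2l.
Qed.

Lemma bounded_lincomb c T S : bounded_operator T -> bounded_operator S ->
  bounded_operator (c *: T + S).
Proof.
move=> /bounded_operatorP[lT [K [K0 TK]]] /bounded_operatorP[lS [L [L0 SL]]].
apply/bounded_operatorP; split.
  move=> a u v; rewrite -[LHS]/(c *: T (a *: u + v) + S (a *: u + v)) lS lT.
  rewrite -[RHS]/(a *: (c *: T u + S u) + (c *: T v + S v)).
  by rewrite !scalerDr !scalerA mulrC addrACA.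
exists (2 * (`|c| ^+ 2 * K) + 2 * L); split=> [|x].
  by rewrite addr_ge0 // mulr_ge0 // mulr_ge0 // exprn_ge0.
rewrite -[(c *: T + S) x]/(c *: T x + S x) (le_trans (dnormD_le _ _)) //.
rewrite dnormZ [leRHS]mulrDl -!mulrA lerD // ?ler_wpM2l // ?exprn_ge0.
Qed.

Lemma is_adjoint_sym T S : is_adjoint T S -> is_adjoint S T.
Proof. by move=> h x y; rewrite dot_conj -h -dot_conj. Qed.

Lemma adjointE T S : is_adjoint T S -> adjoint T = S.
Proof.
move=> TS; rewrite /adjoint; case: xgetP => [S' -> TS'|/(_ S)//].
by apply/funext => y; apply: dot_extr => x; rewrite -TS -TS'.
Qed.

Lemma is_adjoint_comp T S T' S' : is_adjoint T T' -> is_adjoint S S' ->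
  is_adjoint (T \o S) (S' \o T').
Proof. by move=> hT hS x y /=; rewrite hT hS. Qed.

Lemma is_adjoint_lincomb c T S T' S' : is_adjoint T T' -> is_adjoint S S' ->
  is_adjoint (c *: T + S) (c^* *: T' + S').
Proof.
move=> hT hS x y; rewrite -[(c *: T + S) x]/(c *: T x + S x).
rewrite -[(c^* *: T' + S') y]/(c^* *: T' y + S' y).
by rewrite linearDl linearDr linearZl_LR linearZr_LR /= conjCK hT hS.
Qed.

(** By Cauchy-Schwarz for [T (S y)] and [y], the square of ['[S y]] is at most [K * '[S y] * '[y]];
    one factor cancels. *)
Lemma adjoint_bound T S K : bound_by T K -> is_adjoint T S -> bound_by S K.
Proof.
move=> [K0 TK] TS; split=> // y.
have h := cauchy_schwarz (T (S y)) y; rewrite TS in h.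
have [->|Sy] := eqVneq (S y) 0; first by rewrite linear0r mulr_ge0 // dnorm_ge0.
have Sy0 : 0 < '[S y] by rewrite dnorm_gt0.
rewrite -(ler_pM2l Sy0) -expr2 -{1}[ '[S y] ]ger0_norm ?dnorm_ge0 //.
by rewrite (le_trans h) // mulrCA mulrA ler_wpM2r ?dnorm_ge0.
Qed.

Lemma adjoint_bounded T S : bounded_operator T -> is_adjoint T S ->
  bounded_operator S.
Proof.
move=> /bounded_operatorP[lT [K TK]] TS; apply/bounded_operatorP; split.
  move=> c u v; apply: dot_extr => x.
  by rewrite -TS !linearDr !linearZr_LR /= -!TS.
by exists K; exact: adjoint_bound TK TS.
Qed.

Lemma commutant_bounded A : commutant A `<=` @bounded_operator R H.
Proof. by move=> T []. Qed.

Lemma commutant_id A : commutant A idfun.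
Proof. by split; first exact: bounded_id. Qed.

Lemma commutant_comp A T S : commutant A T -> commutant A S -> commutant A (T \o S).
Proof.
move=> [bT hT] [bS hS]; split; first exact: bounded_comp.
move=> U AU; have h1 := hT U AU; have h2 := hS U AU.
by rewrite -compA h2 compA h1.
Qed.

Lemma commutant_lincomb A c T S : A `<=` @bounded_operator R H ->
  commutant A T -> commutant A S -> commutant A (c *: T + S).
Proof.
move=> Ab [bT hT] [bS hS]; split; first exact: bounded_lincomb.
move=> U AU; apply/funext => x.
have := congr1 (fun f => f x) (hT U AU); have := congr1 (fun f => f x) (hS U AU).
move=> /= h2 h1; rewrite -[LHS]/(c *: T (U x) + S (U x)) h1 h2.
by rewrite -[RHS]/(U (c *: T x + S x)) (Ab _ AU).1.
Qed.

Lemma commutantS A B : A `<=` B -> commutant B `<=` commutant A.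
Proof. by move=> AB T [bT h]; split=> // S /AB /h. Qed.

Lemma sub_bicommutant A : A `<=` @bounded_operator R H -> A `<=` commutant (commutant A).
Proof. by move=> Ab T AT; split=> [|S [_ h]]; [exact: Ab | rewrite h]. Qed.

Lemma tricommutant A : A `<=` @bounded_operator R H ->
  commutant (commutant (commutant A)) = commutant A.
Proof.
move=> Ab; apply/seteqP; split; first exact/commutantS/sub_bicommutant.
exact/sub_bicommutant/commutant_bounded.
Qed.

Lemma commutant_star A T T' : (forall S, A S -> exists2 S', A S' & is_adjoint S S') ->
  is_adjoint T T' -> commutant A T -> commutant A T'.
Proof.
move=> As TT' [bT hT]; split; first exact: adjoint_bounded bT TT'.
move=> S AS; have [S' AS' SS'] := As S AS; apply/funext => x; apply: dot_extr => y /=.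
have := congr1 (fun f => f y) (hT S' AS') => /= h.
by rewrite -TT' -(is_adjoint_sym SS') -h TT' (is_adjoint_sym SS').
Qed.

End Operators.

(** * Operators on square-summable families: extensionality and adjoints *)

Section Ell2Operators.
Variables (R : realType) (T : choiceType).
Local Notation C := R[i].
Local Notation H := (ell2_hilbert R T).
Local Notation "''[' u , v ]" := (hilbert_dot H u v) : ring_scope.
Local Notation "''[' u ]" := (hilbert_dot H u u) : ring_scope.
Implicit Types (A B : H -> H) (u v : H).

Lemma dot_delta u a : '[u, delta R a] = (u : ell2 R T) a.
Proof. exact: ell2_dot_delta. Qed.

Lemma dot_delta_delta a b : '[delta R a, delta R b] = (b == a)%:R.
Proof. by rewrite dot_delta. Qed.

Lemma operator_ext A B : bounded_operator A -> bounded_operator B ->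
  (forall a, A (delta R a) = B (delta R a)) -> A = B.
Proof.
move=> bA bB AB; apply/funext => u; apply/eqP; rewrite -subr_eq0; apply/eqP.
have bD : bounded_operator (-1 *: B + A) by exact: bounded_lincomb.
have DE x : (-1 *: B + A) x = A x - B x.
  by rewrite -[LHS]/(-1 *: B x + A x) scaleN1r addrC.
rewrite -DE; have /bounded_operatorP[lD [K [K0 KD]]] := bD.
apply: (@dnorm_small _ _ _ K) => e /(trunc_dense u)[F hF].
have D0 : (-1 *: B + A) (trunc (u : ell2 R T) F) = 0.
  rewrite /trunc (linear_sum_seq lD) big1 // => x _.
  by rewrite (linear_Z lD) DE AB subrr scaler0.
rewrite -(subr0 ((-1 *: B + A) u)) -D0 -(linear_B lD) (le_trans (KD _)) //.
by rewrite ler_wpM2l // ltW.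
Qed.

(** The coordinates [f y x] of the adjoint are forced by the basis. If [s] is a partial sum of their
    squares, testing [A] on the truncation [z] gives ['[A z, y] = '[z] = s], hence [s ^+ 2 <= s * (K
    * '[y])] and square-summability. *)
Lemma adjoint_exists A : bounded_operator A -> exists B, is_adjoint A B.
Proof.
move=> bA; have /bounded_operatorP[lA [K [K0 KA]]] := bA.
pose f (y : H) x : C := '[A (delta R x), y]^*.
have fP y : sqsum (f y).
  exists (complex.Re (K * '[y])) => F.
  rewrite RRe_real; last by rewrite ger0_real // mulr_ge0 ?dnorm_ge0.
  set s := psum _ F; pose z : H := trunc (f y) F.
  have sE : '[A z, y] = s.
    rewrite /z /trunc (linear_sum_seq lA) linear_sumlz; apply: eq_bigr => x _.
    by rewrite (linear_Z lA) linearZl_LR /= normCK conjCK mulrC.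
  have zE : '[z] = s.
    rewrite {1}/z /trunc linear_sumlz; apply: eq_big_seq => x xF.
    by rewrite linearZl_LR /= (dot_conj z) dot_delta truncE xF mulr1 normCK.
  have [->|s0] := eqVneq s 0; first by rewrite mulr_ge0 ?dnorm_ge0.
  have sgt0 : 0 < s by rewrite lt_def s0 -zE dnorm_ge0.
  have := cauchy_schwarz (A z) y; rewrite sE ger0_norm ?(ltW sgt0) // => h.
  have : s ^+ 2 <= s * (K * '[y]).
    rewrite (le_trans h) // mulrA ler_wpM2r ?dnorm_ge0 // mulrC -zE; exact: KA.
  by rewrite expr2 ler_pM2l.
exists (fun y => mkell2 (fP y)) => x y; apply/eqP; rewrite -subr_eq0 -normr_eq0.
set S := mkell2 (fP y) : H.
have ad a : '[A (delta R a), y] = '[delta R a, S].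
  by rewrite (dot_conj S) dot_delta conjCK.
have at0 F : '[A (trunc (x : ell2 R T) F), y] - '[trunc (x : ell2 R T) F, S] = 0.
  rewrite /trunc (linear_sum_seq lA) !linear_sumlz -sumrB big1 // => a _.
  by rewrite (linear_Z lA) !linearZl_LR /= ad subrr.
set L := 2 * (K * '[y]) + 2 * '[S].
have L0 : 0 <= L by rewrite addr_ge0 // mulr_ge0 ?mulr_ge0 ?dnorm_ge0.
suff : `|'[A x, y] - '[x, S]| ^+ 2 == 0 by rewrite sqrf_eq0.
rewrite eq_le exprn_ge0 // andbT; apply/ler_addgt0Pl => e e0; rewrite addr0.
have L1 : 0 < L + 1 by rewrite ltr_wpDl.
have [|F hF] := @trunc_dense _ _ x (e / (L + 1)); first by rewrite divr_gt0.
rewrite -[X in `|X|]subr0 -(at0 F).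
set t : H := trunc _ F in at0 hF *.
have -> : '[A x, y] - '[x, S] - ('[A t, y] - '[t, S])
   = '[A (x - t), y] - '[x - t, S].
  by rewrite (linear_B lA) !linearBl /=; ring.
apply: (@le_trans _ _ (L * '[x - t])).
  rewrite (le_trans (normC_sqrD_le _ _)) // normrN [leRHS]mulrDl.
  rewrite -!mulrA; apply: lerD; rewrite ler_wpM2l // (le_trans (cauchy_schwarz _ _)) //.
    by rewrite [ '[y] * _]mulrC mulrA ler_wpM2r ?dnorm_ge0 ?KA.
  by rewrite mulrC.
apply: (@le_trans _ _ (L * (e / (L + 1)))); first by rewrite ler_wpM2l // ltW.
by rewrite mulrCA ler_piMr ?(ltW e0) // ler_pdivrMr // mul1r lerDl ler01.
Qed.

Lemma adjointP A : bounded_operator A -> is_adjoint A (adjoint A).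
Proof. by move=> /adjoint_exists[B AB]; rewrite (adjointE AB). Qed.

Lemma commutant_adjoint (X : set (H -> H)) A : X `<=` @bounded_operator R H ->
  (forall B, X B -> X (adjoint B)) -> commutant X A -> commutant X (adjoint A).
Proof.
move=> Xb Xs XA; apply: commutant_star (adjointP (commutant_bounded XA)) XA.
by move=> B XB; exists (adjoint B); [exact: Xs | exact/adjointP/Xb].
Qed.

End Ell2Operators.

(** * Strong limits of powers *)

Lemma cvgC_unique (R : realType) (f : nat -> R[i]) (l l' : R[i]) :
  (f : _ -> R[i]^o) @ \oo --> (l : R[i]^o) ->
  (f : _ -> R[i]^o) @ \oo --> (l' : R[i]^o) -> l = l'.
Proof. exact: (@cvg_unique _ (@norm_hausdorff R[i] R[i]^o)). Qed.

Lemma cvg_conjC (R : realType) (f : nat -> R[i]) (l : R[i]) :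
  (f : _ -> R[i]^o) @ \oo --> (l : R[i]^o) ->
  ((fun n => (f n)^*) : _ -> R[i]^o) @ \oo --> (l^* : R[i]^o).
Proof.
move=> /cvgrPdist_lt h; apply/cvgrPdist_lt => e /h [N _ hN]; exists N => // n /hN.
by rewrite /= -rmorphB norm_conjC.
Qed.

Lemma nonincreasing_tail (R : realType) (s : nat -> R[i]) :
  (forall n, 0 <= s n) -> (forall n, s n.+1 <= s n) ->
  forall e, 0 < e -> exists N, forall k, (N <= k)%N -> s N - e < s k <= s N.
Proof.
move=> s0 sS e e0.
have smono m n : (m <= n)%N -> s n <= s m.
  by move=> /subnK <-; elim: (n - m)%N => [|k IH] //=; exact: le_trans (sS _) IH.
pose r n := complex.Re (s n); have rE n : s n = (r n)%:C by rewrite RRe_real ?ger0_real.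
have eE : e = (complex.Re e)%:C by rewrite RRe_real // gtr0_real.
have hi : has_inf (range r).
  split; first by exists (r 0%N); exists 0%N.
  by exists 0 => _ [n _ <-]; rewrite -ler0c -rE.
rewrite eE ltcR in e0 *.
have [_ [N _ <-] hN] := inf_adherent e0 hi.
exists N => k Nk; rewrite smono // andbT !rE -rmorphB ltcR.
have : inf (range r) <= r k by apply: ge_inf; [exact: hi.2 | exists k].
lra.
Qed.

Section ProjectionPowers.
Variables (R : realType) (H : hilbertSpace R).
Local Notation C := R[i].
Local Notation "''[' u , v ]" := (hilbert_dot H u v) : ring_scope.
Local Notation "''[' u ]" := (hilbert_dot H u u) : ring_scope.
Variables (q a : H -> H).
Hypotheses (bq : bounded_operator q) (ba : bounded_operator a).
Hypotheses (qq : forall x, q (q x) = q x) (qa : forall x, q (a x) = a x).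
Hypotheses (aq : forall x, a (q x) = a x).
Hypotheses (q_adj : is_adjoint q q) (a_adj : is_adjoint a a).

(** The power of exponent zero is [q], the unit of the corner that contains [a], rather than the
    identity. *)
Definition pw n (x : H) : H := iter n a (q x).

Lemma pwSr n x : pw n.+1 x = pw n (a x).
Proof. by rewrite /pw iterSr aq qa. Qed.

Lemma pw_q n x : pw n (q x) = pw n x.
Proof. by rewrite /pw qq. Qed.

Lemma q_pw n x : q (pw n x) = pw n x.
Proof. by case: n => [|n]; rewrite /pw ?iterS /= ?qq ?qa. Qed.

Lemma pwD m n x : pw (m + n) x = pw m (pw n x).
Proof. by rewrite {2}/pw q_pw /pw iterD. Qed.

Lemma pw_adj n : is_adjoint (pw n) (pw n).
Proof.
elim: n => [|n IH] x y; first exact: q_adj.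
by rewrite [in LHS]/pw iterS a_adj -/(pw n x) IH -pwSr.
Qed.

Lemma pw_bounded n : bounded_operator (pw n).
Proof. by elim: n => [|n IH] //; have := bounded_comp ba IH. Qed.

Lemma dnorm_pw_even n x : '[pw n x] = '[pw n.*2 x, x].
Proof. by rewrite -addnn pwD [RHS]pw_adj. Qed.

Hypothesis a_contr : forall x, '[a x] <= '[x].
Hypothesis q_contr : forall x, '[q x] <= '[x].

Lemma pw_contr n x : '[pw n x] <= '[x].
Proof. by elim: n => [|n IH]; [exact: q_contr | exact: le_trans (a_contr _) IH]. Qed.

(** With [s k = '[pw k x]], the squared distance of the powers [2m] and [2n] at [x] is
    [s (2m) + s (2n) - 2 s (m + n)], and [s] decreases because [a] is a contraction. Odd powers are
    left out because [a] may have negative spectrum, where they change sign. *)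
Lemma pw_even_cauchy x e : 0 < e -> exists N, forall m n, (N <= m)%N -> (N <= n)%N ->
  '[pw m.*2 x - pw n.*2 x] < e.
Proof.
move=> e0; pose s k := '[pw k x].
have s0 k : 0 <= s k by exact: dnorm_ge0.
have sS k : s k.+1 <= s k by exact: a_contr.
have e20 : 0 < e / 2 by rewrite divr_gt0.
have [N hN] := nonincreasing_tail s0 sS e20.
exists N => m n Nm Nn.
have sE k l : '[pw k.*2 x, pw l.*2 x] = s (k + l)%N.
  by rewrite pw_adj -pwD -doubleD /s dnorm_pw_even pw_adj.
have sr : (s (m + n)%N)^* = s (m + n)%N by rewrite -dot_conj.
have -> : '[pw m.*2 x - pw n.*2 x] =
    s (m + m)%N + s (n + n)%N - (s (m + n)%N + s (m + n)%N).
  by rewrite dnormB !sE sr.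
have /andP[_ h1] := hN (m + m)%N (leq_trans Nm (leq_addl _ _)).
have /andP[_ h2] := hN (n + n)%N (leq_trans Nn (leq_addl _ _)).
have /andP[h3 _] := hN (m + n)%N (leq_trans Nm (leq_addr _ _)).
rewrite ltrBlDr; apply: (@le_lt_trans _ _ (s N + s N)); first exact: lerD.
have -> : s N + s N = e + ((s N - e / 2) + (s N - e / 2)) by field.
by rewrite ltrD2l ltrD.
Qed.

(** [Q] is the orthogonal projection onto the vectors fixed by all even powers. The limit exists in
    norm at each vector, but its weak form is what transports linearity, self-adjointness and
    invariance to [Q]. *)
Lemma pw_strong_limit : exists Q : H -> H, [/\ bounded_operator Q, is_adjoint Q Q,
  (forall n x, pw n.*2 (Q x) = Q x), (forall x, Q (Q x) = Q x) &
  forall x y, ((fun n => '[pw n.*2 x, y]) : _ -> C^o) @ \oo --> ('[Q x, y] : C^o)].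
Proof.
have lim x : exists l, forall e : C, 0 < e -> exists N : nat, forall n : nat,
    (N <= n)%N -> '[pw n.*2 x - l] < e.
  have [|l hl] := @hilbert_complete R H (fun n => pw n.*2 x).
    move=> e e0; have [|N hN] := @pw_even_cauchy x (e ^+ 2); first by rewrite exprn_gt0.
    exists N => m n Nm Nn; rewrite /dot_norm -[e](sqrCK (ltW e0)).
    by rewrite ltr_sqrtC ?nnegrE ?dnorm_ge0 ?exprn_ge0 ?(ltW e0) // hN.
  exists l => e e0; have [|N hN] := hl (sqrtC e); first by rewrite sqrtC_gt0.
  exists N => n /hN; rewrite /dot_norm.
  by rewrite ltr_sqrtC ?nnegrE ?dnorm_ge0 // ltW.
have [Q hQ] := choice lim.
have W x y : ((fun n => '[pw n.*2 x, y]) : _ -> C^o) @ \oo --> ('[Q x, y] : C^o).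
  apply/cvgrPdist_lt => e e0.
  have y1 : 0 < '[y] + 1 by rewrite ltr_wpDl ?dnorm_ge0.
  have [|N hN] := hQ x (e ^+ 2 / ('[y] + 1)); first by rewrite divr_gt0 // exprn_gt0.
  exists N => // n /= /hN h; rewrite distrC -linearBl /=.
  rewrite -(@ltr_pXn2r _ 2) ?nnegrE ?normr_ge0 ?(ltW e0) //.
  apply: le_lt_trans (cauchy_schwarz _ _) _.
  apply: (@le_lt_trans _ _ ('[pw n.*2 x - Q x] * ('[y] + 1))).
    by rewrite ler_wpM2l ?dnorm_ge0 // lerDl ler01.
  by rewrite -ltr_pdivlMr.
have lQ : linear Q.
  move=> c u v; apply: dot_ext => y; rewrite linearDl linearZl_LR /=.
  apply: cvgC_unique (W _ _) _.
  have -> : (fun n => '[pw n.*2 (c *: u + v), y]) =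
            (fun n => c *: ('[pw n.*2 u, y] : C^o)) + (fun n => '[pw n.*2 v, y] : C^o).
    by apply/funext => n; rewrite (pw_bounded _).1 linearDl linearZl_LR.
  exact: (@cvgD C C^o _ \oo _ _ _ _ _ (cvgZl_tmp (W _ _)) (W _ _)).
have bQ : bounded_operator Q.
  apply/bounded_operatorP; split=> //; exists 2; split=> // x.
  apply/ler_addgt0Pr => e e0; have [|N /(_ N (leqnn N)) hN] := hQ x (e / 2).
    by rewrite divr_gt0.
  rewrite -[Q x](subrK (pw N.*2 x)) (le_trans (dnormD_le _ _)) // addrC.
  apply: lerD; first by rewrite ler_wpM2l // pw_contr.
  have -> : '[Q x - pw N.*2 x] = '[pw N.*2 x - Q x].
    by rewrite -opprB linearNl linearNr opprK.
  by rewrite mulrC -ler_pdivlMr // ltW.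
have W' x y : ((fun n => '[x, pw n.*2 y]) : _ -> C^o) @ \oo --> ('[x, Q y] : C^o).
  rewrite (_ : (fun n => '[x, pw n.*2 y]) = fun n => '[pw n.*2 y, x]^*).
    by rewrite dot_conj; exact: cvg_conjC (W y x).
  by apply/funext => n; rewrite -dot_conj.
have aQ : is_adjoint Q Q.
  move=> x y; apply: cvgC_unique (W x y) _; have := W' x y.
  by under eq_fun do rewrite -pw_adj.
have fQ n x : pw n.*2 (Q x) = Q x.
  apply: dot_ext => y; rewrite pw_adj.
  apply: cvgC_unique (W _ _) _.
  apply/cvgrPdist_lt => e e0; move/cvgrPdist_lt: (W x y) => /(_ e e0)[N _ hN].
  exists N => // k Nk; rewrite -pw_adj -pwD -doubleD.
  exact: hN (leq_trans Nk (leq_addl _ _)).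
exists Q; split=> // x; apply: dot_ext => y; apply: cvgC_unique (W _ _) _.
by under eq_fun do rewrite fQ; exact: cvg_cst.
Qed.

End ProjectionPowers.

(** * The von Neumann algebra of a locally finite ICC group *)

Section Reindexing.
Variables (R : realType) (T : choiceType).
Local Notation C := R[i].
Local Notation H := (ell2_hilbert R T).
Local Notation "''[' u , v ]" := (hilbert_dot H u v) : ring_scope.
Local Notation "''[' u ]" := (hilbert_dot H u u) : ring_scope.
Implicit Types (p q : T -> T) (u v : H).

Lemma sqsum_comp p q u : cancel p q -> sqsum ((u : ell2 R T) \o p).
Proof.
move=> pK; have [K uK] := ell2_sqsum u; exists K => F.
have -> : psum (fun x => `|((u : ell2 R T) \o p) x| ^+ 2) F =
          psum (fun x => `|(u : ell2 R T) x| ^+ 2) [fset p x | x in F]%fset.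
  by rewrite /psum big_imfset //= => x y _ _; exact: can_inj.
exact: uK.
Qed.

Definition reindex p q (pK : cancel p q) : H -> H :=
  fun u => mkell2 (sqsum_comp u pK).

Lemma reindex_dot p q (pK : cancel p q) u v : cancel q p ->
  '[reindex pK u, reindex pK v] = '[u, v].
Proof.
move=> qK; apply: (ell2_dot_eq (u := reindex pK u)).
have h := has_sum_bij pK qK (ell2_dotP u v); exact: h.
Qed.

Lemma reindex_linear p q (pK : cancel p q) : linear (reindex pK).
Proof. by move=> c u v; exact: ell2_eq. Qed.

Lemma reindex_bounded p q (pK : cancel p q) (qK : cancel q p) :
  bounded_operator (reindex pK).
Proof.
apply/bounded_operatorP; split; first exact: reindex_linear.
by exists 1; split=> // u; rewrite reindex_dot // mul1r.
Qed.

Lemma reindex_delta p q (pK : cancel p q) (qK : cancel q p) a :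
  reindex pK (delta R a) = delta R (q a).
Proof. by apply: ell2_eq => x /=; rewrite (can2_eq pK qK). Qed.

End Reindexing.

(** * Left and right translations on a group *)

Section Translations.
Variables (R : realType) (L : groupType).
Local Notation C := R[i].
Local Notation H := (ell2_hilbert R L).
Local Notation "''[' u , v ]" := (hilbert_dot H u v) : ring_scope.
Local Notation "''[' u ]" := (hilbert_dot H u u) : ring_scope.
Implicit Types (g h : L) (u v : H) (A B : H -> H).

(** With [rtrans], these are the left and right regular representations. *)
Definition ltrans g : H -> H := @reindex R _ _ _ (mulVKg g).
Definition rtrans g : H -> H := @reindex R _ _ _ (mulgK g).

Lemma ltransE g u x : (ltrans g u : ell2 R L) x = (u : ell2 R L) (g^-1 * x)%g.
Proof. by []. Qed.

Lemma rtransE g u x : (rtrans g u : ell2 R L) x = (u : ell2 R L) (x * g)%g.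
Proof. by []. Qed.

Lemma ltrans_bounded g : bounded_operator (ltrans g).
Proof. exact: reindex_bounded (mulKg g). Qed.

Lemma rtrans_bounded g : bounded_operator (rtrans g).
Proof. exact: reindex_bounded (mulgVK g). Qed.

Lemma ltrans_delta g x : ltrans g (delta R x) = delta R (g * x)%g.
Proof. exact: reindex_delta (mulKg g) _. Qed.

Lemma rtrans_delta g x : rtrans g (delta R x) = delta R (x * g^-1)%g.
Proof. exact: reindex_delta (mulgVK g) _. Qed.

Lemma ltrans1 : ltrans 1 = idfun.
Proof. by apply/funext => u; apply: ell2_eq => x; rewrite ltransE invg1 mul1g. Qed.

Lemma ltransM g h : ltrans (g * h)%g = ltrans g \o ltrans h.
Proof.
by apply/funext => u; apply: ell2_eq => x /=; rewrite invMg mulgA.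
Qed.

Lemma rtransC g h : ltrans g \o rtrans h = rtrans h \o ltrans g.
Proof.
by apply/funext => u; apply: ell2_eq => x /=; rewrite mulgA.
Qed.

Lemma ltrans_dot g u v : '[ltrans g u, ltrans g v] = '[u, v].
Proof. exact: reindex_dot (mulKg g). Qed.

Lemma ltrans_is_adjoint g : is_adjoint (ltrans g) (ltrans g^-1).
Proof.
move=> u v; rewrite -(ltrans_dot g u (ltrans g^-1 v)).
by rewrite -[ltrans g (ltrans _ _)]/((ltrans g \o ltrans g^-1) v) -ltransM mulgV ltrans1.
Qed.

Lemma adjoint_ltrans g : adjoint (ltrans g) = ltrans g^-1.
Proof. exact/adjointE/ltrans_is_adjoint. Qed.

End Translations.

(** * The finite group algebras, their bicommutant and its trace *)

Section GroupFactor.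
Variables (R : realType) (L : groupType) (K : nat -> seq L).
Hypothesis K_uniq : forall n, uniq (K n).
Hypothesis K_id : forall n, 1%g \in K n.
Hypothesis K_mul : forall n, {in K n &, forall g h, (g * h)%g \in K n}.
Hypothesis K_inv : forall n, {in K n, forall g, g^-1%g \in K n}.
Hypothesis K_sub : forall n, {subset K n <= K n.+1}.
Hypothesis K_cover : forall g, exists n, g \in K n.
Hypothesis L_icc : forall x : L, x != 1%g ->
  exists c : nat -> L, injective (fun n => x ^ c n)%g.
Hypothesis K_involution : forall n, exists s : L,
  [/\ s \notin K n, (s * s = 1)%g & {in K n, forall g, (s * g = g * s)%g}].

Local Notation C := R[i].
Local Notation H := (ell2_hilbert R L).
Local Notation "''[' u , v ]" := (hilbert_dot H u v) : ring_scope.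
Local Notation "''[' u ]" := (hilbert_dot H u u) : ring_scope.
Local Notation ltrans := (@ltrans R L).
Local Notation rtrans := (@rtrans R L).
Local Notation d1 := (delta R (1%g : L) : H).
Implicit Types (g h : L) (u v x y : H) (A B T S p q e : H -> H).

Definition span_alg n : set (H -> H) :=
  [set T | exists c : L -> C, T = \sum_(g <- K n) c g *: ltrans g].

Lemma sum_opE (I : Type) (r : seq I) (E : I -> H -> H) u :
  (\sum_(i <- r) E i) u = \sum_(i <- r) E i u.
Proof. by elim/big_rec2: _ => [|i y z _ <-]. Qed.

Lemma span_lincomb n c T S : span_alg n T -> span_alg n S -> span_alg n (c *: T + S).
Proof.
move=> [a ->] [b ->]; exists (fun g => c * a g + b g).
rewrite scaler_sumr -big_split; apply: eq_bigr => g _ /=.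
by rewrite scalerA -scalerDl.
Qed.

Lemma span0 n : span_alg n 0.
Proof. by exists (fun=> 0); rewrite big1 // => g _; rewrite scale0r. Qed.

Lemma span_sum n (I : eqType) (r : seq I) (c : I -> C) (E : I -> H -> H) :
  (forall i, i \in r -> span_alg n (E i)) -> span_alg n (\sum_(i <- r) c i *: E i).
Proof.
elim: r => [|i r IH] hE; first by rewrite big_nil; exact: span0.
rewrite big_cons; apply: span_lincomb; first by apply: hE; rewrite mem_head.
by apply: IH => j jr; apply: hE; rewrite inE jr orbT.
Qed.

Lemma span_ltrans n g : g \in K n -> span_alg n (ltrans g).
Proof.
move=> gK; exists (fun h => (h == g)%:R).
rewrite (bigD1_seq g) //= eqxx scale1r big1 ?addr0 // => h /negPf ->.
by rewrite scale0r.
Qed.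

Lemma span_bounded n : span_alg n `<=` @bounded_operator R H.
Proof.
move=> T [c ->]; elim: (K n) => [|g r IH].
  rewrite big_nil; have := bounded_lincomb (-1) (@bounded_id R H) (@bounded_id R H).
  by rewrite scaleN1r addNr.
by rewrite big_cons; apply: bounded_lincomb => //; exact: ltrans_bounded.
Qed.

Lemma span_comp n T S : span_alg n T -> span_alg n S -> span_alg n (T \o S).
Proof.
move=> [a ->] [b ->].
rewrite (_ : _ \o _ = \sum_(g <- K n) a g *: \sum_(h <- K n) b h *: ltrans (g * h)).
  apply: span_sum => g gK; apply: span_sum => h hK; apply: span_ltrans; exact: K_mul.
apply/funext => u /=; rewrite !sum_opE; apply: eq_bigr => g _.
rewrite -[LHS]/(a g *: ltrans g _).
rewrite -[RHS]/(a g *: (\sum_(h <- K n) b h *: ltrans (g * h)) u).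
rewrite !sum_opE (linear_sum_seq (ltrans_bounded R g).1); congr (_ *: _).
apply: eq_bigr => h _; rewrite -[X in ltrans g X]/(b h *: ltrans h u).
by rewrite (linear_Z (ltrans_bounded R g).1) -[RHS]/(b h *: ltrans (g * h) u) ltransM.
Qed.

Lemma span_adjoint n T : span_alg n T -> span_alg n (adjoint T).
Proof.
move=> [a ->]; pose S := \sum_(g <- K n) (a g)^* *: ltrans g^-1.
have : is_adjoint (\sum_(g <- K n) a g *: ltrans g) S.
  rewrite /S; elim: (K n) => [|g r IH].
    by rewrite !big_nil => u v; rewrite linear0l linear0r.
  by rewrite !big_cons; apply: is_adjoint_lincomb => //; exact: ltrans_is_adjoint.
move=> /adjointE ->; apply: span_sum => g gK; apply: span_ltrans; exact: K_inv.
Qed.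

Lemma span_mono n m : (n <= m)%N -> span_alg n `<=` span_alg m.
Proof.
move=> /subnK <-; elim: (m - n)%N => [|k IH] //=; apply: subset_trans IH _ => T [c ->].
by apply: span_sum => g /K_sub; exact: span_ltrans.
Qed.

Lemma span_findim n : findim_star_subalgebra (span_alg n).
Proof.
split; first exact: span_bounded.
- by rewrite -(ltrans1 R); exact: span_ltrans.
- by move=> c T S; exact: span_lincomb.
- by move=> T S; exact: span_comp.
split; first exact: span_adjoint.
exists (size (K n)), (fun i => ltrans (nth 1%g (K n) i)) => T [c ->].
exists (fun i => c (nth 1%g (K n) i)).
by rewrite (big_nth 1%g) big_mkord.
Qed.

Definition group_alg : set (H -> H) := \bigcup_n span_alg n.
Definition group_vn : set (H -> H) := commutant (commutant group_alg).
Local Notation M := group_vn.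

Lemma group_alg_bounded : group_alg `<=` @bounded_operator R H.
Proof. by move=> T [n _]; exact: span_bounded. Qed.

Lemma group_alg_vn : group_alg `<=` M.
Proof. exact/sub_bicommutant/group_alg_bounded. Qed.

Lemma vn_bounded : M `<=` @bounded_operator R H.
Proof. exact: commutant_bounded. Qed.

Lemma vn_ltrans g : M (ltrans g).
Proof.
by have [n gn] := K_cover g; apply: group_alg_vn; exists n => //; exact: span_ltrans.
Qed.

Lemma vn_id : M idfun. Proof. exact: commutant_id. Qed.

Lemma vn_comp T S : M T -> M S -> M (T \o S).
Proof. exact: commutant_comp. Qed.

Lemma vn_lincomb c T S : M T -> M S -> M (c *: T + S).
Proof. exact/commutant_lincomb/commutant_bounded. Qed.

Lemma vn_adjoint T : M T -> M (adjoint T).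
Proof.
apply: commutant_adjoint; first exact: commutant_bounded.
move=> S; apply: commutant_adjoint; first exact: group_alg_bounded.
by move=> B [n _ Bn]; exists n => //; exact: span_adjoint.
Qed.

Lemma vn_von_neumann : von_neumann_algebra M.
Proof.
split; [exact: vn_bounded | exact: vn_adjoint|].
by rewrite /M (tricommutant (@commutant_bounded _ _ _)).
Qed.

Lemma vn_adjointP T : M T -> is_adjoint T (adjoint T).
Proof. by move=> /vn_bounded; exact: adjointP. Qed.

Lemma vn_scale c T : M T -> M (c *: T).
Proof.
by move=> MT; rewrite -[c](subrK 1) scalerDl scale1r; exact: vn_lincomb.
Qed.

Lemma vn_sub T S : M T -> M S -> M (T - S).
Proof. by move=> MT MS; rewrite addrC -scaleN1r; exact: vn_lincomb. Qed.

Lemma vn0 : M 0. Proof. by rewrite -(subrr idfun); apply: vn_sub; exact: vn_id. Qed.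

(** Right translations commute with left ones, so they lie in the commutant of [group_alg], whose
    own commutant is [M]. This is why the vector [T d1] determines [T]. *)
Lemma vn_rtrans T g : M T -> T \o rtrans g = rtrans g \o T.
Proof.
move=> [_]; apply; split=> [|S [n _ [c ->]]]; first exact: rtrans_bounded.
apply/funext => u /=; rewrite !sum_opE (linear_sum_seq (rtrans_bounded R g).1).
apply: eq_bigr => h _; rewrite -[LHS]/(rtrans g (c h *: ltrans h u)) ?rtransC //.
by rewrite -[in RHS]/(c h *: ltrans h (rtrans g u)) (linear_Z (rtrans_bounded R g).1);
  rewrite -[RHS]/(c h *: (ltrans h \o rtrans g) u) rtransC.
Qed.

Lemma vn_delta T (x : L) : M T -> T (delta R x) = rtrans x^-1 (T d1).
Proof.
move=> MT; have := congr1 (fun f => f d1) (vn_rtrans x^-1 MT) => /= <-.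
by rewrite rtrans_delta invgK mul1g.
Qed.

Lemma vn_ext T S : M T -> M S -> T d1 = S d1 -> T = S.
Proof.
move=> MT MS TS; apply: operator_ext; [exact: vn_bounded|exact: vn_bounded|].
by move=> x; rewrite (vn_delta x MT) (vn_delta x MS) TS.
Qed.

Definition vn_trace T : C := '[T d1, d1].

Lemma vn_adjoint_coord T (x : L) : M T ->
  (adjoint T d1 : ell2 R L) x = ((T d1 : ell2 R L) x^-1%g)^*.
Proof.
move=> MT; rewrite -(dot_delta (adjoint T d1)) (dot_conj (delta R x : H)).
rewrite -(vn_adjointP MT) vn_delta // dot_delta.
by rewrite rtransE mul1g.
Qed.

Lemma vn_trace_adjoint T S : M T -> M S -> vn_trace (T \o S) = '[S d1, adjoint T d1].
Proof. by move=> MT MS; rewrite /vn_trace /= (vn_adjointP MT). Qed.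

(** The coordinate at [x] of the adjoint applied to [d1] is the conjugate of the coordinate of
    [T d1] at the inverse of [x]. Both traces are therefore convolutions evaluated at 1, exchanged
    by the substitution of inverses. *)
Lemma vn_traceC T S : M T -> M S -> vn_trace (T \o S) = vn_trace (S \o T).
Proof.
move=> MT MS; rewrite (vn_trace_adjoint MT MS) (vn_trace_adjoint MS MT).
apply: (ell2_dot_eq (u := S d1)).
have := has_sum_bij (@invgK L) (@invgK L) (ell2_dotP (T d1) (adjoint S d1)).
congr has_sum; apply/funext => x /=.
by rewrite !vn_adjoint_coord // invgK !conjCK mulrC.
Qed.

Lemma vn_trace_sq T : M T -> vn_trace (adjoint T \o T) = '[T d1].
Proof.
move=> MT; rewrite vn_trace_adjoint //; last exact: vn_adjoint.
by rewrite (adjointE (is_adjoint_sym (vn_adjointP MT))).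
Qed.

Lemma vn_trace_lincomb c T S : vn_trace (c *: T + S) = c * vn_trace T + vn_trace S.
Proof.
rewrite /vn_trace -[(c *: T + S) d1]/(c *: T d1 + S d1).
by rewrite linearDl linearZl_LR.
Qed.

Lemma vn_trace_id : vn_trace idfun = 1.
Proof. by rewrite /vn_trace dot_delta /= eqxx. Qed.

Lemma vn_tracial : tracial_state M vn_trace.
Proof.
split; first by move=> c T S _ _; exact: vn_trace_lincomb.
- exact: vn_trace_id.
- by move=> T MT; rewrite vn_trace_sq // dnorm_ge0.
by move=> T S; exact: vn_traceC.
Qed.

(** Traciality gives [p = 1 - v (adjoint v)] trace zero. As [adjoint v] annihilates the range of
    [p], this trace is the squared norm of [p d1], and an element of [M] killing [d1] is zero. *)
Lemma vn_finite : finite_algebra M.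
Proof.
move=> v Mv vv; have Mv' := vn_adjoint Mv.
have Mvv : M (v \o adjoint v) by exact: vn_comp.
pose p := idfun - (v \o adjoint v); have Mp : M p by apply: vn_sub => //; exact: vn_id.
have pE u : p u = u - v (adjoint v u) by [].
have vvE u : adjoint v (v u) = u by have := congr1 (fun f => f u) vv.
have tp : '[p d1, d1] = 0.
  rewrite pE linearBl /= -[ '[v _, _] ]/(vn_trace (v \o adjoint v)) vn_traceC // vv.
  by rewrite subrr.
have pp : '[p d1] = 0.
  rewrite {2}pE linearBr /= tp sub0r -(is_adjoint_sym (vn_adjointP Mv)).
  by rewrite {1}pE (linear_B (vn_bounded Mv').1) vvE subrr linear0l oppr0.
have p0 : p = 0.
  by apply: vn_ext (vn0) _ => //; apply/eqP; rewrite -(dnorm_eq0 (hilbert_dot H)) pp.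
by apply/esym/eqP; rewrite -subr_eq0 -/p p0.
Qed.

(** For central [T] the coordinates of [T d1] are constant on conjugacy classes. A non-zero value on
    an infinite class would contradict square-summability, so only the coordinate at 1 survives. *)
Lemma vn_factor : is_factor M.
Proof.
split; first exact: vn_von_neumann.
  exists d1; rewrite -(dnorm_eq0 (hilbert_dot H)) dot_delta /= eqxx; exact: oner_neq0.
apply/seteqP; split=> [T [MT [_ CT]]|T [c ->]]; last first.
  split; first exact/vn_scale/vn_id.
  split=> [|S MS]; first by apply: vn_bounded; exact/vn_scale/vn_id.
  apply/funext => u; rewrite -[LHS]/(c *: S u) -[RHS]/(S (c *: u)).
  by rewrite (linear_Z (vn_bounded MS).1).
pose xi : ell2 R L := T d1.
have xiJ (x : L) g : xi (x ^ g)%g = xi x.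
  have := congr1 (fun f => f d1) (CT _ (vn_ltrans g)) => /=.
  rewrite ltrans_delta mulg1 vn_delta // => h.
  have := congr1 (fun f : H => (f : ell2 R L) (g * (x ^ g))%g) h.
  by rewrite rtransE ltransE mulKg conjgE mulKVg mulgK => ->.
have xi0 (x : L) : x != 1%g -> xi x = 0.
  move=> /L_icc[c cI]; apply/eqP/negP => /negP x0.
  have h n : n%:R * `|xi x| ^+ 2 <= '[T d1].
    have := ell2_psum_le xi [fset (x ^ c (val i))%g | i in 'I_n]%fset.
    apply: le_trans; rewrite /psum big_imfset /=; last first.
      by move=> i j _ _ /cI /val_inj.
    rewrite big_enum /= (eq_bigr (fun=> `|xi x| ^+ 2)) => [|i _]; last by rewrite xiJ.
    by rewrite sumr_const card_ord mulr_natl.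
  have x1 : 0 < `|xi x| ^+ 2 by rewrite exprn_gt0 // normr_gt0.
  pose r := '[T d1] / `|xi x| ^+ 2.
  have r0 : 0 <= r by rewrite divr_ge0 ?dnorm_ge0 // ltW.
  have rE : r = (complex.Re r)%:C by rewrite RRe_real // ger0_real.
  have := archi_boundP (x := complex.Re r); rewrite -ler0c -rE => /(_ r0).
  set n := Num.bound _; rewrite -ltcR -rE rmorph_nat /r ltr_pdivrMr // => /lt_geF.
  by rewrite h.
exists (xi 1%g); apply: vn_ext => //; first exact/vn_scale/vn_id.
apply: ell2_eq => x; rewrite -[RHS]/(xi 1%g * (x == 1%g)%:R).
by have [->|x1] := eqVneq; rewrite ?mulr1 // mulr0 -[LHS]/(xi x) xi0.
Qed.

Lemma vn_hyperfinite : hyperfinite M.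
Proof.
exists span_alg; split=> //; first exact: span_findim.
by move=> n; exact: span_mono.
Qed.

(** * Traces of projections and absence of minimal ones *)

Lemma vn_trace_sub T S : vn_trace (T - S) = vn_trace T - vn_trace S.
Proof. by rewrite addrC -scaleN1r vn_trace_lincomb mulN1r addrC. Qed.

Lemma vn_projectionP p : M p -> (forall x, p (p x) = p x) -> is_adjoint p p ->
  projection M p.
Proof.
by move=> Mp pp ap; split=> //; [apply/funext | exact: adjointE].
Qed.

Lemma vn_projection p : projection M p ->
  [/\ M p, forall x, p (p x) = p x, is_adjoint p p & forall x, '[p x] <= '[x]].
Proof.
move=> [Mp pp ap]; have pA : is_adjoint p p by rewrite -{2}ap; exact: vn_adjointP.
have ppx x : p (p x) = p x by have := congr1 (fun f => f x) pp.
split=> // x; have -> : '[x] = '[p x] + '[x - p x].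
  have h : '[p x, x - p x] = 0.
    by rewrite pA (linear_B (vn_bounded Mp).1) ppx subrr linear0r.
  by rewrite -[x in LHS](subrK (p x)) addrC dnormD h conjC0 !addr0.
by rewrite lerDl dnorm_ge0.
Qed.

Lemma vn_trace_projection p : projection M p -> vn_trace p = '[p d1].
Proof. by move=> /vn_projection[_ pp pA _]; rewrite /vn_trace -[in LHS]pp pA. Qed.

Lemma half_double u : (2^-1 : C) *: (u + u) = u.
Proof.
have -> : u + u = (2 : C) *: u by rewrite scaler_nat mulr2n.
by rewrite scalerA mulVf ?scale1r // pnatr_eq0.
Qed.

(* Some involution s outside K n commutes with e, and e s is traceless: e splits
   into the projections (e + e s) / 2 and (e - e s) / 2 of equal trace. *)
Lemma halve_projection n e p : span_alg n e -> projection M e -> e \o p <> 0 ->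
  linear p ->
  exists m f, [/\ span_alg m f, projection M f, vn_trace f = vn_trace e / 2
    & f \o p <> 0].
Proof.
move=> se /vn_projection[Me ee eA _] ep lp.
have le := (vn_bounded Me).1.
have [s [sK ss sC]] := K_involution n.
have sV : (s^-1 = s)%g by apply: (mulgI s); rewrite mulgV ss.
have [m' sm'] := K_cover s; pose m := maxn n m'.
have ssE u : ltrans s (ltrans s u) = u.
  by rewrite -[LHS]/((ltrans s \o ltrans s) u) -ltransM ss ltrans1.
have ls := (ltrans_bounded R s).1.
have eC u : e (ltrans s u) = ltrans s (e u).
  have [c ->] := se; rewrite !sum_opE (linear_sum_seq ls).
  apply: eq_big_seq => g /sC sg.
  rewrite -[LHS]/(c g *: (ltrans g \o ltrans s) u) -ltransM -sg.
  by rewrite -[X in ltrans s X]/(c g *: ltrans g u) (linear_Z ls) ltransM.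
pose es := e \o ltrans s.
have esE u : es u = e (ltrans s u) by [].
have ses : span_alg m es.
  apply: span_comp; first by apply: span_mono se; exact: leq_maxl.
  by apply: (@span_mono m'); [exact: leq_maxr | exact: span_ltrans].
have Mes : M es by apply: vn_comp => //; exact: vn_ltrans.
have esA : is_adjoint es es.
  by move=> u v; rewrite /es /= eA ltrans_is_adjoint sV eC.
have tes : vn_trace es = 0.
  rewrite /vn_trace esE ltrans_delta mulg1; have [c ->] := se.
  rewrite sum_opE linear_sumlz big_seq big1 // => g gK.
  rewrite -[(c g *: ltrans g) _]/(c g *: ltrans g (delta R s)) linearZl_LR /=.
  rewrite ltrans_delta dot_delta_delta; case: eqP => [gs|]; last by rewrite mulr0.
  suff : s \in K n by rewrite (negPf sK).
  have -> : s = (g^-1)%g by apply: (mulgI g); rewrite -gs mulgV.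
  exact: K_inv.
pose f c := (2^-1 : C) *: (c *: es + e).
have fE c u : f c u = (2^-1 : C) *: (c *: es u + e u) by [].
have fP c : c * c = 1 -> c^* = c -> projection M (f c).
  move=> cc cJ; apply: vn_projectionP.
  - exact/vn_scale/vn_lincomb.
  - move=> u; have eses v : es (es v) = e v.
      by rewrite !esE [e (ltrans s (e _))]eC ee eC ssE -?eC.
    have ees v : e (es v) = es v by rewrite esE ee.
    have ese v : es (e v) = es v by rewrite !esE eC ee -eC.
    have les := (vn_bounded Mes).1.
    rewrite [LHS]fE fE (linear_Z les) (linear_D les) (linear_Z les).
    rewrite (linear_Z le) (linear_D le) (linear_Z le) eses ees ese ee.
    rewrite scalerA mulrC -scalerA -scalerDr; congr (_ *: _).
    rewrite [c *: (_ + _)]scalerDr scalerA cc scale1r [e u + _]addrC.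
    exact: half_double.
  have h : is_adjoint (c *: es + e) (c *: es + e).
    by rewrite -{2}cJ; exact: is_adjoint_lincomb.
  move=> u v; rewrite fE linearZl_LR /=.
  rewrite [RHS](_ : _ = (2^-1 : C)^* * '[u, (c *: es + e) v]).
    by rewrite h fmorphV /= conjC_nat.
  by rewrite fE linearZr_LR.
have fs c : span_alg m (f c).
  rewrite -[f c]addr0; apply: span_lincomb; last exact: span0.
  by apply: span_lincomb => //; apply: span_mono se; exact: leq_maxl.
have ft c : vn_trace (f c) = vn_trace e / 2.
  rewrite -[f c]addr0 vn_trace_lincomb vn_trace_lincomb tes mulr0 add0r.
  by rewrite /vn_trace linear0l addr0 mulrC.
have fD u : e u = f 1 u + f (-1) u.
  rewrite !fE scaleN1r scale1r -scalerDr addrACA subrr add0r.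
  by rewrite half_double.
have [f1|f1] := pselect (f 1 \o p = 0); last first.
  by exists m, (f 1); split=> //; apply: fP; rewrite ?mul1r ?conjC1.
exists m, (f (-1)); split=> //; first by apply: fP; rewrite ?mulrNN ?mul1r ?rmorphN1.
move=> f2; apply: ep; apply/funext => u /=.
have := congr1 (fun h : H -> H => h u) f1.
have := congr1 (fun h : H -> H => h u) f2 => /= h2 h1.
by rewrite fD h1 h2 addr0.
Qed.

(** Halving starts from the identity. At each stage a half that does not annihilate [p] is kept,
    since the two halves add up to [e]. *)
Lemma small_projection p : projection M p -> p <> 0 -> forall k,
  exists n e, [/\ span_alg n e, projection M e, vn_trace e = 2 ^- k & e \o p <> 0].
Proof.
move=> Pp p0; elim=> [|k [n [e [se Pe te ep]]]].
  exists 0%N, idfun; split=> //.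
  - by rewrite -(ltrans1 R); exact: span_ltrans.
  - by apply: vn_projectionP => //; exact: vn_id.
  - by rewrite expr0 invr1 vn_trace_id.
have [Mp _ _ _] := vn_projection Pp.
have [m [f [sf Pf tf fp]]] := halve_projection se Pe ep (vn_bounded Mp).1.
by exists m, f; split=> //; rewrite tf te exprS invfM mulrC.
Qed.

(** Besides [b = p (1 - e) p], the mirror operator [d = e (1 - p) e] is used. The powers satisfy
    [B n p e = p e D n], and with traciality this gives [B n] and [D n] the same trace decrements.
    From [B 0 = p] and [D 0 = e] follows [tr (B n) = tr p - tr e + tr (D n)], where the last term is
    non-negative for even [n]. *)
Lemma vn_subprojection p e : projection M p -> projection M e ->
  vn_trace e < vn_trace p -> e \o p <> 0 ->
  exists q, [/\ projection M q, p \o q = q, q <> 0 & q <> p].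
Proof.
move=> Pp Pe ltep ep0.
have [Mp pp pA pc] := vn_projection Pp; have [Me ee eA ec] := vn_projection Pe.
have lp := (vn_bounded Mp).1; have le := (vn_bounded Me).1.
pose b : H -> H := p - (p \o e \o p); pose d : H -> H := e - (e \o p \o e).
have bE x : b x = p x - p (e (p x)) by [].
have dE x : d x = e x - e (p (e x)) by [].
have Mb : M b by apply: vn_sub => //; apply: vn_comp => //; exact: vn_comp.
have Md : M d by apply: vn_sub => //; apply: vn_comp => //; exact: vn_comp.
have pb x : p (b x) = b x by rewrite bE (linear_B lp) !pp.
have bp x : b (p x) = b x by rewrite !bE !pp.
have ed x : e (d x) = d x by rewrite dE (linear_B le) !ee.
have de x : d (e x) = d x by rewrite !dE !ee.
have bA : is_adjoint b b.
  by move=> x y; rewrite !bE linearBl linearBr /= pA pA eA pA.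
have dA : is_adjoint d d.
  by move=> x y; rewrite !dE linearBl linearBr /= eA eA pA eA.
have be x : '[b x] <= '[p x - e (p x)].
  have -> : b x = p (p x - e (p x)) by rewrite (linear_B lp) pp.
  exact: pc.
have e' x : '[x] = '[e x] + '[x - e x].
  have h : '[e x, x - e x] = 0 by rewrite eA (linear_B le) ee subrr linear0r.
  by rewrite -[x in LHS](subrK (e x)) addrC dnormD h conjC0 !addr0.
have bc x : '[b x] <= '[x].
  by rewrite (le_trans (be x)) // (le_trans _ (pc x)) // [leRHS]e' lerDr dnorm_ge0.
pose B := pw p b; pose D := pw e d.
have MB n : M (B n).
  by elim: n => [|n IH] //; have := vn_comp Mb IH.
have MD n : M (D n).
  by elim: n => [|n IH] //; have := vn_comp Md IH.
have BpeD n y : B n (p (e y)) = p (e (D n y)).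
  elim: n y => [|n IH] y; first by rewrite /B /D /pw /= pp ee.
  have -> : B n.+1 (p (e y)) = b (B n (p (e y))) by [].
  rewrite IH bE pp -/(D n y).
  have -> : D n.+1 y = d (D n y) by [].
  by rewrite dE !(linear_B le) !(linear_B lp) !ee.
have step n : vn_trace (B n) - vn_trace (B n.+1) = vn_trace (D n) - vn_trace (D n.+1).
  rewrite -!vn_trace_sub.
  have -> : B n - B n.+1 = (B n \o (p \o e)) \o (e \o p).
    apply/funext => x; rewrite -[LHS]/(B n x - B n.+1 x) /B pwSr // -/B.
    have Bp : B n (p x) = B n x := pw_q b pp n x.
    rewrite -[X in X - _]Bp -(linear_B (vn_bounded (MB n)).1) bE.
    by rewrite opprB addrC subrK /= ee.
  rewrite (vn_traceC (vn_comp (MB n) (vn_comp Mp Me)) (vn_comp Me Mp)).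
  congr vn_trace; apply/funext => y /=.
  rewrite BpeD pp -[RHS]/(D n y - d (D n y)) dE.
  have -> : e (D n y) = D n y by exact: q_pw.
  by rewrite opprB addrC subrK.
have trB n : vn_trace (B n) = vn_trace p - vn_trace e + vn_trace (D n).
  elim: n => [|n IH]; first by rewrite subrK.
  have := step n; rewrite IH => h.
  rewrite -[LHS](subKr (vn_trace p - vn_trace e + vn_trace (D n))) h.
  by rewrite opprB addrA addrAC addrK.
have trB_ge n : vn_trace p - vn_trace e <= vn_trace (B n.*2).
  rewrite trB lerDl /vn_trace -dnorm_pw_even ?dnorm_ge0 //; exact: vn_bounded.
have [Q [bQ QA BQ QQ W]] :=
  pw_strong_limit (vn_bounded Mp) (vn_bounded Mb) pp pb bp pA bA bc pc.
(* Each [B n] commutes with the commutant, and this passes to weak limits. *)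
have MQ : M Q.
  split=> // S XS; have bS := commutant_bounded XS.
  apply/funext => x; apply: dot_ext => y /=.
  rewrite (adjointP bS); apply: cvgC_unique (W _ _) _.
  have := W x (adjoint S y); under eq_fun do rewrite -(adjointP bS).
  have h n : S (B n.*2 x) = B n.*2 (S x).
    by have := congr1 (fun f => f x) ((MB n.*2).2 S XS) => /= ->.
  by under eq_fun do rewrite h.
exists Q; split.
- exact: vn_projectionP.
- by apply/funext => x; exact: (BQ 0%N).
- move=> Q0; have := W d1 d1; rewrite Q0 linear0l => /cvgrPdist_lt.
  have t0 : 0 < vn_trace p - vn_trace e by rewrite subr_gt0.
  move=> /(_ _ t0)[N _ /(_ N (leqnn N))]; rewrite /= sub0r normrN.
  rewrite -/B -[ '[_, _] ]/(vn_trace (B N.*2)) ger0_norm; first by rewrite le_gtF.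
  exact: le_trans (ltW t0) (trB_ge N).
(* If [Q = p], then [b (b (p x)) = p x]; as [b] contracts and factors through [1 - e], the norm of
   [p x] is at most that of [p x - e (p x)], so Pythagoras forces [e (p x) = 0]. *)
move=> Qp; apply: ep0; apply/funext => x; apply/eqP.
rewrite -[_ == 0](dnorm_eq0 (hilbert_dot H)) eq_le dnorm_ge0 andbT /=.
have := BQ 1%N x; rewrite Qp => h.
have : '[p x] <= '[p x - e (p x)].
  have hh : b (b (p x)) = p x by move: h; rewrite /pw /= pp.
  have -> : '[p x] = '[b (b (p x))] by rewrite hh.
  by apply: le_trans (bc _) _; have := be (p x); rewrite pp.
by rewrite {1}[ '[p x] ]e' gerDr.
Qed.

Lemma vn_no_minimal : ~ exists p, minimal_projection M p.
Proof.
move=> [p [Pp p0 pmin]].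
have tp : 0 < vn_trace p.
  rewrite vn_trace_projection // lt_def dnorm_ge0 andbT dnorm_eq0.
  apply/eqP => h; apply: p0; have [Mp _ _] := Pp.
  by apply: vn_ext => //; exact: vn0.
have [k hk] : exists k, 2 ^- k < vn_trace p.
  have rE : vn_trace p = (complex.Re (vn_trace p))%:C by rewrite RRe_real // gtr0_real.
  set r := complex.Re _ in rE; rewrite rE ltcR in tp *.
  have := archi_boundP (x := r^-1); rewrite invr_ge0 => /(_ (ltW tp)).
  set k := Num.bound _ => hk; exists k.
  have -> : 2 ^- k = (2 ^- k)%:C :> C by rewrite fmorphV rmorphXn /= rmorph_nat.
  rewrite ltcR invf_plt ?posrE ?exprn_gt0 // (lt_le_trans hk) //.
  by rewrite -natrX ler_nat ltnW // ltn_expl.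
have [n [e [_ Pe te ep]]] := small_projection Pp p0 k.
have [|q [Pq pq q0 qp]] := vn_subprojection Pp Pe _ ep; first by rewrite te.
by case: (pmin q Pq pq).
Qed.

Definition group_factor : hyperfiniteII1Factor R :=
  HyperfiniteII1Factor (And3 vn_factor vn_finite vn_no_minimal) vn_hyperfinite vn_tracial.

(** * Local embeddings into the tracial ultrapower *)

Section LocalEmbedding.
Variable w : set_system nat.
Context {wU : UltraFilter w}.
Local Notation family := (nat -> H -> H).
Implicit Types a b c : family.

Local Notation bounded := (@bounded_families R group_factor nat).
Local Notation null := (@null_families R group_factor nat w).
Local Notation coset := (@ucoset R group_factor nat w).
Local Notation fmul := (@family_mul R group_factor nat).
Local Notation fstar := (@family_star R group_factor nat).

Lemma bounded_familyP a :
  bounded a <-> (forall n, M (a n)) /\ exists K : C, forall n, bound_by (a n) K.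
Proof.
split=> -[Ma [k ak]]; split=> //.
  by exists (`|k| ^+ 2) => n; exact: norm_le_bound.
by exists (sqrtC k) => n; exact: bound_norm_le.
Qed.

Lemma bounded_familyM a b : bounded a -> bounded b -> bounded (fmul a b).
Proof.
move=> /bounded_familyP[Ma [k ak]] /bounded_familyP[Mb [l bl]].
apply/bounded_familyP; split=> [n|]; first exact: vn_comp.
exists (k * l) => n; split; first by apply: mulr_ge0; [exact: (ak n).1|exact: (bl n).1].
move=> x; apply: le_trans ((ak n).2 _) _; rewrite -mulrA.
by apply: ler_wpM2l; [exact: (ak n).1|exact: (bl n).2].
Qed.

Lemma bounded_familyB a b : bounded a -> bounded b -> bounded (a - b).
Proof.
move=> /bounded_familyP[Ma [k ak]] /bounded_familyP[Mb [l bl]].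
apply/bounded_familyP; split=> [n|]; first exact: vn_sub.
exists (2 * k + 2 * l) => n; have k0 := (ak n).1; have l0 := (bl n).1.
split=> [|x]; first by rewrite addr_ge0 // mulr_ge0.
apply: le_trans (dnormD_le _ _) _; rewrite linearNl linearNr opprK.
by rewrite [leRHS]mulrDl -!mulrA lerD // ler_wpM2l //; [exact: (ak n).2|exact: (bl n).2].
Qed.

Lemma bounded_familyV a : bounded a -> bounded (fstar a).
Proof.
move=> /bounded_familyP[Ma [k ak]]; apply/bounded_familyP; split=> [n|].
  exact: vn_adjoint.
by exists k => n; apply: adjoint_bound (ak n) _; exact: vn_adjointP.
Qed.

Lemma dnorm_adjoint T : M T -> '[adjoint T d1] = '[T d1].
Proof.
move=> MT; have MT' := vn_adjoint MT.
rewrite -(vn_trace_sq MT) vn_traceC // -(vn_trace_sq MT').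
by rewrite (adjointE (is_adjoint_sym (vn_adjointP MT))).
Qed.

(** Traciality turns the trace of [a n] times its adjoint into the squared norm of [a n d1]: null
    families are those that tend to 0 in the 2-norm. *)
Lemma null_familyP a : bounded a ->
  null a <-> forall e : C, 0 < e -> w [set n | '[a n d1] < e].
Proof.
move=> ba; have [Ma _] := ba.
have trE n : vn_trace (a n \o adjoint (a n)) = '[a n d1].
  have Mn : M (a n) := Ma n.
  by rewrite (vn_traceC Mn (vn_adjoint Mn)); exact: vn_trace_sq.
split=> [[_ /cvgrPdist_lt h] e /h|h].
  by apply: filterS => n /=; rewrite sub0r normrN trE ger0_norm ?dnorm_ge0.
split=> //; apply/cvgrPdist_lt => e /h; apply: filterS => n /= an.
by rewrite sub0r normrN trE ger0_norm ?dnorm_ge0.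
Qed.

Lemma null_eventually a : bounded a -> w [set n | a n = 0] -> null a.
Proof.
move=> ba a0; apply/null_familyP => // e e0; apply: filterS a0 => n /= ->.
by rewrite linear0l.
Qed.

Lemma null_bounded a : null a -> bounded a. Proof. by case. Qed.

Lemma bounded_familyD a b : bounded a -> bounded b -> bounded (a + b).
Proof.
have z : bounded (fun=> 0).
  apply/bounded_familyP; split=> [n|]; first exact: vn0.
  by exists 0 => n; split=> // x; rewrite linear0l mul0r.
move=> ba bb; rewrite -[b]opprK; apply: bounded_familyB => //.
by rewrite -[- b]sub0r; exact: bounded_familyB.
Qed.

Lemma null_add a b : null a -> null b -> null (a + b).
Proof.
move=> na nb; have ba := null_bounded na; have bb := null_bounded nb.
apply/null_familyP; first exact: bounded_familyD.
move=> e e0; have e40 : 0 < e / 4 by rewrite divr_gt0.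
have := (null_familyP ba).1 na _ e40; have := (null_familyP bb).1 nb _ e40.
apply: filterS2 => n /= hb ha; change ('[a n d1 + b n d1] < e).
apply: le_lt_trans (dnormD_le _ _) _.
have -> : e = 2 * (e / 4) + 2 * (e / 4) by field.
by rewrite ltrD // ltr_pM2l.
Qed.

Lemma null_mull a b : bounded a -> null b -> null (fmul a b).
Proof.
move=> ba nb; have bb := null_bounded nb.
apply/null_familyP; first exact: bounded_familyM.
have /bounded_familyP[Ma [k ak]] := ba.
move=> e e0; have k1 : 0 < k + 1 by rewrite ltr_wpDl // (ak 0%N).1.
have e1 : 0 < e / (k + 1) by rewrite divr_gt0.
have := (null_familyP bb).1 nb _ e1; apply: filterS => n /= h.
apply: le_lt_trans ((ak n).2 _) _.
apply: (@le_lt_trans _ _ ((k + 1) * '[b n d1])).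
  by rewrite ler_wpM2r ?dnorm_ge0 // lerDl ler01.
by rewrite mulrC -ltr_pdivlMr.
Qed.

Lemma null_star a : null a -> null (fstar a).
Proof.
move=> na; have ba := null_bounded na; apply/null_familyP; first exact: bounded_familyV.
move=> e /((null_familyP ba).1 na); apply: filterS => n /=.
by rewrite /family_star dnorm_adjoint //; exact: ba.1.
Qed.

Lemma family_starK a : bounded a -> fstar (fstar a) = a.
Proof.
move=> [Ma _]; apply/funext => n; exact: (adjointE (is_adjoint_sym (vn_adjointP (Ma n)))).
Qed.

Lemma family_starM a b : bounded a -> bounded b ->
  fstar (fmul a b) = fmul (fstar b) (fstar a).
Proof.
move=> [Ma _] [Mb _]; apply/funext => n; apply: adjointE.
exact: is_adjoint_comp (vn_adjointP (Ma n)) (vn_adjointP (Mb n)).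
Qed.

Lemma family_starB a b : bounded a -> bounded b ->
  fstar (a - b) = fstar a - fstar b.
Proof.
move=> [Ma _] [Mb _]; apply/funext => n; apply: adjointE => x y.
rewrite -[(a - b) n x]/(a n x - b n x) linearBl /=.
rewrite !(vn_adjointP (Ma _), vn_adjointP (Mb _)).
by rewrite -linearBr.
Qed.

(** The operator bound controls left multiplication at [d1], not right multiplication; the adjoint,
    an isometry for the 2-norm, exchanges the two. *)
Lemma null_mulr a b : null a -> bounded b -> null (fmul a b).
Proof.
move=> na bb; have ba := null_bounded na.
rewrite -(family_starK (bounded_familyM ba bb)) family_starM //.
by apply/null_star/null_mull; [exact: bounded_familyV | exact: null_star].
Qed.

Lemma null_trans a b c : null (a - b) -> null (b - c) -> null (a - c).
Proof. by move=> ab bc; have := null_add ab bc; rewrite addrA subrK. Qed.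

Lemma null_sym a b : bounded a -> bounded b -> null (a - b) -> null (b - a).
Proof.
move=> ba bb nab; apply/null_familyP; first exact: bounded_familyB.
have := (null_familyP (null_bounded nab)).1 nab => h e /h; apply: filterS => n /=.
rewrite -[(a - b) n d1]/(a n d1 - b n d1) -[(b - a) n d1]/(b n d1 - a n d1).
by rewrite -opprB linearNl linearNr opprK.
Qed.

Lemma cosetP a b : bounded a -> bounded b -> null (a - b) -> coset a = coset b.
Proof.
move=> ba bb ab; have ab' := null_sym ba bb ab.
by apply/seteqP; split=> c [bc nc]; split; [exact: bc|exact: (null_trans nc ab)|
  exact: bc|exact: (null_trans nc ab')].
Qed.

Lemma coset_refl a : bounded a -> coset a a.
Proof.
move=> ba; split; first exact: ba.
apply: null_eventually; first exact: (bounded_familyB ba ba).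
by apply: filterE => n; exact: subrr.
Qed.

Lemma coset_mul a b : bounded a -> bounded b ->
  @ultrapower_mul R group_factor nat w (coset a) (coset b) = coset (fmul a b).
Proof.
move=> ba bb; apply/seteqP; split=> [c [a' [b' [[ba' na] [bb' nb] h]]]|c h]; last first.
  by exists a, b; split; [exact: coset_refl|exact: coset_refl|exact: h].
suff <- : coset (fmul a' b') = coset (fmul a b) by exact: h.
apply: cosetP; [exact: bounded_familyM|exact: bounded_familyM|].
apply: (@null_trans _ (fmul a b')).
  have -> : fmul a' b' - fmul a b' = fmul (a' - a) b' by [].
  exact: (null_mulr na bb').
have -> : fmul a b' - fmul a b = fmul a (b' - b).
  apply/funext => n; apply/funext => x.
  by rewrite -[LHS]/(a n (b' n x) - a n (b n x)) -(linear_B (vn_bounded (ba.1 n)).1).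
exact: (null_mull ba nb).
Qed.

Lemma coset_star a : bounded a ->
  @ultrapower_star R group_factor nat w (coset a) = coset (fstar a).
Proof.
move=> ba; apply/seteqP; split=> [c [a' [ba' na] h]|c h]; last first.
  by exists a; [exact: coset_refl|exact: h].
suff <- : coset (fstar a') = coset (fstar a) by exact: h.
apply: cosetP; [exact: bounded_familyV|exact: bounded_familyV|].
by rewrite -(family_starB ba' ba); exact: (null_star na).
Qed.

(** Where [phi n] is multiplicative on a pair the error family is exactly 0, hence null. Where it
    separates a pair, the two basis vectors are orthogonal, at squared distance 2; the test value 1
    then rules out equal cosets. *)
Lemma local_embedding_hyperlinear (G : groupType) (phi : nat -> G -> L) :
  countable [set: G] ->
  (forall g h : G, w [set n | phi n (g * h)%g = (phi n g * phi n h)%g]) ->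
  (forall g h : G, g <> h -> w [set n | phi n g <> phi n h]) ->
  hyperlinear R G.
Proof.
move=> cG phiM phiI; split=> //; exists group_factor, nat, w; split=> //.
pose a (g : G) : family := fun n => ltrans (phi n g).
have ba (g : G) : bounded (a g).
  apply/bounded_familyP; split=> [n|]; first exact: vn_ltrans.
  by exists 1 => n; split=> // x; rewrite ltrans_dot mul1r.
exists (fun g : G => coset (a g)); split=> [g|g h|g h gh].
- have aV : fmul (a g) (fstar (a g)) = @family_one _ group_factor nat.
    apply/funext => n; rewrite /family_mul /family_star /a adjoint_ltrans -ltransM.
    by rewrite mulgV ltrans1.
  have Va : fmul (fstar (a g)) (a g) = @family_one _ group_factor nat.
    apply/funext => n; rewrite /family_mul /family_star /a adjoint_ltrans -ltransM.
    by rewrite mulVg ltrans1.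
  have bV := bounded_familyV (ba g).
  split; first by exists (a g); [exact: ba|].
    by rewrite (coset_star (ba g)) (coset_mul (ba g) bV) aV.
  by rewrite (coset_star (ba g)) (coset_mul bV (ba g)) Va.
- rewrite (coset_mul (ba g) (ba h)).
  have bgh := bounded_familyM (ba g) (ba h).
  apply: (cosetP (ba _) bgh).
  apply: null_eventually; first exact: (bounded_familyB (ba _) bgh).
  apply: filterS (phiM g h) => n /= e.
  rewrite -[LHS]/(a (g * h)%g n - (a g n \o a h n)) /a e ltransM; exact: subrr.
- have [//|ngh] := pselect (g = h).
  have : coset (a h) (a g) by rewrite -gh; exact: coset_refl.
  move=> [_ ngh']; have := (null_familyP (null_bounded ngh')).1 ngh' 1 ltr01.
  move=> /(filterI (phiI _ _ ngh)) /filter_ex [n [/= nn]].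
  rewrite -[(a g - a h) n d1]/(ltrans (phi n g) d1 - ltrans (phi n h) d1).
  rewrite !ltrans_delta !mulg1 dnormB !dot_delta_delta !eqxx.
  case: eqP => [e|_]; first by case: nn.
  rewrite conjC0 !addr0 subr0 -[ltLHS]/(2 : C) => /ltW; by rewrite lern1.
Qed.

End LocalEmbedding.

End GroupFactor.

(** * The finitary symmetric group *)

Section FinitarySymmetricGroup.

Definition finsym_pred : {pred nat -> nat} := fun f =>
  `[< exists n (g : nat -> nat),
        [/\ cancel f g, cancel g f & forall k, (n <= k)%N -> f k = k] >].

Record finsym := FinSym { finsym_fun :> nat -> nat; _ : finsym_fun \in finsym_pred }.

HB.instance Definition _ := [isSub for finsym_fun].
HB.instance Definition _ := [Choice of finsym by <:].

Implicit Types f g h : finsym.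

Lemma finsym_eq f g : (forall k, f k = g k) -> f = g.
Proof. by move=> fg; apply/val_inj/funext. Qed.

Lemma finsymP f : exists n (g : nat -> nat),
  [/\ cancel f g, cancel g f & forall k, (n <= k)%N -> f k = k].
Proof. by case: f => f /= /asboolP. Qed.

Definition finsym_inv_fun f : nat -> nat :=
  xget (idfun : nat -> nat) [set g | cancel f g /\ cancel g f].

Lemma finsym_invP f : [/\ cancel f (finsym_inv_fun f), cancel (finsym_inv_fun f) f &
  exists n, forall k, (n <= k)%N -> f k = k].
Proof.
have [n [g [fg gf fn]]] := finsymP f.
have [] : [set g | cancel f g /\ cancel g f] (finsym_inv_fun f).
  by apply: xgetPex; exists g.
by split=> //; exists n.
Qed.

Lemma finsym_inj f : injective f.
Proof. by have [/can_inj] := finsym_invP f. Qed.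

Lemma finsym_one_subproof : idfun \in finsym_pred.
Proof. by apply/asboolP; exists 0%N, idfun. Qed.

Lemma finsym_inv_subproof f : finsym_inv_fun f \in finsym_pred.
Proof.
have [fg gf [n fk]] := finsym_invP f; apply/asboolP; exists n, f; split=> // k nk.
by apply: (@finsym_inj f); rewrite gf fk.
Qed.

(* As for permutations in [perm], products are composed from left to right. *)
Lemma finsym_mul_subproof f g : g \o f \in finsym_pred.
Proof.
have [fK f'K [n fk]] := finsym_invP f; have [gK g'K [m gk]] := finsym_invP g.
apply/asboolP; exists (maxn n m), (finsym_inv_fun f \o finsym_inv_fun g).
split=> [k|k|k] /=; rewrite ?gK ?fK ?f'K ?g'K //.
by rewrite geq_max => /andP[nk mk]; rewrite fk // gk.
Qed.

Definition finsym_one : finsym := FinSym finsym_one_subproof.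
Definition finsym_inv f : finsym := FinSym (finsym_inv_subproof f).
Definition finsym_mul f g : finsym := FinSym (finsym_mul_subproof f g).

Lemma finsym_mulA : associative finsym_mul.
Proof. by move=> f g h; exact: finsym_eq. Qed.
Lemma finsym_mul1g : left_id finsym_one finsym_mul.
Proof. by move=> f; exact: finsym_eq. Qed.
Lemma finsym_mulg1 : right_id finsym_one finsym_mul.
Proof. by move=> f; exact: finsym_eq. Qed.
Lemma finsym_mulVg : left_inverse finsym_one finsym_inv finsym_mul.
Proof. by move=> f; apply: finsym_eq => k; have [_ + _] := finsym_invP f; exact. Qed.
Lemma finsym_mulgV : right_inverse finsym_one finsym_inv finsym_mul.
Proof. by move=> f; apply: finsym_eq => k; have [+ _ _] := finsym_invP f; exact. Qed.

HB.instance Definition _ := isGroup.Build finsym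
  finsym_mulA finsym_mul1g finsym_mulg1 finsym_mulVg finsym_mulgV.

Lemma finsymM f g k : (f * g)%g k = g (f k). Proof. by []. Qed.
Lemma finsymVK f k : (f^-1)%g (f k) = k.
Proof. by rewrite -finsymM mulgV. Qed.

Definition fixes_from n f := forall k, (n <= k)%N -> f k = k.

Lemma fixes_from_lt n f k : fixes_from n f -> (k < n)%N -> (f k < n)%N.
Proof.
move=> fn kn; rewrite ltnNge; apply/negP => nfk.
by have := fn _ nfk => /finsym_inj e; rewrite e leqNgt kn in nfk.
Qed.

Lemma fixes_from_finite n : finite_set [set f | fixes_from n f].
Proof.
pose F (t : {ffun 'I_n -> 'I_n}) : finsym :=
  xget 1%g [set f | fixes_from n f /\ forall i : 'I_n, f i = t i].
apply: (@sub_finite_set _ _ (F @` setT)); last exact/finite_image/finite_finset.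
move=> f fn; exists [ffun i : 'I_n => Ordinal (fixes_from_lt fn (ltn_ord i))] => //.
rewrite /F; case: xgetP => [g _ [gn gf]|/(_ f)[]]; last first.
  by split=> // i; rewrite ffunE.
apply: finsym_eq => k; have [nk|kn] := leqP n k; first by rewrite gn // fn.
by have := gf (Ordinal kn); rewrite ffunE.
Qed.

Definition finsym_chain n : {fset finsym} := fset_set [set f | fixes_from n f].

Lemma finsym_chainP n f : reflect (fixes_from n f) (f \in finsym_chain n).
Proof.
rewrite in_fset_set; last exact: fixes_from_finite.
by apply: (iffP idP) => [/set_mem|/mem_set].
Qed.

Lemma finsym_chain_id n : 1%g \in finsym_chain n.
Proof. exact/finsym_chainP. Qed.

Lemma finsym_chain_mul n :
  {in finsym_chain n &, forall f g, (f * g)%g \in finsym_chain n}.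
Proof.
move=> f g /finsym_chainP fn /finsym_chainP gn; apply/finsym_chainP => k nk.
by rewrite finsymM fn // gn.
Qed.

Lemma finsym_chain_inv n : {in finsym_chain n, forall f, f^-1%g \in finsym_chain n}.
Proof.
move=> f /finsym_chainP fn; apply/finsym_chainP => k nk.
by rewrite -{1}(fn k nk) finsymVK.
Qed.

Lemma finsym_chain_sub n : {subset finsym_chain n <= finsym_chain n.+1}.
Proof. by move=> f /finsym_chainP fn; apply/finsym_chainP => k /ltnW /fn. Qed.

Lemma finsym_chain_cover f : exists n, f \in finsym_chain n.
Proof. by have [_ _ [n fn]] := finsym_invP f; exists n; exact/finsym_chainP. Qed.

Definition swapn a b k : nat := if k == a then b else if k == b then a else k.

Lemma swapnK a b : involutive (swapn a b).
Proof.
move=> k; rewrite /swapn; have [->|ka] := eqVneq k a.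
  by rewrite eqxx; case: eqP.
by have [->|kb] := eqVneq k b; rewrite ?eqxx // (negPf ka) (negPf kb).
Qed.

Lemma swapn_subproof a b : swapn a b \in finsym_pred.
Proof.
apply/asboolP; exists (maxn a b).+1, (swapn a b); split; try exact: swapnK.
move=> k; rewrite gtn_max => /andP[ak bk].
by rewrite /swapn (gtn_eqF ak) (gtn_eqF bk).
Qed.

Definition finsym_swap a b : finsym := FinSym (swapn_subproof a b).

Lemma finsym_swapV a b : (finsym_swap a b)^-1%g = finsym_swap a b.
Proof.
apply: (mulgI (finsym_swap a b)); rewrite mulgV; apply: finsym_eq => k.
by rewrite finsymM; exact/esym/swapnK.
Qed.

(** The swap of [f a] with a far point [c] fixes [a], so the conjugate of [f] sends [a] to [c];
    infinitely many [c] are available. *)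
Lemma finsym_icc f : f != 1%g -> exists c : nat -> finsym, injective (fun n => f ^ c n)%g.
Proof.
move=> f1; have [a fa] : exists a, f a != a.
  apply/not_existsP => h; move/eqP: f1; apply; apply: finsym_eq => k.
  by apply/eqP/negP => /negP /h.
have [_ _ [N fN]] := finsym_invP f.
exists (fun n => finsym_swap (f a) (maxn a (f a) + n).+1) => n m.
move=> /(congr1 (fun h : finsym => h a)).
have E i : (f ^ finsym_swap (f a) (maxn a (f a) + i).+1)%g a = (maxn a (f a) + i).+1.
  rewrite conjgE !finsymM finsym_swapV /= /swapn [a == f a]eq_sym (negPf fa).
  have lt : (a < (maxn a (f a) + i).+1)%N.
    by rewrite ltnS (leq_trans (leq_maxl a (f a))) // leq_addr.
  by rewrite (ltn_eqF lt) eqxx.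
by rewrite !E => -[] /addnI.
Qed.

(** The swap of [n] and [n.+1] is disjoint from every permutation supported below [n]. *)
Lemma finsym_involution n : exists s : finsym,
  [/\ s \notin finsym_chain n, (s * s = 1)%g &
      {in finsym_chain n, forall g, (s * g = g * s)%g}].
Proof.
exists (finsym_swap n n.+1); split.
- apply/negP => /finsym_chainP /(_ n (leqnn n)) /=; rewrite /swapn eqxx => e.
  by move/eqP: e; rewrite gtn_eqF.
- by rewrite -{1}finsym_swapV mulVg.
- move=> g /finsym_chainP gn; apply: finsym_eq => k; rewrite !finsymM /= /swapn.
  have [kn|nk] := ltnP k n.
    have gk := fixes_from_lt gn kn.
    by rewrite !ltn_eqF // ltnW.
  rewrite (gn k nk); case: ifP => [_|_]; first by rewrite gn.
  by case: ifP => _; rewrite gn.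
Qed.

(** * Finite symmetric groups inside the finitary one *)

Section PermEmbedding.
Variable X : finType.
Implicit Types s t : {perm X}.

(** Transport along the numbering of [X]; numbers that encode no element are fixed, and the codes of
    a finite type are bounded. *)
Definition perm_nat s k := if @pickle_inv X k is Some x then choice.pickle (s x) else k.

Lemma perm_nat_pickle s x : perm_nat s (choice.pickle x) = choice.pickle (s x).
Proof. by rewrite /perm_nat pickleK_inv. Qed.

Lemma perm_natM s t : perm_nat (s * t)%g =1 perm_nat t \o perm_nat s.
Proof.
move=> k /=; rewrite /perm_nat; case E : (@pickle_inv X k) => [x|]; rewrite ?E //.
by rewrite pickleK_inv permM.
Qed.

Lemma perm_nat1 : perm_nat 1%g =1 id.
Proof.
move=> k; rewrite /perm_nat; have := @pickle_invK X k.
by case: pickle_inv => //= x; rewrite perm1.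
Qed.

Lemma perm_nat_subproof s : perm_nat s \in finsym_pred.
Proof.
apply/asboolP; exists (\max_(x : X) (choice.pickle x).+1)%N, (perm_nat s^-1%g); split=> k.
- by rewrite -[LHS]/((perm_nat s^-1%g \o perm_nat s) k) -perm_natM mulgV perm_nat1.
- by rewrite -[LHS]/((perm_nat s \o perm_nat s^-1%g) k) -perm_natM mulVg perm_nat1.
rewrite /perm_nat => nk; have := @pickle_invK X k.
case: pickle_inv => //= x xk; move: nk; rewrite -xk => nk.
have := leq_bigmax (F := fun x : X => (choice.pickle x).+1) x => /leq_trans /(_ nk).
by rewrite ltnn.
Qed.

Definition finsym_of_perm s : finsym := FinSym (perm_nat_subproof s).

Lemma finsym_of_permM s t :
  finsym_of_perm (s * t)%g = (finsym_of_perm s * finsym_of_perm t)%g.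
Proof. by apply: finsym_eq => k; exact: perm_natM. Qed.

Lemma finsym_of_perm_inj : injective finsym_of_perm.
Proof.
move=> s t st; apply/permP => x; apply: (pcan_inj (@pickleK_inv X)).
by rewrite -!perm_nat_pickle; have := congr1 (fun h : finsym => h (choice.pickle x)) st.
Qed.

End PermEmbedding.

End FinitarySymmetricGroup.

(** The sets [X n] may vary with [n], since all their symmetric groups land in the same finitary
    group. *)
Lemma hyperlinear_of_perms (R : realType) (G : groupType) (X : nat -> finType)
    (w : set_system nat) (phi : forall n, G -> {perm X n}) :
  UltraFilter w -> countable [set: G] ->
  (forall g h : G, w [set n | phi n (g * h)%g = (phi n g * phi n h)%g]) ->
  (forall g h : G, g <> h -> w [set n | phi n g <> phi n h]) ->
  hyperlinear R G.
Proof.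
move=> wU cG phiM phiI.
apply: (@local_embedding_hyperlinear R finsym (fun n => finsym_chain n : seq finsym)
  (fun n => fset_uniq _) finsym_chain_id finsym_chain_mul finsym_chain_inv
  finsym_chain_sub finsym_chain_cover
  finsym_icc finsym_involution w wU G
  (fun n g => finsym_of_perm (phi n g)) cG) => g h.
  by apply: filterS (phiM g h) => n /= ->; exact: finsym_of_permM.
by move=> gh; apply: filterS (phiI g h gh) => n /= + /finsym_of_perm_inj.
Qed.

(** * PSL_2(Q) *)

(** A set disjoint from its translates by [s] and by the square of [s] has three disjoint
    translates, the last two being disjoint by cancellation of [s]. Its measure is at most 1/3, so
    two such sets cannot cover. *)
Lemma amenable_no_three_translates (R : realType) (G : groupType)
    (A B : set G) (a b : G) :
  (forall q, A q \/ B q) ->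
  (forall q, A q -> ~ A (a * q)%g /\ ~ A (a * (a * q))%g) ->
  (forall q, B q -> ~ B (b * q)%g /\ ~ B (b * (b * q))%g) ->
  ~ amenable R G.
Proof.
move=> AB hA hB [mu [mu0 mu1 muU mul_mu]].
have mono S T : S `<=` T -> mu S <= mu T.
  move=> ST; rewrite -(setDUK ST) muU; first by rewrite lerDl.
  by apply/seteqP; split=> x // -[Sx []].
have third S s : (forall q, S q -> ~ S (s * q)%g /\ ~ S (s * (s * q))%g) ->
    mu S <= 3^-1.
  move=> hS; pose S1 := [set (s * x)%g | x in S]; pose S2 := [set (s * x)%g | x in S1].
  have S01 : S `&` S1 = set0.
    by apply/seteqP; split=> x // -[Sx [y Sy yx]]; have [] := hS y Sy; rewrite yx.
  have S012 : (S `|` S1) `&` S2 = set0.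
    apply/seteqP; split=> x // -[[Sx|[y Sy yx]] [_ [z Sz <-] zx]].
      by have [_] := hS z Sz; rewrite zx.
    by move: zx; rewrite -yx => /mulgI zy; have [+ _] := hS z Sz; rewrite zy.
  have := mono ((S `|` S1) `|` S2) setT (fun x _ => I).
  rewrite !muU // mu1 !mul_mu.
  have m0 := mu0 S; lra.
have := third A a hA; have := third B b hB.
have : 1 <= mu A + mu B.
  rewrite -mu1 (_ : [set: G] = A `|` (B `\` A)).
    rewrite muU; first by rewrite lerD2l; apply: mono => x [].
    by apply/seteqP; split=> x // -[Ax []].
  apply/seteqP; split=> x // _; have [Ax|nA] := pselect (A x); first by left.
  by right; split=> //; case: (AB x).
lra.
Qed.

(** By the triangle inequality [|a + t c| >= (t - 1) |c|], which exceeds [|c|] once [t > 2]. One and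
    two shears use it with [t = 3] and [t = 6]. *)
Lemma norm_shift_gt (K : realDomainType) (a c t : K) :
  `|a| <= `|c| -> c != 0 -> 3 <= t -> ~ `|a + t * c| <= `|c|.
Proof.
move=> ac; rewrite -normr_gt0 => c0 t3 h.
have : `|t * c| <= `|a + t * c| + `|a|.
  by have := ler_normB (a + t * c) a; rewrite (_ : a + t * c - a = t * c) //; ring.
have t0 : 0 <= t by lra.
rewrite normrM (ger0_norm t0) => h2.
have : 3 * `|c| <= t * `|c| by rewrite ler_wpM2r // ltW.
lra.
Qed.

(** * Two-by-two matrices over a field *)

Section TwoByTwo.
Variable F : fieldType.

(** The flattened form reduces matrix identities to [ring] on entries, and over a finite field it is
    directly a finite type on which to act. *)
Definition m2 : Type := (F * F * F * F)%type.
Implicit Types M N P : m2.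

Definition mul2 M N : m2 :=
  let: (a, b, c, d) := M in let: (a', b', c', d') := N in
  (a * a' + b * c', a * b' + b * d', c * a' + d * c', c * b' + d * d').
Definition one2 : m2 := (1, 0, 0, 1).
Definition det2 M : F := let: (a, b, c, d) := M in a * d - b * c.
Definition adj2 M : m2 := let: (a, b, c, d) := M in (d, - b, - c, a).
Definition neg2 M : m2 := let: (a, b, c, d) := M in (- a, - b, - c, - d).

Lemma m2_eq (a b c d a' b' c' d' : F) : a = a' -> b = b' -> c = c' -> d = d' ->
  (a, b, c, d) = (a', b', c', d') :> m2.
Proof. by move=> -> -> -> ->. Qed.

Lemma mul2A : associative mul2.
Proof.
by move=> [[[? ?] ?] ?] [[[? ?] ?] ?] [[[? ?] ?] ?]; apply: m2_eq; ring.
Qed.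

Lemma mul21 : right_id one2 mul2.
Proof. by move=> [[[? ?] ?] ?]; apply: m2_eq; ring. Qed.

Lemma mul12 : left_id one2 mul2.
Proof. by move=> [[[? ?] ?] ?]; apply: m2_eq; ring. Qed.

Lemma det2M M N : det2 (mul2 M N) = det2 M * det2 N.
Proof. by case: M N => [[[? ?] ?] ?] [[[? ?] ?] ?] /=; ring. Qed.

Lemma det21 : det2 one2 = 1.
Proof. by rewrite /=; ring. Qed.

Lemma det2_adj M : det2 (adj2 M) = det2 M.
Proof. by case: M => [[[? ?] ?] ?] /=; ring. Qed.

Lemma det2_neg M : det2 (neg2 M) = det2 M.
Proof. by case: M => [[[? ?] ?] ?] /=; ring. Qed.

Lemma mul2_adj M : det2 M = 1 -> mul2 M (adj2 M) = one2.
Proof.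
case: M => [[[a b] c] d] /= h; apply: m2_eq; rewrite -?h; ring.
Qed.

Lemma mul2_adjl M : det2 M = 1 -> mul2 (adj2 M) M = one2.
Proof.
case: M => [[[a b] c] d] /= h; apply: m2_eq; rewrite -?h; ring.
Qed.

Lemma neg2K : involutive neg2.
Proof. by move=> [[[? ?] ?] ?]; apply: m2_eq; ring. Qed.

Lemma mul2N M N : mul2 M (neg2 N) = neg2 (mul2 M N).
Proof. by case: M N => [[[? ?] ?] ?] [[[? ?] ?] ?]; apply: m2_eq; ring. Qed.

Lemma mulN2 M N : mul2 (neg2 M) N = neg2 (mul2 M N).
Proof. by case: M N => [[[? ?] ?] ?] [[[? ?] ?] ?]; apply: m2_eq; ring. Qed.

Lemma adj2N M : adj2 (neg2 M) = neg2 (adj2 M).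
Proof. by case: M => [[[? ?] ?] ?]; apply: m2_eq; ring. Qed.

Lemma adj2M M N : adj2 (mul2 M N) = mul2 (adj2 N) (adj2 M).
Proof. by case: M N => [[[? ?] ?] ?] [[[? ?] ?] ?]; apply: m2_eq; ring. Qed.

(** For determinant 1 this is a right action by conjugation, in agreement with the left-to-right
    product of permutations. *)
Definition conj2 M X : m2 := mul2 (mul2 (adj2 M) X) M.

Lemma conj2M M N X : conj2 (mul2 M N) X = conj2 N (conj2 M X).
Proof. by rewrite /conj2 adj2M !mul2A. Qed.

Lemma conj2N M X : conj2 (neg2 M) X = conj2 M X.
Proof. by rewrite /conj2 adj2N mulN2 mul2N mulN2 neg2K. Qed.

Lemma conj21 X : conj2 one2 X = X.
Proof. by case: X => [[[? ?] ?] ?]; apply: m2_eq; ring. Qed.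

Lemma conj2K M : det2 M = 1 -> cancel (conj2 M) (conj2 (adj2 M)).
Proof. by move=> h X; rewrite -conj2M mul2_adj // conj21. Qed.

(** Conjugation on all matrices has kernel [{1, -1}] in SL_2, which makes PSL_2 of a finite field a
    permutation group. The quotient [K] of [M] by [N] commutes with every matrix; testing it on two
    matrix units shows that it is scalar, and its determinant is 1. *)
Lemma conj2_eq M N : det2 M = 1 -> det2 N = 1 -> conj2 M =1 conj2 N ->
  M = N \/ M = neg2 N.
Proof.
move=> hM hN h; pose K := mul2 M (adj2 N).
have hK X : mul2 X K = mul2 K X.
  have : mul2 M (mul2 (conj2 M X) (adj2 N)) = mul2 M (mul2 (conj2 N X) (adj2 N)).
    by rewrite h.
  rewrite /conj2 !mul2A mul2_adj // mul12 -[RHS]mul2A -[in RHS]mul2A mul2_adj //.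
  by rewrite mul21 -!mul2A.
have KE : M = mul2 K N by rewrite /K -mul2A mul2_adjl // mul21.
have dK : det2 K = 1 by rewrite det2M det2_adj hM hN mulr1.
move: hK KE dK; case: K => [[[a b] c] d] hK KE.
have := congr1 (fun X : m2 => X.1.1.1) (hK (0, 1, 0, 0)).
have := congr1 (fun X : m2 => X.1.2) (hK (0, 0, 1, 0)).
have := congr1 (fun X : m2 => X.1.1.1) (hK (0, 0, 1, 0)).
rewrite /= !(mul0r, mulr0, mul1r, mulr1, addr0, add0r) => b0 /esym da c0.
move: KE; rewrite -b0 c0 da mulr0 subr0 -expr2 => KE /eqP.
rewrite sqrf_eq1 => /orP[] /eqP a1; move: KE; rewrite a1; [left|right]; rewrite KE;
  case: N {h hN KE} => [[[? ?] ?] ?]; apply: m2_eq; ring.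
Qed.

End TwoByTwo.

(** * PSL_2(Q) by normalized representatives, and its non-amenability *)

Section PSL2Q.
Local Notation M2 := (m2 rat).
Implicit Types M N P : M2.

Definition pos2 M := let: (a, b, c, d) := M in (0 < a) || (a == 0) && (0 < b).
Definition nrm2 M := if pos2 M then M else neg2 M.

Lemma nrm2P M : nrm2 M = M \/ nrm2 M = neg2 M.
Proof. by rewrite /nrm2; case: ifP; [left|right]. Qed.

Lemma pos2N M : det2 M = 1 -> pos2 (neg2 M) = ~~ pos2 M.
Proof.
case: M => [[[a b] c] d] /= h; rewrite !oppr_gt0 oppr_eq0.
have [a0|a0|a0] := ltgtP a 0 => //=; rewrite ?orbF.
move: h; rewrite a0 mul0r sub0r => h; have [b0|b0|b0] := ltgtP b 0 => //.
by move: h; rewrite b0 mul0r oppr0 => /eqP; rewrite eq_sym oner_eq0.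
Qed.

Lemma pos2_nrm M : det2 M = 1 -> pos2 (nrm2 M).
Proof. by move=> h; rewrite /nrm2; case: ifPn => //; rewrite pos2N. Qed.

Lemma nrm2N M : det2 M = 1 -> nrm2 (neg2 M) = nrm2 M.
Proof. by move=> h; rewrite /nrm2 pos2N //; case: (pos2 M); rewrite /= ?neg2K. Qed.

Lemma det2_nrm M : det2 (nrm2 M) = det2 M.
Proof. by case: (nrm2P M) => ->; rewrite ?det2_neg. Qed.

Definition psl_pred : {pred M2} := fun M => (det2 M == 1) && pos2 M.

(* An element of PSL_2(Q) is the representative M of {M, -M} whose first
   non-zero entry in the first row is positive. *)
Record psl := PSL { psl_val :> M2; _ : psl_val \in psl_pred }.

HB.instance Definition _ := [isSub for psl_val].
HB.instance Definition _ := [Countable of psl by <:].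

Implicit Types x y z : psl.

Lemma psl_det x : det2 x = 1.
Proof. by case: x => M /= /andP[/eqP]. Qed.

Lemma psl_pos x : pos2 x.
Proof. by case: x => M /= /andP[]. Qed.

Lemma nrm2_psl x : nrm2 x = x.
Proof. by rewrite /nrm2 psl_pos. Qed.

Lemma psl_subproof M : det2 M = 1 -> nrm2 M \in psl_pred.
Proof. by move=> h; rewrite unfold_in /psl_pred det2_nrm h eqxx pos2_nrm. Qed.

Definition psl_of M (h : det2 M = 1) : psl := PSL (psl_subproof h).

Lemma psl_ofE M (h : det2 M = 1) : psl_val (psl_of h) = nrm2 M. Proof. by []. Qed.

Lemma psl_mul_subproof x y : det2 (mul2 x y) = 1.
Proof. by rewrite det2M !psl_det mulr1. Qed.
Lemma psl_inv_subproof x : det2 (adj2 x) = 1.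
Proof. by rewrite det2_adj psl_det. Qed.

Definition psl_one : psl := psl_of (det21 _).
Definition psl_mul x y : psl := psl_of (psl_mul_subproof x y).
Definition psl_inv x : psl := psl_of (psl_inv_subproof x).

Lemma nrm2_mull M N : det2 M = 1 -> det2 N = 1 ->
  nrm2 (mul2 (nrm2 M) N) = nrm2 (mul2 M N).
Proof.
by move=> hM hN; case: (nrm2P M) => ->; rewrite ?mulN2 ?nrm2N // det2M hM hN mulr1.
Qed.

Lemma nrm2_mulr M N : det2 M = 1 -> det2 N = 1 ->
  nrm2 (mul2 M (nrm2 N)) = nrm2 (mul2 M N).
Proof.
by move=> hM hN; case: (nrm2P N) => ->; rewrite ?mul2N ?nrm2N // det2M hM hN mulr1.
Qed.

Lemma nrm2_adj M : det2 M = 1 -> nrm2 (adj2 (nrm2 M)) = nrm2 (adj2 M).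
Proof.
by move=> hM; case: (nrm2P M) => ->; rewrite ?adj2N ?nrm2N // det2_adj.
Qed.

Lemma psl_mulA : associative psl_mul.
Proof.
move=> x y z; apply: val_inj => /=.
by rewrite nrm2_mulr ?nrm2_mull ?psl_mul_subproof ?psl_det // mul2A.
Qed.

Lemma psl_mul1g : left_id psl_one psl_mul.
Proof.
move=> x; apply: val_inj; rewrite -[LHS]/(nrm2 (mul2 (nrm2 (one2 _)) x)).
by rewrite nrm2_mull ?det21 ?psl_det // mul12 nrm2_psl.
Qed.

Lemma psl_mulg1 : right_id psl_one psl_mul.
Proof.
by move=> x; apply: val_inj; rewrite /= nrm2_mulr ?det21 ?psl_det // mul21 nrm2_psl.
Qed.

Lemma psl_mulVg : left_inverse psl_one psl_inv psl_mul.
Proof.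
move=> x; apply: val_inj => /=.
by rewrite nrm2_mull ?psl_inv_subproof ?psl_det // mul2_adjl ?psl_det.
Qed.

Lemma psl_mulgV : right_inverse psl_one psl_inv psl_mul.
Proof.
move=> x; apply: val_inj => /=.
by rewrite nrm2_mulr ?psl_inv_subproof ?psl_det // mul2_adj ?psl_det.
Qed.

HB.instance Definition _ := isGroup.Build psl
  psl_mulA psl_mul1g psl_mulg1 psl_mulVg psl_mulgV.

Lemma psl_countable : countable [set: psl].
Proof. exact: countableP. Qed.

Lemma psl_valM x y : psl_val (x * y)%g = nrm2 (mul2 x y). Proof. by []. Qed.
Lemma psl_ofM M N (hM : det2 M = 1) (hN : det2 N = 1) (hMN : det2 (mul2 M N) = 1) :
  psl_of hMN = (psl_of hM * psl_of hN)%g.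
Proof.
by apply: val_inj; rewrite /= nrm2_mull ?det2_nrm // nrm2_mulr.
Qed.

Lemma psl_ofV M (hM : det2 M = 1) (hV : det2 (adj2 M) = 1) :
  psl_of hV = ((psl_of hM)^-1)%g.
Proof. by apply: val_inj; rewrite /= nrm2_adj. Qed.

Lemma psl_of_val x : psl_of (psl_det x) = x.
Proof. by apply: val_inj; rewrite /= nrm2_psl. Qed.

(** Left multiplication by a shear acts on the first column [(a, c)]. The cones [V] and [U] compare
    absolute values in that column, so the choice of sign of a representative does not affect
    them. *)
Lemma psl_not_amenable (R : realType) : ~ amenable R psl.
Proof.
pose V (x : psl) := let: (a, _, c, _) := psl_val x in `|a| <= `|c| /\ c != 0.
pose U (x : psl) := let: (a, _, c, _) := psl_val x in `|c| <= `|a| /\ a != 0.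
have du (t : rat) : det2 (1, t, 0, 1) = 1 by rewrite /=; ring.
have dl (t : rat) : det2 (1, 0, t, 1) = 1 by rewrite /=; ring.
have VE (t : rat) x : V (psl_of (du t) * x)%g ->
    let: (a, _, c, _) := psl_val x in `|a + t * c| <= `|c|.
  rewrite /V psl_valM psl_ofE nrm2_mull ?psl_det //.
  case: (nrm2P (mul2 (1, t, 0, 1) x)) => ->; case: (psl_val x) => [[[a b] c] d] /=;
    rewrite ?normrN !(mul1r, mul0r, add0r); by case.
have UE (t : rat) x : U (psl_of (dl t) * x)%g ->
    let: (a, _, c, _) := psl_val x in `|t * a + c| <= `|a|.
  rewrite /U psl_valM psl_ofE nrm2_mull ?psl_det //.
  case: (nrm2P (mul2 (1, 0, t, 1) x)) => ->; case: (psl_val x) => [[[a b] c] d] /=;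
    rewrite ?normrN !(mul1r, mul0r, addr0); by case.
apply: (@amenable_no_three_translates R psl V U (psl_of (du 3)) (psl_of (dl 3))).
- move=> x; rewrite /V /U; have := psl_det x; case: (psl_val x) => [[[a b] c] d] /= h.
  have [ac|ca] := leP `|a| `|c|; [left|right]; split=> //.
    apply/eqP => c0; move: ac h; rewrite c0 normr0 normr_le0 => /eqP ->.
    by rewrite mul0r mulr0 subrr => /eqP; rewrite eq_sym oner_eq0.
  exact: ltW.
  by rewrite -normr_gt0 (le_lt_trans _ ca).
- move=> x Vx; split=> [/VE|].
    move: Vx; rewrite /V; case: (psl_val x) => [[[a b] c] d] [ac c0].
    exact: norm_shift_gt.
  have -> : (psl_of (du 3) * (psl_of (du 3) * x))%g = (psl_of (du (3 + 3)) * x)%g.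
    have h : det2 (mul2 (1, 3, 0, 1) (1, 3, 0, 1) : M2) = 1 by rewrite det2M !du mulr1.
    rewrite mulgA -(psl_ofM (du 3) (du 3) h); congr (_ * _)%g.
    by apply: val_inj => /=; congr nrm2; apply: m2_eq; ring.
  move=> /VE; move: Vx; rewrite /V; case: (psl_val x) => [[[a b] c] d] [ac c0].
  by apply: norm_shift_gt => //; lra.
- move=> x Ux; split=> [/UE|].
    move: Ux; rewrite /U; case: (psl_val x) => [[[a b] c] d] [ca a0].
    by rewrite addrC; exact: norm_shift_gt.
  have -> : (psl_of (dl 3) * (psl_of (dl 3) * x))%g = (psl_of (dl (3 + 3)) * x)%g.
    have h : det2 (mul2 (1, 0, 3, 1) (1, 0, 3, 1) : M2) = 1 by rewrite det2M !dl mulr1.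
    rewrite mulgA -(psl_ofM (dl 3) (dl 3) h); congr (_ * _)%g.
    by apply: val_inj => /=; congr nrm2; apply: m2_eq; ring.
  move=> /UE; move: Ux; rewrite /U; case: (psl_val x) => [[[a b] c] d] [ca a0].
  by rewrite addrC; apply: norm_shift_gt => //; lra.
Qed.

(** * Simplicity of PSL_2(Q) *)

Section Simplicity.
Variable S : set psl.
Hypothesis nS : normal_subgroup S.

Definition in2 M := exists h : det2 M = 1, S (psl_of h).

Lemma in2_mul M N : in2 M -> in2 N -> in2 (mul2 M N).
Proof.
move=> [hM SM] [hN SN]; have h : det2 (mul2 M N) = 1 by rewrite det2M hM hN mulr1.
exists h; rewrite (psl_ofM hM hN).
have [[S1 SV] _] := nS; rewrite -[psl_of hN]invgK; apply: (SV) => //.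
by rewrite -[(_^-1)%g]mul1g; apply: (SV).
Qed.

Lemma in2_adj M : in2 M -> in2 (adj2 M).
Proof.
move=> [hM SM]; have h : det2 (adj2 M) = 1 by rewrite det2_adj.
exists h; rewrite (psl_ofV hM) -[(_^-1)%g]mul1g.
by have [[S1 SV] _] := nS; apply: SV.
Qed.

Lemma in2_conj P M : det2 P = 1 -> in2 M -> in2 (conj2 P M).
Proof.
move=> hP [hM SM]; have hV : det2 (adj2 P) = 1 by rewrite det2_adj.
have h1 : det2 (mul2 (adj2 P) M) = 1 by rewrite det2M hV hM mulr1.
have h : det2 (conj2 P M) = 1 by rewrite det2M h1 hP mulr1.
exists h; rewrite (psl_ofM h1 hP) (psl_ofM hV hM) (psl_ofV hP) -mulgA.
by have [_] := nS; apply.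
Qed.

Lemma in2_comm P M : det2 P = 1 -> in2 M -> in2 (mul2 (adj2 M) (conj2 P M)).
Proof. by move=> hP hM; apply: in2_mul; [exact: in2_adj | exact: in2_conj]. Qed.

Hypothesis S_nontrivial : exists M, [/\ in2 M, M <> one2 _ & M <> neg2 (one2 _)].

(** If [v = (x, y)] is not an eigenvector of the matrix [M], then [D], the determinant of
    [(v, M v)], is non-zero, and the basis [(v, M v / D)] brings [M] to companion form. If (1, 0),
    (0, 1) and (1, 1) are all eigenvectors, then [M] is scalar, hence 1 or -1. *)
Lemma in2_antidiagonal : exists s t : rat, s != 0 /\ in2 (0, - s, s^-1, t).
Proof.
have [[[[a b] c] d] [[h Sh] M_1 M_N1]] := S_nontrivial.
have key (x y : rat) : let D := x * (c * x + d * y) - y * (a * x + b * y) in D != 0 ->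
    exists s t : rat, s != 0 /\ in2 (0, - s, s^-1, t).
  move=> D D0; pose P : M2 := (x, (a * x + b * y) / D, y, (c * x + d * y) / D).
  have hP : det2 P = 1 by rewrite /= /D; field; exact: D0.
  have := in2_conj hP (ex_intro _ h Sh).
  have h' : a * d - b * c = 1 by [].
  have -> : conj2 P (a, b, c, d) = (0, - D^-1, (D^-1)^-1, a + d).
    have aE : b * c = a * d - 1 by rewrite -h'; ring.
    apply: m2_eq; rewrite /= ?invrK.
    - by rewrite /D; field; exact: D0.
    - transitivity (- (a * d - b * c) / D); last by rewrite h' mulN1r.
      by rewrite /D; field; exact: D0.
    - by rewrite /D; ring.
    - by rewrite /D; field; exact: D0.
  by exists D^-1, (a + d); rewrite invr_eq0.
have [c0|c0] := eqVneq c 0; last first.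
  by apply: (key 1 0); rewrite !(mulr0, mulr1, addr0) mul1r mul0r subr0.
have [b0|b0] := eqVneq b 0; last first.
  by apply: (key 0 1); rewrite !(mulr0, mulr1, add0r) mul1r mul0r sub0r oppr_eq0.
have [da|da] := eqVneq d a; last first.
  apply: (key 1 1); rewrite !(mulr1, mul1r) c0 b0 add0r addr0 subr_eq0 //.
have : a * d - b * c = 1 := h.
rewrite b0 c0 da mulr0 subr0 -expr2 => /eqP; rewrite sqrf_eq1.
case/orP => /eqP a1; [case: M_1|case: M_N1]; rewrite b0 c0 da a1 //.
Qed.

(** The commutator with diag(1/2, 2) is lower triangular with diagonal 1/4, 4. Conjugation by it
    multiplies the entry of a lower unipotent by 16, so the commutator with the unipotent of entry
    [- x / 15] has entry [(1 - 16) * (- x / 15) = x]. *)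
Lemma in2_lower (x : rat) : in2 (1, 0, x, 1).
Proof.
have [s [t [s0 h]]] := in2_antidiagonal.
have dD : det2 (2^-1, 0, 0, 2 : rat) = 1 by rewrite /=; field.
have := in2_comm dD (in2_adj h).
pose r := 3 * t / (4 * s).
have -> : mul2 (adj2 (adj2 (0, - s, s^-1, t)))
    (conj2 (2^-1, 0, 0, 2) (adj2 (0, - s, s^-1, t)))
   = (4^-1, 0, r, 4).
  by rewrite /r; apply: m2_eq; rewrite /=; field.
move=> hL; have dW : det2 (1, 0, - x / 15, 1) = 1 by rewrite /=; ring.
have := in2_comm dW (in2_adj hL).
have -> // : mul2 (adj2 (adj2 (4^-1, 0, r, 4)))
    (conj2 (1, 0, - x / 15, 1) (adj2 (4^-1, 0, r, 4)))
  = (1, 0, x, 1).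
by apply: m2_eq; rewrite /=; field.
Qed.

Lemma in2_upper (x : rat) : in2 (1, x, 0, 1).
Proof.
have dw : det2 (0, 1, -1, 0 : rat) = 1 by rewrite /=; ring.
have := in2_conj dw (in2_lower (- x)).
have -> // : conj2 (0, 1, -1, 0) (1, 0, - x, 1) = (1, x, 0, 1).
by apply: m2_eq; ring.
Qed.

(** A matrix with non-zero lower-left entry is a product upper-lower-upper of unipotents. Otherwise
    its upper-left entry is non-zero, and adding the first row to the second reduces to that
    case. *)
Lemma in2_all M : det2 M = 1 -> in2 M.
Proof.
have main N : det2 N = 1 -> N.1.2 != 0 -> in2 N.
  case: N => [[[a b] c] d] /= h c0.
  have -> : (a, b, c, d) =
    mul2 (mul2 (1, (a - 1) / c, 0, 1) (1, 0, c, 1)) (1, (d - 1) / c, 0, 1).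
    apply: m2_eq; rewrite /=; [by field| |by field|by field].
    have -> : b = (a * d - 1) / c by rewrite -h; field.
    by field.
  exact: in2_mul (in2_mul (in2_upper _) (in2_lower _)) (in2_upper _).
move=> h; have [c0|c0] := eqVneq M.1.2 0; last exact: main.
have -> : M = mul2 (1, 0, -1, 1) (mul2 (1, 0, 1, 1) M).
  by case: M {h c0} => [[[? ?] ?] ?]; apply: m2_eq; ring.
apply: in2_mul; first exact: in2_lower.
apply: main; first by rewrite det2M h mulr1 /=; ring.
case: M h c0 => [[[a b] c] d] /= h c0; move: h; rewrite c0 mulr0 subr0 addr0 mul1r => h.
by apply/eqP => a0; move: h; rewrite a0 mul0r => /eqP; rewrite eq_sym oner_eq0.
Qed.

End Simplicity.

Lemma psl_simple : simple_group psl.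
Proof.
split.
  have d : det2 (1, 1, 0, 1 : rat) = 1 by rewrite /=; ring.
  by exists (psl_of d) => /(congr1 val).
move=> S nS; have [S1|nS1] := pselect (S `<=` [set 1%g]); [left|right].
  by apply/seteqP; split=> // x ->; have [[]] := nS.
have [x /not_implyP[Sx x1]] := (existsNP _).2 nS1.
apply/seteqP; split=> // y _; rewrite -(psl_of_val y).
have [|h Sy] := in2_all nS _ (psl_det y); last first.
  by rewrite (_ : psl_det y = h) //; exact: eq_irrelevance.
exists (psl_val x); split.
- by exists (psl_det x); rewrite psl_of_val.
- by move=> e; apply: x1; apply: val_inj; rewrite /= e.
- by move=> e; have := psl_pos x; rewrite e.
Qed.

End PSL2Q.

(** * Reduction of rational numbers and matrices *)

Section RationalReduction.
Variable F : fieldType.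
Implicit Types x y : rat.

(** In positive characteristic [ratr] is a homomorphism only on these numbers: elsewhere it divides
    by zero and returns 0. *)
Definition integral_at x := (denq x)%:~R != 0 :> F.

(** The reduced denominator divides every other one, so [ratr] can be computed from any fraction
    whose denominator survives in [F]. *)
Lemma ratr_frac x (n d : int) : x * d%:~R = n%:~R -> d%:~R != 0 :> F ->
  integral_at x /\ ratr x = n%:~R / d%:~R :> F.
Proof.
move=> xnd d0; have E : numq x * d = n * denq x.
  apply: (@intr_inj rat); rewrite !rmorphM /= -xnd -{2}(divq_num_den x).
  by field; rewrite intr_eq0 denq_neq0.
have : (denq x %| d)%Z.
  have cop : coprimez (denq x) (numq x).
    by rewrite /coprimez gcdzC; exact: coprime_num_den.
  by rewrite -(Gauss_dvdzr d cop) E dvdz_mull.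
move=> /dvdzP[k dk]; have q0 : integral_at x.
  by apply: contraNneq d0; rewrite dk rmorphM /= => ->; rewrite mulr0.
split=> //; rewrite /ratr; apply/eqP; rewrite eqr_div //.
by rewrite -!rmorphM /= E.
Qed.

Lemma ratrD_at x y : integral_at x -> integral_at y ->
  integral_at (x + y) /\ ratr (x + y) = ratr x + ratr y :> F.
Proof.
move=> x0 y0.
have [||gxy ->] := @ratr_frac (x + y) (numq x * denq y + numq y * denq x)
    (denq x * denq y).
- rewrite !rmorphD !rmorphM /= -{1}(divq_num_den x) -{1}(divq_num_den y).
  by field; rewrite !intr_eq0 !denq_neq0.
- by rewrite rmorphM mulf_neq0.
split=> //; rewrite /ratr !rmorphD !rmorphM /=; field.
by apply/andP; split; [exact: y0 | exact: x0].
Qed.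

Lemma ratrM_at x y : integral_at x -> integral_at y ->
  integral_at (x * y) /\ ratr (x * y) = ratr x * ratr y :> F.
Proof.
move=> x0 y0.
have [||gxy ->] := @ratr_frac (x * y) (numq x * numq y) (denq x * denq y).
- rewrite !rmorphM /= -{1}(divq_num_den x) -{1}(divq_num_den y).
  by field; rewrite !intr_eq0 !denq_neq0.
- by rewrite rmorphM mulf_neq0.
split=> //; rewrite /ratr !rmorphM /=; field.
by apply/andP; split; [exact: y0 | exact: x0].
Qed.

Lemma ratrN_at x : ratr (- x) = - ratr x :> F.
Proof. by rewrite /ratr numqN denqN rmorphN mulNr. Qed.

Lemma integral_atN x : integral_at x -> integral_at (- x).
Proof. by rewrite /integral_at denqN. Qed.

Definition integral2 (M : m2 rat) := let: (a, b, c, d) := M in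
  [/\ integral_at a, integral_at b, integral_at c & integral_at d].

Definition red2 (M : m2 rat) : m2 F :=
  let: (a, b, c, d) := M in (ratr a, ratr b, ratr c, ratr d).

Lemma red2M M N : integral2 M -> integral2 N -> red2 (mul2 M N) = mul2 (red2 M) (red2 N).
Proof.
case: M N => [[[a b] c] d] [[[a' b'] c'] d'] [ha hb hc hd] [ha' hb' hc' hd'].
have lin x y x' y' : integral_at x -> integral_at y -> integral_at x' -> integral_at y' ->
    ratr (x * y + x' * y') = ratr x * ratr y + ratr x' * ratr y' :> F.
  move=> hx hy hx' hy'; have [h1 <-] := ratrM_at hx hy; have [h2 <-] := ratrM_at hx' hy'.
  by have [_ ->] := ratrD_at h1 h2.
by apply: m2_eq; exact: lin.
Qed.

Lemma red2N M : red2 (neg2 M) = neg2 (red2 M).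
Proof. by case: M => [[[a b] c] d]; apply: m2_eq; exact: ratrN_at. Qed.

Lemma det2_red M : integral2 M -> det2 M = 1 -> det2 (red2 M) = 1.
Proof.
case: M => [[[a b] c] d] [ha hb hc hd] /= h.
have -> : 1 = ratr (a * d - b * c) :> F by rewrite h -[1 in RHS]/(1%:~R) ratr_int.
have [h1 <-] := ratrM_at ha hd; have [h2 <-] := ratrM_at hb hc.
by have [_ ->] := ratrD_at h1 (integral_atN h2); rewrite ratrN_at.
Qed.

End RationalReduction.

Definition prime_gt n : nat := s2val (prime_above n).

Lemma prime_gtP n : (n < prime_gt n)%N /\ prime (prime_gt n).
Proof. by rewrite /prime_gt; case: prime_above. Qed.

Local Notation Fn n := ('F_(prime_gt n) : fieldType).

(** A prime larger than [|z|] cannot divide a non-zero [z]. *)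
Lemma int_neq0_near (z : int) : z != 0 -> \forall n \near \oo, z%:~R != 0 :> Fn n.
Proof.
move=> z0; exists `|z|%N => // n /= zn; have [np pp] := prime_gtP n.
have : (`|z|%N)%:R != 0 :> Fn n.
  rewrite -(dvdn_pcharf (pchar_Fp pp)) gtnNdvd ?absz_gt0 //.
  exact: leq_ltn_trans zn np.
case: z {zn z0} => m /=; first by [].
by rewrite NegzE rmorphN /= oppr_eq0.
Qed.

Lemma integral_near x : \forall n \near \oo, integral_at (Fn n) x.
Proof. by apply: int_neq0_near; exact: denq_neq0. Qed.

Lemma ratr_inj_near (x y : rat) : \forall n \near \oo, ratr x = ratr y :> Fn n -> x = y.
Proof.
have [->|xy] := eqVneq x y; first exact: filterE.
have d0 : numq (x - y) != 0 by rewrite numq_eq0 subr_eq0.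
have := int_neq0_near d0; apply: filterS3 (integral_near x) (integral_near y) => n.
move=> hx hy h e; exfalso.
have := hx; have [gd] := ratrD_at hx (integral_atN hy).
rewrite ratrN_at e subrr => /eqP; rewrite /ratr mulf_eq0 (negPf h) /= invr_eq0.
by rewrite (negPf gd).
Qed.

Lemma integral2_near (M : m2 rat) : \forall n \near \oo, integral2 (Fn n) M.
Proof.
case: M => [[[a b] c] d]; near=> n.
by split; near: n; exact: integral_near.
Unshelve. all: by end_near. Qed.

Lemma red2_inj_near (M N : m2 rat) : \forall n \near \oo,
  red2 (Fn n) M = red2 (Fn n) N -> M = N.
Proof.
case: M N => [[[a b] c] d] [[[a' b'] c'] d']; near=> n => h.
have ha : ratr a = ratr a' :> Fn n := congr1 (fun X : m2 (Fn n) => X.1.1.1) h.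
have hb : ratr b = ratr b' :> Fn n := congr1 (fun X : m2 (Fn n) => X.1.1.2) h.
have hc : ratr c = ratr c' :> Fn n := congr1 (fun X : m2 (Fn n) => X.1.2) h.
have hd : ratr d = ratr d' :> Fn n := congr1 (fun X : m2 (Fn n) => X.2) h.
by apply: m2_eq; [move: ha|move: hb|move: hc|move: hd]; near: n; exact: ratr_inj_near.
Unshelve. all: by end_near. Qed.

(** * Permutation approximations of PSL_2(Q) *)

Section ConjugationPermutation.
Variable p : nat.
Local Notation X := ('F_p * 'F_p * 'F_p * 'F_p)%type.

(** For the reductions of a fixed matrix of determinant 1, the default [1] occurs at only finitely
    many indices. *)
Definition conj2_perm (M : m2 'F_p) : {perm X} :=
  if det2 M =P 1 is ReflectT h then perm (can_inj (conj2K h)) else 1%g.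

Lemma conj2_permE M (Y : X) : det2 M = 1 -> conj2_perm M Y = conj2 M Y.
Proof. by rewrite /conj2_perm; case: eqP => // h _; rewrite permE. Qed.

End ConjugationPermutation.

Lemma exists_ultrafilter : exists w : set_system nat, UltraFilter w /\
  forall A : set nat, (\forall n \near \oo, A n) -> w A.
Proof. by have [w [wU oow]] := @ultraFilterLemma nat \oo _; exists w. Qed.

Definition nat_ultra : set_system nat := sval (cid exists_ultrafilter).

#[global] Instance nat_ultra_ultrafilter : UltraFilter nat_ultra.
Proof. by rewrite /nat_ultra; case: cid => w []. Qed.

Lemma near_ultra (A : set nat) : (\forall n \near \oo, A n) -> nat_ultra A.
Proof. by rewrite /nat_ultra; case: cid => w [] /= _; exact. Qed.

Lemma psl_hyperlinear (R : realType) : hyperlinear R psl.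
Proof.
apply: (@hyperlinear_of_perms R psl
  (fun n => ('F_(prime_gt n) * 'F_(prime_gt n) * 'F_(prime_gt n) * 'F_(prime_gt n))%type)
  nat_ultra (fun n x => conj2_perm (red2 _ (psl_val x))) _ psl_countable) => x y.
  apply: near_ultra; near=> n => /=.
  have ix : integral2 (Fn n) x by near: n; exact: integral2_near.
  have iy : integral2 (Fn n) y by near: n; exact: integral2_near.
  have dx := det2_red ix (psl_det x); have dy := det2_red iy (psl_det y).
  have dxy : det2 (mul2 (red2 (Fn n) x) (red2 _ y)) = 1 by rewrite det2M dx dy mulr1.
  apply/permP => Y; rewrite permM.
  have xyE : red2 (Fn n) (nrm2 (mul2 x y)) = mul2 (red2 _ x) (red2 _ y) \/
      red2 (Fn n) (nrm2 (mul2 x y)) = neg2 (mul2 (red2 _ x) (red2 _ y)).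
    by case: (nrm2P (mul2 x y)) => ->; rewrite ?red2N red2M //; [left|right].
  rewrite !conj2_permE //; last by case: xyE => ->; rewrite ?det2_neg.
  by case: xyE => ->; rewrite ?conj2N conj2M.
move=> xy; apply: near_ultra; near=> n => /= e; apply: xy.
have ix : integral2 (Fn n) x by near: n; exact: integral2_near.
have iy : integral2 (Fn n) y by near: n; exact: integral2_near.
have dx := det2_red ix (psl_det x); have dy := det2_red iy (psl_det y).
have cE : conj2 (red2 (Fn n) x) =1 conj2 (red2 (Fn n) y).
  by move=> Y; rewrite -!(@conj2_permE (prime_gt n)) // e.
apply: val_inj => /=; case: (conj2_eq dx dy cE).
  by near: n; exact: red2_inj_near.
(* The sign ambiguity left by conjugation disappears over the rationals: the negative of a
   normalized representative is not normalized. *)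
rewrite -red2N => h; have xNy : psl_val x = neg2 y.
  by move: h; near: n; exact: red2_inj_near.
by have := psl_pos x; rewrite xNy pos2N ?psl_det // psl_pos.
Unshelve. all: by end_near. Qed.

(** * A finitely generated group of permutations of Z^2 *)

Section Words.
Variable K : comNzRingType.
Implicit Types (p q : K * K) (l : option bool * bool) (u v : seq (option bool * bool)).

(* The flag marks the inverse of a generator: [Some true] and [Some false] are
   the two elementary maps, [None] is the transposition of (1, 0) and (1, 3). *)
Definition letter := (option bool * bool)%type.

(** The coefficient 3 serves [norm_shift_gt]. The point (1, 3) is the image of (1, 0) under the
    second shear, so the transposition exchanges neighbours in the orbit. *)
Definition step (p : K * K) (l : letter) : K * K :=
  match l with
  | (Some true, s) => (p.1 + (-1) ^+ s * 3 * p.2, p.2)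
  | (Some false, s) => (p.1, p.2 + (-1) ^+ s * 3 * p.1)
  | (None, _) => if p == (1, 0) then (1, 3) else if p == (1, 3) then (1, 0) else p
  end.

Definition run (u : seq letter) p := foldl step p u.

Definition flip_letter (l : letter) : letter := (l.1, ~~ l.2).
Definition word_inv (u : seq letter) : seq letter := rev (map flip_letter u).

Lemma stepK l p : step (step p l) (flip_letter l) = p.
Proof.
case: l p => [[[]|] s] [x y] /=.
- by rewrite -addrA -mulrDl -mulrDl signrN addrN !mul0r addr0.
- by rewrite -addrA -mulrDl -mulrDl signrN addrN !mul0r addr0.
have [->|h1] := eqVneq (x, y) (1, 0).
  by rewrite eqxx; case: eqP.
by have [->|h2] := eqVneq (x, y) (1, 3); rewrite ?eqxx // (negPf h1) (negPf h2).
Qed.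

Lemma run_cat u v p : run (u ++ v) p = run v (run u p).
Proof. exact: foldl_cat. Qed.

Lemma run_invK u p : run (word_inv u) (run u p) = p.
Proof.
elim: u p => [|l u IH] p //=.
by rewrite /word_inv /= rev_cons -cats1 run_cat IH; exact: stepK.
Qed.

Lemma flip_letterK : involutive flip_letter.
Proof. by case=> l s; rewrite /flip_letter /= negbK. Qed.

Lemma word_invK : involutive word_inv.
Proof.
move=> u; rewrite /word_inv map_rev revK -map_comp -[RHS]map_id.
by apply: eq_map => l /=; rewrite flip_letterK.
Qed.

Lemma run_Kinv u p : run u (run (word_inv u) p) = p.
Proof. by rewrite -{1}(word_invK u) run_invK. Qed.

Lemma run_inj u : injective (run u).
Proof. exact: can_inj (run_invK u). Qed.

Lemma step_eq0 l p : (3 : K) != 0 -> step p l = (0, 0) -> p = (0, 0).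
Proof.
move=> k3; case: l p => [[[]|] s] [x y] /=.
- by case=> + y0; rewrite y0 mulr0 addr0 => ->.
- by case=> x0; rewrite x0 mulr0 addr0 => ->.
case: eqP => [_ [/eqP]|_]; first by rewrite oner_eq0.
by case: eqP => [_ [/eqP]|//]; rewrite oner_eq0.
Qed.

End Words.

Local Notation Z2 := (int * int)%type.
Local Notation Kn n := ('F_(prime_gt n)).
Local Notation Xn n := (Kn n * Kn n)%type.

Definition proj2 n (p : Z2) : Xn n := (p.1%:~R, p.2%:~R).

Lemma proj2_inj_near (p q : Z2) : \forall n \near \oo, proj2 n p = proj2 n q -> p = q.
Proof.
have aux (x y : int) : \forall n \near \oo, x%:~R = y%:~R :> Kn n -> x = y.
  have [->|xy] := eqVneq x y; first exact: filterE.
  have : x - y != 0 by rewrite subr_eq0.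
  move=> /int_neq0_near; apply: filterS => n + e.
  by rewrite rmorphB /= e subrr eqxx.
case: p q => [x y] [x' y']; near=> n => h.
have hx : x%:~R = x'%:~R :> Kn n := congr1 fst h.
have hy : y%:~R = y'%:~R :> Kn n := congr1 snd h.
by congr (_, _); [move: hx|move: hy]; near: n; exact: aux.
Unshelve. all: by end_near. Qed.

(** Shears commute with reduction at every index; the transposition does so once reduction no longer
    confuses [p] with one of its two points. *)
Lemma proj2_step_near (p : Z2) l : \forall n \near \oo,
  proj2 n (step p l) = step (proj2 n p) l.
Proof.
case: l => [[[]|] s].
- apply: filterE => n; case: p => x y; congr (_, _).
  by rewrite /= rmorphD !rmorphM /= rmorphXn /= rmorphN1.
- apply: filterE => n; case: p => x y; congr (_, _).
  by rewrite /= rmorphD !rmorphM /= rmorphXn /= rmorphN1.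
near=> n; rewrite /step.
have -> : (proj2 n p == (1, 0)) = (p == (1, 0)).
  apply/eqP/eqP => [|->//]; rewrite -[(1, 0)]/(proj2 n (1, 0)).
  by near: n; exact: proj2_inj_near.
have -> : (proj2 n p == (1, 3)) = (p == (1, 3)).
  apply/eqP/eqP => [|->//]; rewrite -[(1, 3)]/(proj2 n (1, 3)).
  by near: n; exact: proj2_inj_near.
by case: eqP => // _; case: eqP.
Unshelve. all: by end_near. Qed.

Lemma proj2_run_near u (p : Z2) : \forall n \near \oo,
  proj2 n (run u p) = run u (proj2 n p).
Proof.
elim: u p => [|l u IH] p; first exact: filterE.
near=> n => /=.
have <- : proj2 n (step p l) = step (proj2 n p) l by near: n; exact: proj2_step_near.
by near: n; exact: IH.
Unshelve. all: by end_near. Qed.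

(** * The group of words modulo the ultrafilter *)

Definition word_eq u v := nat_ultra [set n | run (K := Kn n) u =1 run v].

Lemma word_eq_refl u : word_eq u u.
Proof. by apply: filterE => n p. Qed.

Lemma word_eq_sym u v : word_eq u v -> word_eq v u.
Proof. by apply: filterS => n + p => /(_ p). Qed.

Lemma word_eq_trans u v t : word_eq u v -> word_eq v t -> word_eq u t.
Proof. by apply: filterS2 => n h1 h2 p; rewrite h1 h2. Qed.

Lemma word_eq_cat u v u' v' : word_eq u u' -> word_eq v v' -> word_eq (u ++ v) (u' ++ v').
Proof. by apply: filterS2 => n h1 h2 p; rewrite !run_cat h1 h2. Qed.

Lemma word_eq_inv u v : word_eq u v -> word_eq (word_inv u) (word_inv v).
Proof.
apply: filterS => n h p; apply: (@run_inj _ v).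
by rewrite run_Kinv -h run_Kinv.
Qed.

Lemma word_eq_mulV u : word_eq (u ++ word_inv u) [::].
Proof. by apply: filterE => n p; rewrite run_cat run_invK. Qed.

Lemma word_eq_Vmul u : word_eq (word_inv u ++ u) [::].
Proof. by apply: filterE => n p; rewrite run_cat run_Kinv. Qed.

(** This makes the word group act on Z^2, although the relation only sees finite planes: two integer
    points whose reductions agree at almost all indices are equal. *)
Lemma word_eq_run u v (p : Z2) : word_eq u v -> run u p = run v p.
Proof.
move=> uv; have := near_ultra (proj2_run_near u p); have := near_ultra (proj2_run_near v p).
move=> hv hu; have inj := near_ultra (proj2_inj_near (run u p) (run v p)).
have : nat_ultra (fun n => proj2 n (run u p) = proj2 n (run v p)).
  by apply: filterS3 hu hv uv => n -> -> ->.
move=> h; have : nat_ultra (fun=> run u p = run v p) by apply: filterS2 inj h => n; exact.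
by move=> /filter_ex[].
Qed.

(** [choose] depends only on the class of [u], so the quotient is realized as a subtype of words and
    inherits countability. *)
Definition canon u : seq letter := choose (fun v => `[< word_eq u v >]) u.

Lemma canonP u : word_eq u (canon u).
Proof.
by apply/asboolP/(@chooseP _ (fun v => `[< word_eq u v >]))/asboolP/word_eq_refl.
Qed.

Lemma canon_eq u v : word_eq u v -> canon u = canon v.
Proof.
move=> uv; rewrite /canon (@eq_choose _ _ (fun t => `[< word_eq v t >])).
  by apply: choose_id; apply/asboolP; [exact: word_eq_sym | exact: word_eq_refl].
move=> t; apply/asbool_equiv_eq; split; first exact: word_eq_trans (word_eq_sym uv).
exact: word_eq_trans uv.
Qed.

(* Words up to equality in the ultraproduct of the finite symmetric groups. *)
Record wgroup := WGroup { wval :> seq letter; _ : canon wval == wval }.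

HB.instance Definition _ := [isSub for wval].
HB.instance Definition _ := [Countable of wgroup by <:].

Implicit Types g h k : wgroup.

Lemma canon_subproof u : canon (canon u) == canon u.
Proof. by apply/eqP/esym/canon_eq/canonP. Qed.

Definition wof u : wgroup := WGroup (canon_subproof u).

Lemma wofP u : word_eq u (wof u). Proof. exact: canonP. Qed.

Lemma wof_eq u v : word_eq u v -> wof u = wof v.
Proof. by move=> uv; apply: val_inj; exact: canon_eq. Qed.

Lemma wvalK g : wof g = g.
Proof. by apply: val_inj; apply/eqP; case: g. Qed.

Lemma wgroup_eq g h : word_eq g h -> g = h.
Proof. by move=> /wof_eq; rewrite !wvalK. Qed.

Definition wmul g h := wof (wval g ++ wval h).
Definition winv g := wof (word_inv g).
Definition wone := wof [::].

Lemma wofM u v : wof (u ++ v) = wmul (wof u) (wof v).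
Proof. by apply: wof_eq; apply: word_eq_cat; exact: wofP. Qed.

Lemma wofV u : wof (word_inv u) = winv (wof u).
Proof. by apply: wof_eq; apply: word_eq_inv; exact: wofP. Qed.

Lemma wmulA : associative wmul.
Proof. by move=> g h k; rewrite -(wvalK g) -(wvalK h) -(wvalK k) -!wofM catA. Qed.
Lemma wmul1g : left_id wone wmul.
Proof. by move=> g; rewrite -(wvalK g) -wofM. Qed.
Lemma wmulg1 : right_id wone wmul.
Proof. by move=> g; rewrite -(wvalK g) -wofM cats0. Qed.
Lemma wmulVg : left_inverse wone winv wmul.
Proof.
by move=> g; rewrite -(wvalK g) -wofV -wofM; apply: wof_eq; exact: word_eq_Vmul.
Qed.
Lemma wmulgV : right_inverse wone winv wmul.
Proof.
by move=> g; rewrite -(wvalK g) -wofV -wofM; apply: wof_eq; exact: word_eq_mulV.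
Qed.

HB.instance Definition _ := isGroup.Build wgroup wmulA wmul1g wmulg1 wmulVg wmulgV.

Lemma wgroup_hyperlinear (R : realType) : hyperlinear R wgroup.
Proof.
apply: (@hyperlinear_of_perms R wgroup (fun n => Xn n) nat_ultra
  (fun n g => perm (@run_inj (Kn n) (wval g)))) => [|g h|g h gh].
- exact: countableP.
- have := wofP (wval g ++ wval h); apply: filterS => n /= e.
  by apply/permP => p; rewrite permM !permE -run_cat e.
(* Maximality of the ultrafilter enters here: words that fail to agree almost everywhere differ
   almost everywhere. *)
have [//|] := in_ultra_setVsetC (F := nat_ultra)
    [set n | run (K := Kn n) (wval g) =1 run (wval h)].
  by move=> /wgroup_eq.
apply: filterS => n /= ne e; apply: ne => p.
by have := congr1 (fun s : {perm Xn n} => s p) e; rewrite /= !permE.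
Qed.

Lemma wgroup_fg : finitely_generated wgroup.
Proof.
exists [seq wof [:: l] | l : option bool * bool] => S [S1 SV] sS.
have SM x y : S x -> S y -> S (x * y)%g.
  move=> Sx Sy; rewrite -[y]invgK; apply: (SV) => //.
  by rewrite -[(_^-1)%g]mul1g; exact: SV.
apply/seteqP; split=> // g _; rewrite -(wvalK g).
elim: (wval g) => [|l u IH]; first exact: S1.
rewrite -cat1s [wof _]wofM; apply: SM => //; apply: sS => /=.
by apply/mapP; exists l => //; rewrite mem_enum.
Qed.

(** * The action on Z^2 and its transpositions *)

Definition wact (p : Z2) g : Z2 := run (wval g) p.

Lemma wact_of p u : wact p (wof u) = run u p.
Proof. exact/esym/word_eq_run/wofP. Qed.

Lemma wactM p g h : wact p (g * h)%g = wact (wact p g) h.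
Proof. by rewrite [LHS]wact_of run_cat. Qed.

Lemma wact1 p : wact p 1%g = p.
Proof. exact: wact_of. Qed.

Lemma wactK g p : wact (wact p g) g^-1%g = p.
Proof. by rewrite -wactM mulgV wact1. Qed.

Lemma wactVK g p : wact (wact p g^-1%g) g = p.
Proof. by rewrite -wactM mulVg wact1. Qed.

Lemma wact_inj g : injective (wact^~ g).
Proof. exact: can_inj (wactK g). Qed.

(** The condition concerns the finite planes, where words are compared, so that it determines the
    group element; its effect on Z^2 is derived in [transposes_run]. *)
Definition transposes (x y : Z2) (u : seq letter) := \forall n \near nat_ultra,
  forall p : Xn n, run u p = tperm (proj2 n x) (proj2 n y) p.

Lemma transposes_sym x y u : transposes x y u -> transposes y x u.
Proof. by apply: filterS => n h p; rewrite h tpermC. Qed.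

Lemma transposes_uniq x y u v : transposes x y u -> transposes x y v -> word_eq u v.
Proof. by apply: filterS2 => n hu hv p; rewrite hu hv. Qed.

Lemma transposes_conj x y u v : transposes x y u ->
  transposes (run v x) (run v y) (word_inv v ++ u ++ v).
Proof.
move=> h; have hx := near_ultra (proj2_run_near v x).
have hy := near_ultra (proj2_run_near v y).
apply: filterS3 h hx hy => n h hx hy p; rewrite !run_cat h hx hy.
pose s := perm (@run_inj (Kn n) v); have sE q : run v q = s q by rewrite permE.
by rewrite -[in RHS](run_Kinv v p) !sE inj_tperm //; exact: perm_inj.
Qed.

Lemma transposes_nil x : transposes x x [::].
Proof. by apply: filterE => n p; rewrite tperm1 perm1. Qed.

Lemma transposes_letter : transposes (1, 0) (1, 3) [:: (None, false)].
Proof.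
apply: filterE => n [x y]; rewrite -[proj2 n (1, 0)]/(1, 0) -[proj2 n (1, 3)]/(1, 3).
rewrite [LHS]/=; case: tpermP => [->|->|/eqP/negPf -> /eqP/negPf ->//].
  by rewrite eqxx.
by rewrite eqxx; case: eqP.
Qed.

Lemma transposes_run x y u (p : Z2) : transposes x y u ->
  run u p = if p == x then y else if p == y then x else p.
Proof.
move=> h; have hp := near_ultra (proj2_run_near u p).
have inj q : nat_ultra (fun n => proj2 n (run u p) = proj2 n q -> run u p = q).
  exact: near_ultra (proj2_inj_near (run u p) q).
have ex q : nat_ultra (fun n => proj2 n (run u p) = proj2 n q) -> run u p = q.
  move=> hq; have : nat_ultra (fun=> run u p = q).
    by apply: filterS2 (inj q) hq => n; exact.
  by move=> /filter_ex[].
have [px|px] := eqVneq p x.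
  by apply: ex; apply: filterS2 h hp => n h ->; rewrite h px tpermL.
have [py|py] := eqVneq p y.
  by apply: ex; apply: filterS2 h hp => n h ->; rewrite h py tpermR.
apply: ex; have ix := near_ultra (proj2_inj_near p x).
have iy := near_ultra (proj2_inj_near p y).
have ixy : nat_ultra (fun n => (proj2 n p = proj2 n x -> p = x) /\
    (proj2 n p = proj2 n y -> p = y)) by exact: filterI.
move: ixy; apply: filterS3 h hp => n h -> [kx ky]; rewrite h tpermD //.
  by apply: contraNneq px => /esym/kx ->.
by apply: contraNneq py => /esym/ky ->.
Qed.

Definition joined x y := exists u, transposes x y u.

Lemma joined_sym x y : joined x y -> joined y x.
Proof. by move=> [u /transposes_sym]; exists u. Qed.

Lemma joined_run v x y : joined x y -> joined (run v x) (run v y).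
Proof. by move=> [u /(transposes_conj v)]; exists (word_inv v ++ u ++ v). Qed.

(** For distinct points, conjugating (y z) by (x y) gives (x z). *)
Lemma joined_trans x y z : joined x y -> joined y z -> joined x z.
Proof.
have [-> //|yz] := eqVneq y z; have [-> //|xy] := eqVneq x y.
have [-> _ _|xz] := eqVneq x z; first by exists [::]; exact: transposes_nil.
move=> [u xyu] /(joined_run u).
by rewrite !(transposes_run _ xyu) eqxx eq_sym (negPf xy) [z == _]eq_sym (negPf xz)
  [z == _]eq_sym (negPf yz).
Qed.

Definition base : Z2 := (1, 0).

(** The first shear fixes [base] and the second sends it to (1, 3), its partner in the
    transposition. The inverse of the second shear carries the pair (1, 0), (1, 3) to (1, -3), (1,
    0). Translating such neighbour relations along words links the whole orbit. *)
Lemma joined_step l : joined base (step base l).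
Proof.
have j13 : joined (1, 0) (1, 3) by exists [:: (None, false)]; exact: transposes_letter.
have nil : joined base base by exists [::]; exact: transposes_nil.
case: l => [[[]|] s]; [|case: s|].
- by rewrite /= mulr0 addr0.
- have := joined_run [:: (Some false, true)] j13; rewrite /= => /joined_sym.
  by congr (joined _ _).
- by have := j13; congr (joined _ _).
- exact: j13.
Qed.

Lemma joined_orbit u : joined base (run u base).
Proof.
elim: u => [|l u IH]; first by exists [::]; exact: transposes_nil.
exact: joined_trans IH (joined_run u (joined_step l)).
Qed.

Definition orbit (p : Z2) := exists g, p = wact base g.

Lemma orbit_act p g : orbit p -> orbit (wact p g).
Proof. by move=> [h ->]; exists (h * g)%g; rewrite wactM. Qed.

Lemma orbit_joined p q : orbit p -> orbit q -> joined p q.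
Proof.
move=> [g ->] [h ->]; apply: joined_trans (joined_orbit (wval h)).
exact/joined_sym/joined_orbit.
Qed.

(** The origin is the one point outside both cones of the measure argument, so the orbit must avoid
    it. *)
Lemma run_neq0 u p : p != (0, 0) -> run u p != (0, 0) :> Z2.
Proof.
elim: u p => [|l u IH] p p0 //=; apply: IH.
by apply: contraNneq p0 => /step_eq0 ->.
Qed.

Definition is_tr (p q : Z2) g := transposes p q (wval g).

Lemma is_tr_exists p q : orbit p -> orbit q -> exists g, is_tr p q g.
Proof.
move=> op oq; have [u tu] := orbit_joined op oq; exists (wof u).
by apply: filterS2 tu (wofP u) => n h e x; rewrite -e h.
Qed.

Lemma is_tr_uniq p q g h : is_tr p q g -> is_tr p q h -> g = h.
Proof. by move=> tg th; apply: wgroup_eq; exact: transposes_uniq tg th. Qed.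

Lemma is_tr_conj p q g h : is_tr p q g -> is_tr (wact p h) (wact q h) (g ^ h)%g.
Proof.
move=> /(transposes_conj (wval h)); rewrite -!/(wact _ h) => t.
have -> : (g ^ h)%g = wof (word_inv h ++ g ++ h) by rewrite !wofM wofV !wvalK.
by apply: filterS2 t (wofP (word_inv h ++ g ++ h)) => n e1 e2 x; rewrite -e2 e1.
Qed.

Lemma is_tr_act p q g x : is_tr p q g ->
  wact x g = if x == p then q else if x == q then p else x.
Proof. exact: transposes_run. Qed.

Lemma is_tr_sq p q g : is_tr p q g -> (g * g = 1)%g.
Proof.
move=> t; apply: wgroup_eq; apply: word_eq_trans (word_eq_sym (wofP _)) _.
apply: word_eq_trans (wofP [::]).
by apply: filterS t => n h x; rewrite run_cat !h tpermK.
Qed.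

Lemma orbit_base : orbit base.
Proof. by exists 1%g; rewrite wact1. Qed.

Lemma orbit_avoid (s : seq Z2) : exists2 z, orbit z & z \notin s.
Proof.
pose f (k : nat) : Z2 := (1, (3 * k)%:Z).
have fO (k : nat) : orbit (f k).
  elim: k => [|k [g fk]]; first exact: orbit_base.
  exists (g * wof [:: (Some false, false)])%g; rewrite wactM -fk wact_of /f /=.
  by congr (_, _); rewrite expr0 mul1r mulr1 mulnS addrC.
have fI : injective f by move=> k l [] /eqP; rewrite eqn_pmul2l // => /eqP.
apply/not_exists2P => h.
have : (size (map f (iota 0 (size s).+1)) <= size s)%N.
  apply: uniq_leq_size; first by rewrite map_inj_uniq // iota_uniq.
  by move=> _ /mapP[k _ ->]; have [/(_ (fO k))|/negP/negPn //] := h (f k).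
by rewrite size_map size_iota ltnn.
Qed.

(** Three successive transpositions place the points one at a time; each fixes the targets already
    reached. *)
Lemma orbit_3transitive x z w a b d : orbit x -> orbit z -> orbit w ->
  orbit a -> orbit b -> orbit d -> uniq [:: x; z; w] -> uniq [:: a; b; d] ->
  exists k, [/\ wact x k = a, wact z k = b & wact w k = d].
Proof.
move=> ox oz ow oa ob od /and3P[]; rewrite !inE negb_or => /andP[xz xw] zw _.
move=> /and3P[]; rewrite !inE negb_or => /andP[ab ad] bd _.
have [k1 t1] := is_tr_exists ox oa.
have E1 : wact x k1 = a by rewrite (is_tr_act _ t1) eqxx.
have z1a : a != wact z k1 by rewrite -E1 (inj_eq (@wact_inj k1)).
have w1a : a != wact w k1 by rewrite -E1 (inj_eq (@wact_inj k1)).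
have [k2 t2] := is_tr_exists (orbit_act k1 oz) ob.
have E2 : wact (wact z k1) k2 = b by rewrite (is_tr_act _ t2) eqxx.
have a2 : wact a k2 = a by rewrite (is_tr_act _ t2) (negPf z1a) (negPf ab).
have w2a : a != wact (wact w k1) k2 by rewrite -a2 (inj_eq (@wact_inj k2)).
have w2b : b != wact (wact w k1) k2.
  by rewrite -E2 (inj_eq (@wact_inj k2)) (inj_eq (@wact_inj k1)).
have [k3 t3] := is_tr_exists (orbit_act k2 (orbit_act k1 ow)) od.
exists (k1 * k2 * k3)%g; rewrite !wactM E1 E2 a2.
by rewrite !(is_tr_act _ t3) eqxx (negPf w2a) (negPf w2b) (negPf ad) (negPf bd).
Qed.

(** * Quotients of the word group *)

Section AmenableQuotient.
Variables (Q : groupType) (f : {multiplicative wgroup -> Q}).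

Let f1 : f 1%g = 1%g.
Proof. by apply: (mulgI (f 1%g)); rewrite -gmulfM !mulg1. Qed.
Let fJ g h : f (g ^ h)%g = (f g ^ f h)%g.
Proof.
have fV : f h^-1%g = (f h)^-1%g.
  by apply: (mulgI (f h)); rewrite -gmulfM !mulgV f1.
by rewrite !conjgE !gmulfM fV.
Qed.

(* A normal subgroup moving a point x to y identifies the transpositions (x z)
   and (y nz), hence, after conjugating by (x w), also (x z) and (w z): it
   contains a 3-cycle. *)
Lemma kernel_three_cycle n x : orbit x -> f n = 1%g -> wact x n != x ->
  forall a b d g h, orbit a -> orbit b -> orbit d -> uniq [:: a; b; d] ->
  is_tr a b g -> is_tr d b h -> f (g * h)%g = 1%g.
Proof.
move=> ox fn nx a b d g h oa ob od abd tg th.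
(* The point [z] may equal the image of [x]. What matters is that neither image under [n] is [x] or
   [w]: the transposition [k] of [x] and [w] then fixes both and leaves the conjugate of [g1] by [n]
   unchanged. *)
have [z oz] := orbit_avoid [:: x; wact x n^-1%g].
rewrite !inE negb_or => /andP[zx zn].
have nzx : wact z n != x by rewrite -[X in _ != X](wactVK n) (inj_eq (@wact_inj n)).
have [w ow] := orbit_avoid [:: x; z; wact x n; wact z n].
rewrite !inE !negb_or => /and4P[wx wz wy wnz].
have [g1 t1] := is_tr_exists ox oz.
have [k tk] := is_tr_exists ox ow.
have t2 := is_tr_conj n t1.
have f12 : f (g1 ^ n)%g = f g1 by rewrite fJ fn conjg1.
have kx : wact x k = w by rewrite (is_tr_act _ tk) eqxx.
have kz : wact z k = z by rewrite (is_tr_act _ tk) (negPf zx) eq_sym (negPf wz).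
have t3 := is_tr_conj k t1; rewrite kx kz in t3.
have t4 := is_tr_conj k t2.
rewrite !(is_tr_act _ tk) (negPf nx) (negPf nzx) in t4.
rewrite ![_ == w]eq_sym (negPf wy) (negPf wnz) in t4.
have e4 := is_tr_uniq t4 t2.
have f3 : f (g1 ^ k)%g = f g1 by rewrite fJ -f12 -fJ e4.
have [|c [cx cz cw]] := @orbit_3transitive x z w a b d ox oz ow oa ob od _ abd.
  by rewrite /= !inE negb_or ![x == _]eq_sym zx wx eq_sym wz.
have t5 := is_tr_conj c t1; rewrite cx cz in t5.
have t6 := is_tr_conj c t3; rewrite cw cz in t6.
rewrite (is_tr_uniq tg t5) (is_tr_uniq th t6) -conjMg fJ gmulfM f3 -gmulfM (is_tr_sq t1).
by rewrite f1 conj1g.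
Qed.

End AmenableQuotient.

Lemma wgroup_not_residually_amenable (R : realType) : ~ residually_amenable R wgroup.
Proof.
have [b ob] := orbit_avoid [:: base]; rewrite inE => bb.
have [d od] := orbit_avoid [:: base; b]; rewrite !inE negb_or => /andP[db1 db].
have [g tg] := is_tr_exists orbit_base ob.
have [h th] := is_tr_exists od ob.
have u3 : uniq [:: base; b; d].
  by rewrite /= !inE negb_or ![base == _]eq_sym bb db1 eq_sym db.
have gh1 : (g * h)%g <> 1%g.
  move=> e; have := wact1 base; rewrite -e wactM (is_tr_act _ tg) eqxx.
  by rewrite (is_tr_act _ th) [b == d]eq_sym (negPf db) eqxx => /eqP; rewrite (negPf db1).
move=> /(_ _ gh1)[Q [f [amQ fsurj fgh]]].
have ker n x : orbit x -> f n = 1%g -> wact x n = x.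
  move=> ox fn; apply/eqP/negP => /negP nx; apply: fgh.
  exact: (kernel_three_cycle ox fn nx orbit_base ob od u3 tg th).
have feq x g1 g2 : orbit x -> f g1 = f g2 -> wact x g1^-1%g = wact x g2^-1%g.
  move=> ox e; apply: (@wact_inj g1); rewrite wactVK -wactM; apply/esym/ker => //.
  by apply: (mulgI (f g2)); rewrite -gmulfM mulKVg mulg1.
pose V (p : Z2) := `|p.1| <= `|p.2| /\ p.2 != 0.
pose U (p : Z2) := `|p.2| <= `|p.1| /\ p.1 != 0.
(* [wact] is a right action, so inverses convert left multiplication in [Q] into motion along the
   orbit. By [feq] the choice of preimage is immaterial. *)
pose lift (P : Z2 -> Prop) : set Q :=
  [set q | exists2 g1, f g1 = q & P (wact base g1^-1%g)].
have liftM (P : Z2 -> Prop) g1 k :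
    lift P (f k * f g1)%g -> P (wact (wact base g1^-1%g) k^-1%g).
  move=> [g2 e]; rewrite -gmulfM in e; rewrite (feq _ _ _ orbit_base e) invMg wactM.
  exact.
(* The flag selects inverse shears, so that the inverses acting on the orbit add [3] with a positive
   sign. *)
pose la : wgroup := wof [:: (Some true, true)].
pose lb : wgroup := wof [:: (Some false, true)].
have laE p : wact p la^-1%g = (p.1 + 3 * p.2, p.2).
  have -> : la^-1%g = wof [:: (Some true, false)].
    by rewrite -[RHS]/(wof (word_inv [:: (Some true, true)])) wofV.
  by rewrite wact_of /= mul1r.
have lbE p : wact p lb^-1%g = (p.1, p.2 + 3 * p.1).
  have -> : lb^-1%g = wof [:: (Some false, false)].
    by rewrite -[RHS]/(wof (word_inv [:: (Some false, true)])) wofV.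
  by rewrite wact_of /= mul1r.
apply: (@amenable_no_three_translates R Q (lift V) (lift U) (f la) (f lb)) => //.
- move=> q; have [g1 g1q] := fsurj q.
  have : wact base g1^-1%g != (0, 0) by exact: run_neq0.
  case E : (wact base g1^-1%g) => [x y] xy.
  have [xley|yltx] := leP `|x| `|y|; [left|right]; exists g1 => //; rewrite E /V /U /=;
    split=> //.
  + apply: contraNneq xy => y0; move: xley; rewrite y0 normr0 normr_le0 => /eqP ->.
    by [].
  + exact: ltW.
  + by rewrite -normr_gt0 (le_lt_trans _ yltx).
- move=> _ [g1 <- [Vx Vy]]; split=> [|h2].
    by move=> /liftM; rewrite laE => -[/= h2 _]; exact: (norm_shift_gt Vx Vy _ h2).
  rewrite -gmulfM in h2; move/liftM: h2; rewrite invMg wactM !laE => -[/= h2 _].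
  by apply: (norm_shift_gt (t := 3 + 3) Vx Vy) => //; rewrite mulrDl addrA.
- move=> _ [g1 <- [Ux Uy]]; split=> [|h2].
    by move=> /liftM; rewrite lbE => -[/= h2 _]; exact: (norm_shift_gt Ux Uy _ h2).
  rewrite -gmulfM in h2; move/liftM: h2; rewrite invMg wactM !lbE => -[/= h2 _].
  by apply: (norm_shift_gt (t := 3 + 3) Ux Uy) => //; rewrite mulrDl addrA.
Qed.

Theorem corollary3p1 (R : realType) :
  (exists G : groupType,
     [/\ countable [set: G], simple_group G, ~ amenable R G &
         hyperlinear R G]) /\
  (exists G : groupType,
     [/\ finitely_generated G, hyperlinear R G &
         ~ residually_amenable R G]).
Proof.
split.
  exists psl; split; [exact: psl_countable | exact: psl_simple | |].
    exact: psl_not_amenable.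
  exact: psl_hyperlinear.
exists wgroup; split; first exact: wgroup_fg.
  exact: wgroup_hyperlinear.
exact: wgroup_not_residually_amenable.
Qed.
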